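(* Let $L\in\mathcal{L}$ be such that $L$ and $L^*$ have order continuous norms. Let $\alpha_1,\dots,\alpha_m$ be positive numbers with $\sum_{j=1}^m\alpha_j\ge1$, let $n\in\mathbb{N}$, let $r\in\{\rho_{ess},\hat\rho_{ess}\}$, and let $\Psi_1,\dots,\Psi_m$ and $\{\Psi_{ij}\}_{i=1,\dots,k;\ j=1,\dots,m}$ be bounded sets of nonnegative matrices that define operators on $L$. Then $$r(\Psi_1^{(\alpha_1)}\circ\cdots\circ\Psi_m^{(\alpha_m)})\le r((\Psi_1^n)^{(\alpha_1)}\circ\cdots\circ(\Psi_m^n)^{(\alpha_m)})^{1/n}\le r(\Psi_1)^{\alpha_1}\cdots r(\Psi_m)^{\alpha_m},$$ and $$r\left(\left(\Psi_{11}^{(\alpha_1)}\circ\cdots\circ\Psi_{1m}^{(\alpha_m)}\right)\cdots\left(\Psi_{k1}^{(\alpha_1)}\circ\cdots\circ\Psi_{km}^{(\alpha_m)}\right)\right)\le r\left((\Psi_{11}\cdots\Psi_{k1})^{(\alpha_1)}\circ\cdots\circ(\Psi_{1m}\cdots\Psi_{km})^{(\alpha_m)}\right)$$ $$\le r\left(((\Psi_{11}\cdots\Psi_{k1})^n)^{(\alpha_1)}\circ\cdots\circ((\Psi_{1m}\cdots\Psi_{km})^n)^{(\alpha_m)}\right)^{1/n}\le r(\Psi_{11}\cdots\Psi_{k1})^{\alpha_1}\cdots r(\Psi_{1m}\cdots\Psi_{km})^{\alpha_m}.$$ In particular, if $\Psi_1,\dots,\Psi_k$ are bounded sets of nonnegative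 matrices that define operators on $L$ and $t\ge1$, then $$r(\Psi_1^{(t)}\cdots\Psi_k^{(t)})\le r((\Psi_1\cdots\Psi_k)^{(t)})\le r(((\Psi_1\cdots\Psi_k)^n)^{(t)})^{1/n}\le r(\Psi_1\cdots\Psi_k)^t.$$
   Context: Let $R=\mathbb{N}$ or $R=\{1,\dots,N\}$. A Banach sequence space is a Banach space $L$ of complex sequences indexed by $R$ such that if $x$ is a complex sequence, $y\in L$ and $|x|\le|y|$ entrywise, then $x\in L$ and $\|x\|_L\le\|y\|_L$. $\mathcal{L}$ is the class of Banach sequence spaces containing every standard unit vector $e_n$ with $\|e_n\|_L=1$. A Banach lattice has order continuous norm if every decreasing net $0\le f_\alpha\downarrow0$ satisfies $\|f_\alpha\|\to0$; $L^*$ is the Banach dual of $L$. A nonnegative matrix $A=[a_{ij}]$ defines an operator on $L$ if $(Ax)_i=\sum_j a_{ij}x_j$ converges absolutely and $Ax\in L$ for all $x\in L$. Hadamard power $A^{(t)}=[a_{ij}^t]$, Hadamard product $A\circ B=[a_{ij}b_{ij}]$. For sets: $\Psi\Sigma=\{AB: A\in\Psi,B\in\Sigma\}$, $\Psi^n=\{A_1\cdots A_n: A_i\in\Psi\}$, $\Psi^{(t)}=\{A^{(t)}:A\in\Psi\}$, and $\Psi_1^{(\alpha_1)}\circ\cdots\circ\Psi_m^{(\alpha_m)}=\{A_1^{(\alpha_1)}\circ\cdots\circ A_m^{(\alpha_m)}: A_j\in\Psi_j\}$ (these are bounded sets of nonnegative matrices defining operators on $L$ when $\sum\alpha_j\ge1$).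 $\gamma(T)$ is the Hausdorff measure of noncompactness $\inf\{\delta>0: T(D_L)\subseteq M+\delta D_L$ for some finite $M\subset L\}$, $\rho_{ess}(T)$ the essential spectral radius. For a bounded set $\Sigma$ of operators: the generalized essential spectral radius is $\rho_{ess}(\Sigma)=\limsup_{m\to\infty}[\sup_{A\in\Sigma^m}\rho_{ess}(A)]^{1/m}=\sup_m[\sup_{A\in\Sigma^m}\rho_{ess}(A)]^{1/m}$ and the joint essential spectral radius is $\hat\rho_{ess}(\Sigma)=\lim_{m\to\infty}[\sup_{A\in\Sigma^m}\gamma(A)]^{1/m}$. *)

(* Defs.v *)
From Stdlib Require Import Reals Lra List.
From Coquelicot Require Import Coquelicot.
Open Scope R_scope.

(* ---------- index set R = N (None) or {1,...,N} (Some N), encoded as {0..N-1} ---------- *)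
Definition idx (N : option nat) (i : nat) : Prop :=
  match N with None => True | Some n => (i < n)%nat end.

Definition seqC := nat -> C.
Definition szero : seqC := fun _ => RtoC 0.
Definition sadd (x y : seqC) : seqC := fun i => Cplus (x i) (y i).
Definition sscal (c : C) (x : seqC) : seqC := fun i => Cmult c (x i).
Definition ssub (x y : seqC) : seqC := fun i => Cminus (x i) (y i).
Definition unitv (n : nat) : seqC := fun i => if Nat.eqb i n then RtoC 1 else RtoC 0.

Record BSS (N : option nat) (L : seqC -> Prop) (nrm : seqC -> R) : Prop := {
  bss_supp : forall x, L x -> forall i, ~ idx N i -> x i = RtoC 0;
  bss_zero : L szero;
  bss_add : forall x y, L x -> L y -> L (sadd x y);
  bss_scal : forall c x, L x -> L (sscal c x);
  bss_nrm_nonneg : forall x, L x -> 0 <= nrm x;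
  bss_nrm_def : forall x, L x -> nrm x = 0 -> x = szero;
  bss_nrm_tri : forall x y, L x -> L y -> nrm (sadd x y) <= nrm x + nrm y;
  bss_nrm_scal : forall c x, L x -> nrm (sscal c x) = Cmod c * nrm x;
  bss_complete : forall u : nat -> seqC, (forall k, L (u k)) ->
      (forall eps, 0 < eps -> exists K, forall p q, (K <= p)%nat -> (K <= q)%nat ->
          nrm (ssub (u p) (u q)) < eps) ->
      exists x, L x /\ forall eps, 0 < eps -> exists K, forall p, (K <= p)%nat ->
          nrm (ssub (u p) x) < eps;
  bss_ideal : forall x y, L y -> (forall i, Cmod (x i) <= Cmod (y i)) ->
      L x /\ nrm x <= nrm y
}.

Definition in_classL (N : option nat) (L : seqC -> Prop) (nrm : seqC -> R) : Prop :=
  BSS N L nrm /\ forall n, idx N n -> L (unitv n) /\ nrm (unitv n) = 1.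

Definition spos (x : seqC) : Prop := forall i, Im (x i) = 0 /\ 0 <= Re (x i).
Definition ord_le (x y : seqC) : Prop := spos (ssub y x).

Definition directed {D : Type} (le : D -> D -> Prop) : Prop :=
  (exists d : D, True) /\ (forall a, le a a) /\
  (forall a b c, le a b -> le b c -> le a c) /\
  (forall a b, exists c, le a c /\ le b c).

Definition order_continuous (L : seqC -> Prop) (nrm : seqC -> R) : Prop :=
  forall (D : Type) (le : D -> D -> Prop) (f : D -> seqC),
    directed le ->
    (forall a, L (f a) /\ spos (f a)) ->
    (forall a b, le a b -> ord_le (f b) (f a)) ->
    (forall z, L z -> (forall a, ord_le z (f a)) -> ord_le z szero) ->
    forall eps, 0 < eps -> exists a0, forall a, le a0 a -> nrm (f a) < eps.

(* Banach dual L^* : bounded linear functionals on L (identified when equal on L) *)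
Definition in_dual (L : seqC -> Prop) (nrm : seqC -> R) (phi : seqC -> C) : Prop :=
  (forall x y, L x -> L y -> phi (sadd x y) = Cplus (phi x) (phi y)) /\
  (forall c x, L x -> phi (sscal c x) = Cmult c (phi x)) /\
  (exists M, forall x, L x -> Cmod (phi x) <= M * nrm x).

Definition dual_le (L : seqC -> Prop) (phi psi : seqC -> C) : Prop :=
  forall x, L x -> spos x ->
    Im (Cminus (psi x) (phi x)) = 0 /\ Re (phi x) <= Re (psi x).

Definition dual_zero : seqC -> C := fun _ => RtoC 0.

(* order continuous norm on L^* (the dual norm of phi is <= eps iff
   |phi x| <= eps ||x|| for all x in L) *)
Definition dual_order_continuous (L : seqC -> Prop) (nrm : seqC -> R) : Prop :=
  forall (D : Type) (le : D -> D -> Prop) (phi : D -> seqC -> C),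
    directed le ->
    (forall a, in_dual L nrm (phi a) /\ dual_le L dual_zero (phi a)) ->
    (forall a b, le a b -> dual_le L (phi b) (phi a)) ->
    (forall chi, in_dual L nrm chi -> (forall a, dual_le L chi (phi a)) ->
        dual_le L chi dual_zero) ->
    forall eps, 0 < eps -> exists a0, forall a, le a0 a ->
      forall x, L x -> Cmod (phi a x) <= eps * nrm x.

Section Ops.
Variables (L : seqC -> Prop) (nrm : seqC -> R).

Definition bop (T : seqC -> seqC) : Prop :=
  (forall x, L x -> L (T x)) /\
  (forall x y, L x -> L y -> T (sadd x y) = sadd (T x) (T y)) /\
  (forall c x, L x -> T (sscal c x) = sscal c (T x)) /\
  (exists M, forall x, L x -> nrm (T x) <= M * nrm x).

(* compact operator: image of the closed unit ball is relatively compact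
   (= totally bounded, L being complete) *)
Definition compact_op (T : seqC -> seqC) : Prop :=
  bop T /\
  forall eps, 0 < eps -> exists M : list seqC, List.Forall L M /\
    forall x, L x -> nrm x <= 1 -> exists m, In m M /\ nrm (ssub (T x) m) <= eps.

Definition gamma (T : seqC -> seqC) : R :=
  real (Glb_Rbar (fun d => 0 < d /\ exists M : list seqC, List.Forall L M /\
    forall x, L x -> nrm x <= 1 -> exists m, In m M /\
      exists y, L y /\ nrm y <= 1 /\ T x = sadd m (sscal (RtoC d) y))).

(* essential spectrum: lambda I - T is not invertible modulo compact operators
   (spectrum in the Calkin algebra) *)
Definition ess_spec (T : seqC -> seqC) (lam : C) : Prop :=
  ~ exists S K1 K2, bop S /\ compact_op K1 /\ compact_op K2 /\
      forall x, L x ->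
        ssub (sscal lam (S x)) (T (S x)) = sadd x (K1 x) /\
        S (ssub (sscal lam x) (T x)) = sadd x (K2 x).

(* supremum of a set of reals (0 for the empty set) *)
Definition supR (E : R -> Prop) : R := real (Lub_Rbar (fun r => r = 0 \/ E r)).

Definition ess_rad (T : seqC -> seqC) : R :=
  supR (fun r => exists lam, ess_spec T lam /\ r = Cmod lam).
End Ops.

Definition mat := nat -> nat -> R.

Definition nonneg_mat (N : option nat) (A : mat) : Prop :=
  forall i j, 0 <= A i j /\ ((~ idx N i \/ ~ idx N j) -> A i j = 0).

Definition matop (A : mat) (x : seqC) : seqC :=
  fun i => (Series (fun j => A i j * Re (x j)), Series (fun j => A i j * Im (x j))).

Definition defines_op (L : seqC -> Prop) (A : mat) : Prop :=
  forall x, L x ->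
    (forall i, ex_series (fun j => Rabs (A i j) * Cmod (x j))) /\ L (matop A x).

Definition bounded_set (N : option nat) (L : seqC -> Prop) (nrm : seqC -> R)
    (Psi : mat -> Prop) : Prop :=
  (forall A, Psi A -> nonneg_mat N A /\ defines_op L A) /\
  exists M, forall A x, Psi A -> L x -> nrm (matop A x) <= M * nrm x.

Definition matmul (A B : mat) : mat := fun i j => Series (fun k => A i k * B k j).

(* Hadamard power with the convention 0^t = 0 (t > 0) *)
Definition hpow (a t : R) : R := if Rle_dec a 0 then 0 else Rpower a t.
Definition hmat (A : mat) (t : R) : mat := fun i j => hpow (A i j) t.

Fixpoint prodR (m : nat) (f : nat -> R) : R :=
  match m with O => 1 | S m' => prodR m' f * f m' end.
Fixpoint sumR (m : nat) (f : nat -> R) : R :=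
  match m with O => 0 | S m' => sumR m' f + f m' end.

Definition mset := mat -> Prop.

Definition setmul (P S : mset) : mset :=
  fun C => exists A B, P A /\ S B /\ C = matmul A B.

(* Psi^n = {A_1 ... A_n}, for n >= 1 (the value at n = 0 is junk and never used) *)
Fixpoint setpow (P : mset) (n : nat) : mset :=
  match n with
  | O => P
  | S O => P
  | S n' => setmul (setpow P n') P
  end.

(* Phi_0 Phi_1 ... Phi_{k-1}, for k >= 1 (k = 0 is junk) *)
Fixpoint setprodS (Phi : nat -> mset) (k : nat) : mset :=
  match k with O => Phi O | S k' => setmul (setprodS Phi k') (Phi k) end.
Definition setprod (k : nat) (Phi : nat -> mset) : mset := setprodS Phi (k - 1).

Definition setHpow (P : mset) (t : R) : mset :=
  fun C => exists A, P A /\ C = hmat A t.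

Definition hadset (m : nat) (Psi : nat -> mset) (alpha : nat -> R) : mset :=
  fun C => exists As : nat -> mat, (forall j, (j < m)%nat -> Psi j (As j)) /\
    C = fun i l => prodR m (fun j => hpow (As j i l) (alpha j)).

Definition gen_ess_rad (L : seqC -> Prop) (nrm : seqC -> R) (Sig : mset) : R :=
  real (LimSup_seq (fun m =>
    hpow (supR (fun r => exists A, setpow Sig (S m) A /\ r = ess_rad L nrm (matop A)))
         (/ INR (S m)))).

Definition joint_ess_rad (L : seqC -> Prop) (nrm : seqC -> R) (Sig : mset) : R :=
  real (Lim_seq (fun m =>
    hpow (supR (fun r => exists A, setpow Sig (S m) A /\ r = gamma L nrm (matop A)))
         (/ INR (S m)))).

(* Main.v *)
(** Since the norm of [L] is order continuous, [gamma T] is the limit of the norms of [Q_k T],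
    where [Q_k] cuts off the first [k] coordinates; as [T - Q_k T] has finite rank, [gamma] is
    also the norm of the Calkin algebra.  Hence [gamma] is monotone on nonnegative matrices and
    satisfies the Hoelder-type inequality for Hadamard products, both of which are norm
    inequalities for the tails; when the weights sum to more than 1 one uses that the entries
    of a matrix are bounded by its norm, the unit vectors having norm 1.

    The essential spectral radius of a nonnegative matrix [A] equals [lim gamma (A^n) ^ (1/n)],
    the joint essential spectral radius of the singleton of [A].  So each of the two radii [r]
    is monotone for entrywise domination, satisfies [r (S^n) = r S ^ n], and is
    submultiplicative for weighted Hadamard products.  Together with the entrywise inequality
    (product of Hadamard products) <= (Hadamard product of products), these three properties
    give all the chains of inequalities. *)

(* The obstacle is the identity between [ess_rad] and the growth rate of [gamma]. Its usual proof is
   the spectral radius formula in the Calkin algebra, which needs analytic functions with values in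
   a quotient. Positivity replaces it: the growth rate J is shown to be itself a point of the
   essential spectrum, by finite sums of powers of the matrix, and above J a cut-off matrix has a
   Neumann inverse. From this, [ess_rad] inherits monotonicity, which its definition hides, and the
   rule for powers without a spectral mapping theorem.

   The joint radius is handled through bounds gamma A <= C t^n for A in S^n, with t strictly above
   the radius. The constant C disappears on taking n-th roots, and strictness avoids dividing by a
   radius that may be 0; right continuity of the powers then lets t decrease to the radius.

   Each Hadamard inequality is a weighted arithmetic-geometric mean inequality for factors
   normalized to be at most 1. Infinite matrices multiply associatively only where the series
   converge, so norm bounds accompany all manipulations of products. *)
From Stdlib Require Import Reals Arith List Lra Lia.
From Stdlib Require Import Classical ClassicalEpsilon FunctionalExtensionality PropExtensionality.
From Coquelicot Require Import Coquelicot.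
Require Import Defs.
Open Scope R_scope.

(** * Powers, weighted products and Fekete's lemma *)

Lemma hpow_pos_eq (a t : R) : 0 < a -> hpow a t = Rpower a t.
Proof. intro H; unfold hpow; destruct (Rle_dec a 0); lra. Qed.

Lemma hpow_le0 (a t : R) : a <= 0 -> hpow a t = 0.
Proof. intro H; unfold hpow; destruct (Rle_dec a 0); lra. Qed.

Lemma hpow_gt0 (a t : R) : 0 < a -> 0 < hpow a t.
Proof. intro H; rewrite (hpow_pos_eq _ _ H); apply exp_pos. Qed.

Lemma hpow_ge0 (a t : R) : 0 <= hpow a t.
Proof.
  destruct (Rlt_le_dec 0 a) as [H|H].
  - left; now apply hpow_gt0.
  - rewrite (hpow_le0 _ _ H); lra.
Qed.

Lemma hpow_le (a b t : R) : 0 <= t -> a <= b -> hpow a t <= hpow b t.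
Proof.
  intros Ht Hab. destruct (Rlt_le_dec 0 a) as [H|H].
  - rewrite !hpow_pos_eq by lra. apply Rle_Rpower_l; lra.
  - rewrite (hpow_le0 _ _ H). apply hpow_ge0.
Qed.

Lemma hpow_mult (a b t : R) : 0 <= a -> 0 <= b -> hpow (a * b) t = hpow a t * hpow b t.
Proof.
  intros [Ha|<-] [Hb|<-].
  - rewrite !hpow_pos_eq by nra. symmetry; now apply Rpower_mult_distr.
  - rewrite Rmult_0_r, !(hpow_le0 0) by lra. ring.
  - rewrite Rmult_0_l, !(hpow_le0 0) by lra. ring.
  - rewrite Rmult_0_r, !(hpow_le0 0) by lra. ring.
Qed.

Lemma hpow_pow (a t : R) (n : nat) : 0 <= a -> (1 <= n)%nat -> hpow (a ^ n) t = hpow a t ^ n.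
Proof.
  intros Ha Hn. induction n as [|[|n] IH]; [lia| |].
  - now rewrite !pow_1.
  - rewrite <- (tech_pow_Rmult a), <- (tech_pow_Rmult (hpow a t)), hpow_mult, IH; auto with arith.
    now apply pow_le.
Qed.

Lemma hpow_1 (a : R) : 0 <= a -> hpow a 1 = a.
Proof.
  intros [H|<-]; [rewrite hpow_pos_eq, Rpower_1 | rewrite hpow_le0]; lra.
Qed.

Lemma hpow_hpow (a s t : R) : hpow (hpow a s) t = hpow a (s * t).
Proof.
  destruct (Rlt_le_dec 0 a) as [H|H].
  - rewrite (hpow_pos_eq (hpow a s)) by now apply hpow_gt0.
    rewrite !hpow_pos_eq by assumption. apply Rpower_mult.
  - rewrite (hpow_le0 a) by assumption. rewrite !hpow_le0; lra.
Qed.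

Lemma hpow_INR (a : R) (n : nat) : 0 <= a -> (1 <= n)%nat -> hpow a (INR n) = a ^ n.
Proof.
  intros [H|<-] Hn.
  - rewrite hpow_pos_eq by assumption. now apply Rpower_pow.
  - rewrite hpow_le0, pow_i; auto with arith; lra.
Qed.

Lemma hpow_root_pow (a : R) (n : nat) : 0 <= a -> (1 <= n)%nat -> hpow a (/ INR n) ^ n = a.
Proof.
  intros Ha Hn. rewrite <- hpow_INR by (trivial; apply hpow_ge0).
  rewrite hpow_hpow, Rinv_l, hpow_1; trivial. apply not_0_INR; lia.
Qed.

Lemma hpow_pow_root (a : R) (n : nat) : 0 <= a -> (1 <= n)%nat -> hpow (a ^ n) (/ INR n) = a.
Proof.
  intros Ha Hn. rewrite <- hpow_INR by trivial.
  rewrite hpow_hpow, Rinv_r, hpow_1; trivial. apply not_0_INR; lia.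
Qed.

Lemma pow_lt_cancel (a b : R) (n : nat) : 0 <= b -> a ^ n < b ^ n -> a < b.
Proof.
  intros Hb H. apply Rnot_le_lt; intro C.
  assert (b ^ n <= a ^ n) by (apply pow_incr; lra). lra.
Qed.

Lemma pow_le_cancel (a b : R) (n : nat) :
  (1 <= n)%nat -> 0 <= a -> 0 <= b -> a ^ n <= b ^ n -> a <= b.
Proof.
  intros Hn Ha Hb H.
  rewrite <- (hpow_pow_root a n), <- (hpow_pow_root b n) by assumption.
  apply hpow_le; trivial. left; apply Rinv_0_lt_compat, lt_0_INR; lia.
Qed.

Lemma hpow_right_continuous (a t : R) :
  0 <= a -> 0 < t -> is_lim_seq (fun k => hpow (a + / INR (S k)) t) (hpow a t).
Proof.
  intros Ha Ht.
  assert (Hinv : is_lim_seq (fun k => / INR (S k)) 0).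
  { apply (is_lim_seq_ext (fun k => 1 / INR (S k))); [intro; unfold Rdiv; ring|].
    apply (is_lim_seq_incr_1 (fun k => 1 / INR k)).
    apply (is_lim_seq_ext (fun k => / INR k)); [intro; unfold Rdiv; ring|].
    replace (Finite 0) with (Rbar_inv p_infty) by reflexivity.
    apply is_lim_seq_inv; [apply is_lim_seq_INR | discriminate]. }
  assert (Hpos : forall k, 0 < / INR (S k))
    by (intro k; apply Rinv_0_lt_compat, lt_0_INR; lia).
  destruct Ha as [Ha|<-].
  - rewrite hpow_pos_eq by assumption.
    apply (is_lim_seq_ext (fun k => Rpower (a + / INR (S k)) t)).
    { intro k. specialize (Hpos k). rewrite hpow_pos_eq; lra. }
    unfold Rpower. apply (is_lim_seq_continuous (fun x => exp (t * ln x))).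
    + apply continuity_pt_filterlim.
      apply (continuous_comp (fun x => t * ln x) exp).
      * apply (continuous_mult (fun _ : R => t) ln); [apply continuous_const|].
        apply continuity_pt_filterlim, derivable_continuous_pt.
        exists (/ a). now apply derivable_pt_lim_ln.
      * apply continuity_pt_filterlim, derivable_continuous_pt, derivable_pt_exp.
    + replace (Finite a) with (Finite (a + 0)) by (f_equal; ring).
      apply is_lim_seq_plus'; [apply is_lim_seq_const | apply Hinv].
  - rewrite (hpow_le0 0) by lra.
    apply is_lim_seq_spec. intros eps.
    (* At a = 0 the modulus of continuity is eps^(1/t), whose t-th power is eps. *)
    assert (He : 0 < hpow eps (/ t)) by (apply hpow_gt0, cond_pos).
    apply is_lim_seq_spec in Hinv.
    destruct (Hinv (mkposreal _ He)) as [K HK]. exists K. intros k Hk.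
    specialize (HK k Hk). simpl pos in HK. rewrite Rminus_0_r in *.
    rewrite Rabs_pos_eq in HK by (left; apply Hpos).
    rewrite Rabs_pos_eq by apply hpow_ge0. rewrite Rplus_0_l.
    assert (Hp := Hpos k).
    replace (pos eps) with (hpow (hpow eps (/ t)) t).
    + rewrite !(hpow_pos_eq _ t) by assumption.
      unfold Rpower at 1 2. apply exp_increasing, Rmult_lt_compat_l; trivial.
      now apply ln_increasing.
    + rewrite hpow_hpow, Rinv_l by lra. apply hpow_1. left; apply cond_pos.
Qed.

(** * Finite products and sums, weighted means *)

Lemma prodR_ext (m : nat) (f g : nat -> R) :
  (forall j, (j < m)%nat -> f j = g j) -> prodR m f = prodR m g.
Proof. induction m; simpl; intro H; auto. rewrite IHm, H; auto with arith. Qed.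

Lemma prodR_ge0 (m : nat) (f : nat -> R) :
  (forall j, (j < m)%nat -> 0 <= f j) -> 0 <= prodR m f.
Proof. induction m; simpl; intro H; [lra|]. apply Rmult_le_pos; auto. Qed.

Lemma prodR_gt0 (m : nat) (f : nat -> R) :
  (forall j, (j < m)%nat -> 0 < f j) -> 0 < prodR m f.
Proof. induction m; simpl; intro H; [lra|]. apply Rmult_lt_0_compat; auto. Qed.

Lemma prodR_le (m : nat) (f g : nat -> R) :
  (forall j, (j < m)%nat -> 0 <= f j <= g j) -> prodR m f <= prodR m g.
Proof.
  induction m; simpl; intro H; [lra|].
  apply Rmult_le_compat; try apply H; auto.
  apply prodR_ge0. intros j Hj. now apply H, Nat.lt_lt_succ_r.
Qed.

Lemma prodR_mult (m : nat) (f g : nat -> R) :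
  prodR m (fun j => f j * g j) = prodR m f * prodR m g.
Proof. induction m; simpl; [ring|]. rewrite IHm; ring. Qed.

Lemma prodR_pow (m n : nat) (f : nat -> R) : prodR m (fun j => f j ^ n) = prodR m f ^ n.
Proof.
  induction m; simpl; [now rewrite pow1|]. now rewrite IHm, Rpow_mult_distr.
Qed.

Lemma prodR_zero (m : nat) (f : nat -> R) :
  (exists j, (j < m)%nat /\ f j = 0) -> prodR m f = 0.
Proof.
  induction m; simpl; intros (j & Hj & E); [lia|].
  destruct (Nat.eq_dec j m) as [->|Hne]; [rewrite E; ring|].
  rewrite IHm; [ring|]. exists j; split; trivial; lia.
Qed.

Lemma sumR_le (m : nat) (f g : nat -> R) :
  (forall j, (j < m)%nat -> f j <= g j) -> sumR m f <= sumR m g.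
Proof. induction m; simpl; intro H; [lra|]. apply Rplus_le_compat; auto. Qed.

Lemma sumR_ext (m : nat) (f g : nat -> R) :
  (forall j, (j < m)%nat -> f j = g j) -> sumR m f = sumR m g.
Proof. induction m; simpl; intro H; auto. rewrite IHm, H; auto with arith. Qed.

Lemma sumR_ge0 (m : nat) (f : nat -> R) :
  (forall j, (j < m)%nat -> 0 <= f j) -> 0 <= sumR m f.
Proof. induction m; simpl; intro H; [lra|]. apply Rplus_le_le_0_compat; auto. Qed.

Lemma sumR_plus (m : nat) (f g : nat -> R) :
  sumR m (fun j => f j + g j) = sumR m f + sumR m g.
Proof. induction m; simpl; [ring|]. rewrite IHm; ring. Qed.

Lemma sumR_scal (m : nat) (c : R) (f : nat -> R) :
  sumR m (fun j => c * f j) = c * sumR m f.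
Proof. induction m; simpl; [ring|]. rewrite IHm; ring. Qed.

Lemma sumR_nonpos (m : nat) (f : nat -> R) :
  (forall j, (j < m)%nat -> f j <= 0) -> sumR m f <= 0.
Proof.
  induction m; simpl; intro H; [lra|].
  assert (f m <= 0) by auto. assert (sumR m f <= 0) by auto. lra.
Qed.

Lemma sumR_pos_size (m : nat) (f : nat -> R) : 1 <= sumR m f -> (1 <= m)%nat.
Proof. destruct m; simpl; [lra | lia]. Qed.

(* The weights exceed 1 in total, but as the [y j] are at most 1 this only lowers the product. *)
Lemma prod_hpow_le_mean (m : nat) (alpha y : nat -> R) :
  (forall j, (j < m)%nat -> 0 < alpha j) -> 1 <= sumR m alpha ->
  (forall j, (j < m)%nat -> 0 <= y j <= 1) ->
  prodR m (fun j => hpow (y j) (alpha j)) <= sumR m (fun j => alpha j / sumR m alpha * y j).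
Proof.
  intros Ha Hs Hy. set (s := sumR m alpha) in *.
  destruct (classic (exists j, (j < m)%nat /\ y j = 0)) as [(j & Hj & E)|Hnz].
  { rewrite prodR_zero.
    - apply sumR_ge0. intros i Hi. apply Rmult_le_pos; [|now apply Hy].
      apply Rlt_le, Rdiv_lt_0_compat; [auto|lra].
    - exists j; split; trivial. apply hpow_le0; lra. }
  assert (Hp : forall j, (j < m)%nat -> 0 < y j).
  { intros j Hj. destruct (Hy j Hj) as [[H|H] _]; trivial.
    exfalso; apply Hnz; exists j; auto. }
  set (E := sumR m (fun j => alpha j * ln (y j))).
  assert (HE : prodR m (fun j => hpow (y j) (alpha j)) = exp E).
  { unfold E. clear - Hp. induction m; simpl; [now rewrite exp_0|].
    rewrite exp_plus, IHm by auto. f_equal. now rewrite hpow_pos_eq by auto. }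
  assert (HE0 : E <= 0).
  { apply sumR_nonpos. intros j Hj. assert (ln (y j) <= 0).
    { rewrite <- ln_1. destruct (Hy j Hj) as [_ [H|H]].
      - left; apply ln_increasing; auto.
      - rewrite H; lra. }
    specialize (Ha j Hj). nra. }
  rewrite HE.
  apply Rle_trans with (exp (E / s)).
  { assert (E <= E / s).
    { apply (Rmult_le_reg_r s); [lra|]. unfold Rdiv. rewrite Rmult_assoc, Rinv_l by lra. nra. }
    destruct H as [H|H]; [left; now apply exp_increasing | right; now f_equal]. }
  (* Weighted mean inequality from the tangent of exp at E / s, the weighted mean of the logarithms:
     y j >= G (1 + ln (y j) - E / s), and in the weighted sum the linear terms cancel, leaving G. *)
  set (G := exp (E / s)). assert (HG : 0 < G) by apply exp_pos.
  apply Rle_trans with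
    (sumR m (fun j => G / s * (1 - E / s) * alpha j + G / s * (alpha j * ln (y j)))).
  - rewrite sumR_plus, !sumR_scal. fold s E. right. field. lra.
  - apply sumR_le. intros j Hj.
    assert (Hyj : y j = G * exp (ln (y j) - E / s)).
    { unfold G. rewrite <- exp_plus.
      replace (E / s + (ln (y j) - E / s)) with (ln (y j)) by ring.
      symmetry; apply exp_ln; auto. }
    rewrite Hyj at 2.
    assert (Hx := exp_ineq1_le (ln (y j) - E / s)).
    replace (G / s * (1 - E / s) * alpha j + G / s * (alpha j * ln (y j)))
      with (alpha j / s * (G * (1 + (ln (y j) - E / s)))) by (field; lra).
    apply Rmult_le_compat_l; [apply Rlt_le, Rdiv_lt_0_compat; auto; lra|].
    apply Rmult_le_compat_l; lra.
Qed.

(** Take t j = a j + 1/(k+1) and let k grow: right continuity suffices, and it covers a j = 0. This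
    passes from bounds valid strictly above a radius to the radius itself. *)
Lemma prod_hpow_le_of_lt (m : nat) (alpha a : nat -> R) (x : R) :
  (forall j, (j < m)%nat -> 0 < alpha j) ->
  (forall j, (j < m)%nat -> 0 <= a j) ->
  (forall t, (forall j, (j < m)%nat -> a j < t j) -> x <= prodR m (fun j => hpow (t j) (alpha j))) ->
  x <= prodR m (fun j => hpow (a j) (alpha j)).
Proof.
  intros Ha H0 H.
  assert (Hl : is_lim_seq (fun k => prodR m (fun j => hpow (a j + / INR (S k)) (alpha j)))
                          (prodR m (fun j => hpow (a j) (alpha j)))).
  { clear H x. induction m; simpl; [apply is_lim_seq_const|].
    apply is_lim_seq_mult'; auto. apply hpow_right_continuous; auto. }
  apply (is_lim_seq_le (fun _ => x) _ x _) with (2 := is_lim_seq_const x) (3 := Hl).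
  intro k. apply H. intros j Hj.
  assert (0 < / INR (S k)) by (apply Rinv_0_lt_compat, lt_0_INR; lia). lra.
Qed.

Lemma pow_le_of_lt (n : nat) (a x : R) :
  0 <= a -> (1 <= n)%nat -> (forall t, a < t -> x <= t ^ n) -> x <= a ^ n.
Proof.
  intros Ha Hn H.
  assert (Hp := prod_hpow_le_of_lt 1 (fun _ => INR n) (fun _ => a) x).
  simpl in Hp. rewrite Rmult_1_l, hpow_INR in Hp by assumption.
  apply Hp.
  - intros; apply lt_0_INR; lia.
  - auto.
  - intros t Ht. rewrite Rmult_1_l. rewrite hpow_INR; auto.
    specialize (Ht 0%nat Nat.lt_0_1); lra.
Qed.

(** * Exponential growth rates *)

Lemma pow_ratio_eventually (C s t : R) :
  0 <= s < t -> exists K, forall n, (K <= n)%nat -> C * s ^ n < t ^ n.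
Proof.
  intros [Hs Ht].
  assert (Hq : Rabs (s / t) < 1).
  { rewrite Rabs_pos_eq; [apply Rlt_div_l; lra | apply Rdiv_le_0_compat; lra]. }
  assert (HC : 0 < / (Rabs C + 1)).
  { apply Rinv_0_lt_compat. assert (H := Rabs_pos C). lra. }
  destruct (pow_lt_1_zero _ Hq _ HC) as [K HK].
  exists K. intros n Hn. specialize (HK n Hn).
  rewrite Rabs_pos_eq in HK by (apply pow_le, Rdiv_le_0_compat; lra).
  assert (Htn : 0 < t ^ n) by (apply pow_lt; lra).
  unfold Rdiv in HK. rewrite Rpow_mult_distr, pow_inv in HK.
  assert (Hsn : 0 <= s ^ n) by now apply pow_le.
  assert (HCa := Rle_abs C). assert (HC0 := Rabs_pos C).
  apply (Rmult_lt_compat_r (t ^ n)) in HK; [|lra].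
  rewrite Rmult_assoc, Rinv_l, Rmult_1_r in HK by lra.
  apply (Rmult_lt_compat_l (Rabs C + 1)) in HK; [|lra].
  rewrite <- Rmult_assoc, Rinv_r, Rmult_1_l in HK by lra. nra.
Qed.

(** If t < s, then C t^n < s^n for large n; a constant factor does not affect a growth rate. *)
Lemma pow_growth_le (C s t : R) :
  0 <= s -> 0 <= t -> (forall n, s ^ S n <= C * t ^ S n) -> s <= t.
Proof.
  intros Hs Ht H. apply Rnot_lt_le. intro Hlt.
  destruct (pow_ratio_eventually C t s) as [K HK]; [lra|].
  specialize (HK (S K) (Nat.le_succ_diag_r K)). specialize (H K). lra.
Qed.

(* Fekete's lemma, multiplicative form; [g m] is the term of exponent [m + 1]. *)
Lemma fekete (g : nat -> R) :
  (forall m, 0 <= g m) -> (forall m p, g (S (m + p)) <= g m * g p) ->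
  exists J, 0 <= J /\ is_lim_seq (fun m => hpow (g m) (/ INR (S m))) J /\
    (forall m, J ^ S m <= g m) /\
    (forall t, J < t -> exists C, 0 <= C /\ forall m, g m <= C * t ^ S m).
Proof.
  intros H0 Hsub.
  set (u := fun m => hpow (g m) (/ INR (S m))).
  assert (Hu0 : forall m, 0 <= u m) by (intro; apply hpow_ge0).
  assert (Hupow : forall m, u m ^ S m = g m) by (intro m; apply hpow_root_pow; auto with arith).
  (* J is the infimum of the roots, so J^(m+1) <= g m is immediate and convergence follows from the
     growth bound. *)
  destruct (ex_glb_Rbar (fun x => exists m, x = u m)) as [J [HJlb HJglb]].
  assert (HJ0 : Rbar_le 0 J) by (apply HJglb; intros x [m ->]; apply Hu0).
  assert (HJu : forall m, Rbar_le J (u m)) by (intro m; apply HJlb; exists m; auto).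
  destruct J as [J| |]; [| destruct (HJu 0%nat) | destruct HJ0].
  simpl in HJ0, HJu.
  assert (Hgrow : forall t, J < t -> exists C, 0 <= C /\ forall m, g m <= C * t ^ S m).
  { intros t Ht.
    assert (Hex : exists q, u q < t).
    { apply NNPP. intro Hn. apply (Rlt_not_le _ _ Ht).
      apply (HJglb t). intros x [m ->]. apply Rnot_lt_le. intro; apply Hn; eauto. }
    destruct Hex as [q Hq]. assert (Ht0 : 0 < t) by (specialize (Hu0 q); lra).
    assert (Htp : forall k, 0 < t ^ k) by (intro; now apply pow_lt).
    assert (Hgq : g q <= t ^ S q) by (rewrite <- Hupow; apply pow_incr; split; auto; lra).
    (* This sum dominates each ratio with i <= q, which settles the indices up to q; larger ones
       lose blocks of q + 1 factors, each costing at most t^(q+1). *)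
    set (C := sum_f_R0 (fun i => g i / t ^ S i) q).
    assert (Hterm : forall i, 0 <= g i / t ^ S i) by (intro; apply Rdiv_le_0_compat; auto).
    assert (HCi : forall i, (i <= q)%nat -> g i <= C * t ^ S i).
    { intros i Hi.
      replace (g i) with (g i / t ^ S i * t ^ S i) by (field; apply Rgt_not_eq, Htp).
      apply Rmult_le_compat_r; [apply Rlt_le, Htp|]. unfold C.
      clear - Hi Hterm.
      set (h := fun i => g i / t ^ S i). fold (h i).
      assert (Hh : forall i, 0 <= h i) by exact Hterm. clearbody h. clear Hterm.
      induction q as [|q IHq].
      - replace i with 0%nat by lia. apply Rle_refl.
      - rewrite tech5. assert (H := Hh (S q)).
        destruct (Nat.eq_dec i (S q)) as [->|Hne].
        + assert (0 <= sum_f_R0 h q) by now apply cond_pos_sum. lra.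
        + specialize (IHq ltac:(lia)). lra. }
    exists C; split; [now apply cond_pos_sum|].
    intro m. induction m as [m IH] using (well_founded_induction Nat.lt_wf_0).
    destruct (le_lt_dec m q) as [Hm|Hm]; [auto|].
    (* In exponents, m + 1 = (q + 1) + (m - q), and m - q belongs to the index m - q - 1. *)
    replace m with (S (q + (m - S q))) at 1 by lia.
    eapply Rle_trans; [apply Hsub|].
    specialize (IH (m - S q)%nat ltac:(lia)).
    replace (C * t ^ S m) with (t ^ S q * (C * t ^ S (m - S q))).
    - apply Rmult_le_compat; auto.
    - replace (S m) with (S q + S (m - S q))%nat by lia. rewrite pow_add; ring. }
  exists J. split; [exact HJ0|]. split; [|split; [|exact Hgrow]].
  - apply is_lim_seq_spec. intros eps. assert (He := cond_pos eps).
    destruct (Hgrow (J + eps / 2) ltac:(lra)) as (C & HC & HCg).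
    destruct (pow_ratio_eventually C (J + eps / 2) (J + eps) ltac:(lra)) as [K HK].
    exists K. intros m Hm. specialize (HJu m). fold (u m).
    assert (u m < J + eps).
    { apply (pow_lt_cancel _ _ (S m)); [lra|]. rewrite Hupow.
      eapply Rle_lt_trans; [apply HCg|]. apply HK; lia. }
    rewrite Rabs_pos_eq; lra.
  - intro m. rewrite <- Hupow. apply pow_incr; auto.
Qed.

(** * The measure of noncompactness on a sequence space *)

Ltac seq_ring :=
  apply functional_extensionality; intro; unfold sadd, ssub, sscal, szero; ring.

Definition tail (k : nat) (x : seqC) : seqC := fun i => if Nat.ltb i k then RtoC 0 else x i.
Definition head (k : nat) (x : seqC) : seqC := fun i => if Nat.ltb i k then x i else RtoC 0.

Lemma sadd_head_tail (k : nat) (x : seqC) : sadd (head k x) (tail k x) = x.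
Proof.
  apply functional_extensionality; intro i. unfold sadd, head, tail.
  destruct (Nat.ltb i k); ring.
Qed.

Lemma tail_sadd (k : nat) (x y : seqC) : tail k (sadd x y) = sadd (tail k x) (tail k y).
Proof.
  apply functional_extensionality; intro i. unfold sadd, tail.
  destruct (Nat.ltb i k); ring.
Qed.

Lemma tail_sscal (k : nat) (c : C) (x : seqC) : tail k (sscal c x) = sscal c (tail k x).
Proof.
  apply functional_extensionality; intro i. unfold sscal, tail.
  destruct (Nat.ltb i k); ring.
Qed.

Lemma head_sadd (k : nat) (x y : seqC) : head k (sadd x y) = sadd (head k x) (head k y).
Proof.
  apply functional_extensionality; intro i. unfold sadd, head.
  destruct (Nat.ltb i k); ring.
Qed.

Lemma head_sscal (k : nat) (c : C) (x : seqC) : head k (sscal c x) = sscal c (head k x).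
Proof.
  apply functional_extensionality; intro i. unfold sscal, head.
  destruct (Nat.ltb i k); ring.
Qed.

Lemma Cmod_tail_le (p k : nat) (x : seqC) (i : nat) :
  (k <= p)%nat -> Cmod (tail p x i) <= Cmod (tail k x i).
Proof.
  intro H. unfold tail. destruct (Nat.ltb_spec i p); destruct (Nat.ltb_spec i k);
    rewrite ?Cmod_0; try lia; try apply Rle_refl; apply Cmod_ge_0.
Qed.

Lemma tail_0 (x : seqC) : tail 0 x = x.
Proof. reflexivity. Qed.

Lemma interval_net (delta : R) (n : nat) :
  0 < delta -> exists G : list R,
  forall t, Rabs t <= INR n * delta -> exists g, In g G /\ Rabs (t - g) <= delta.
Proof.
  intro Hd. induction n as [|n [G HG]].
  - exists (0 :: nil). intros t Ht. exists 0; split; [now left|].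
    simpl in Ht. rewrite Rminus_0_r. lra.
  - exists (INR (S n) * delta :: - (INR (S n) * delta) :: G). intros t Ht.
    destruct (Rle_dec (Rabs t) (INR n * delta)) as [H|H].
    + destruct (HG t H) as (g & Hg & E). exists g; split; trivial. now right; right.
    + rewrite S_INR in *. destruct (Rle_dec 0 t) as [Hp|Hp].
      * exists ((INR n + 1) * delta). split; [now left|].
        rewrite (Rabs_pos_eq t) in * by trivial. apply Rabs_le. lra.
      * exists (- ((INR n + 1) * delta)). split; [now right; left|].
        rewrite (Rabs_left t) in * by lra. apply Rabs_le. lra.
Qed.

Lemma disk_net (c eps : R) :
  0 < eps -> exists G : list C, forall z, Cmod z <= c -> exists g, In g G /\ Cmod (z - g)%C <= eps.
Proof.
  intro He. destruct (nfloor_ex (Rmax 0 (c / (eps / 2)))) as [n [_ Hn]]; [apply Rmax_l|].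
  destruct (interval_net (eps / 2) (S n)) as [G HG]; [lra|].
  exists (list_prod G G). intros z Hz.
  assert (Hc : c <= INR (S n) * (eps / 2)).
  { assert (H := Rmax_r 0 (c / (eps / 2))). rewrite S_INR.
    replace c with (c / (eps / 2) * (eps / 2)) by (field; lra).
    apply Rmult_le_compat_r; lra. }
  assert (Hm := Rmax_Cmod z).
  destruct (HG (fst z)) as (g1 & H1 & E1).
  { eapply Rle_trans; [apply Rmax_l|]. eapply Rle_trans; [exact Hm|]. lra. }
  destruct (HG (snd z)) as (g2 & H2 & E2).
  { eapply Rle_trans; [apply Rmax_r|]. eapply Rle_trans; [exact Hm|]. lra. }
  exists (g1, g2). split; [now apply in_prod|].
  replace (z - (g1, g2))%C with (RtoC (fst z - g1) + RtoC (snd z - g2) * Ci)%C.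
  - eapply Rle_trans; [apply Cmod_triangle|]. rewrite Cmod_mult, !Cmod_R, Cmod_Ci. lra.
  - destruct z as [a b]. apply injective_projections; simpl; ring.
Qed.

(** * Norm, bounded operators and coverings by finitely many balls *)

Section Space.
Variables (N : option nat) (L : seqC -> Prop) (nrm : seqC -> R).
Hypothesis HL : in_classL N L nrm.
Hypothesis Hoc : order_continuous L nrm.

Lemma L_le (x y : seqC) : L y -> (forall i, Cmod (x i) <= Cmod (y i)) -> L x.
Proof. intros Hy H. exact (proj1 (bss_ideal _ _ _ (proj1 HL) x y Hy H)). Qed.

Lemma nrm_le (x y : seqC) : L y -> (forall i, Cmod (x i) <= Cmod (y i)) -> nrm x <= nrm y.
Proof. intros Hy H. exact (proj2 (bss_ideal _ _ _ (proj1 HL) x y Hy H)). Qed.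

Lemma L_szero : L szero.
Proof. exact (bss_zero _ _ _ (proj1 HL)). Qed.

Lemma L_sadd (x y : seqC) : L x -> L y -> L (sadd x y).
Proof. exact (bss_add _ _ _ (proj1 HL) x y). Qed.

Lemma L_sscal (c : C) (x : seqC) : L x -> L (sscal c x).
Proof. exact (bss_scal _ _ _ (proj1 HL) c x). Qed.

Lemma nrm_ge0 (x : seqC) : L x -> 0 <= nrm x.
Proof. exact (bss_nrm_nonneg _ _ _ (proj1 HL) x). Qed.

Lemma nrm_sscal (c : C) (x : seqC) : L x -> nrm (sscal c x) = Cmod c * nrm x.
Proof. exact (bss_nrm_scal _ _ _ (proj1 HL) c x). Qed.

Lemma nrm_sadd (x y : seqC) : L x -> L y -> nrm (sadd x y) <= nrm x + nrm y.
Proof. exact (bss_nrm_tri _ _ _ (proj1 HL) x y). Qed.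

Lemma ssub_sadd (x y : seqC) : ssub x y = sadd x (sscal (-1) y).
Proof. seq_ring. Qed.

Lemma L_ssub (x y : seqC) : L x -> L y -> L (ssub x y).
Proof. intros. rewrite ssub_sadd. auto using L_sadd, L_sscal. Qed.

Lemma nrm_ssub (x y : seqC) : L x -> L y -> nrm (ssub x y) <= nrm x + nrm y.
Proof.
  intros Hx Hy. rewrite ssub_sadd. eapply Rle_trans; [apply nrm_sadd; auto using L_sscal|].
  rewrite nrm_sscal, Cmod_R by trivial. rewrite Rabs_left by lra. lra.
Qed.

Lemma nrm_szero : nrm szero = 0.
Proof.
  replace szero with (sscal 0 szero) by seq_ring.
  rewrite nrm_sscal, Cmod_0 by exact L_szero. ring.
Qed.

Lemma nrm_eq0 (x : seqC) : L x -> (forall eps, 0 < eps -> nrm x <= eps) -> x = szero.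
Proof.
  intros Hx H. apply (bss_nrm_def _ _ _ (proj1 HL)); trivial.
  apply Rle_antisym; [apply Rnot_lt_le; intro Hlt | now apply nrm_ge0].
  specialize (H (nrm x / 2)). lra.
Qed.

(** The vector x i times the i-th unit vector is dominated by x and has norm |x i|, unit vectors
    having norm 1. Outside the index set x vanishes. *)
Lemma Cmod_coord_le (x : seqC) (i : nat) : L x -> Cmod (x i) <= nrm x.
Proof.
  intro Hx. destruct (classic (idx N i)) as [Hi|Hi].
  - destruct (proj2 HL i Hi) as [Hu E].
    replace (Cmod (x i)) with (nrm (sscal (x i) (unitv i))) by (rewrite nrm_sscal, E; trivial; ring).
    apply nrm_le; trivial. intro j. unfold sscal, unitv.
    destruct (Nat.eqb_spec j i) as [->|_]; rewrite Cmod_mult, ?Cmod_0, ?Cmod_1.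
    + lra.
    + rewrite Rmult_0_r. apply Cmod_ge_0.
  - rewrite (bss_supp _ _ _ (proj1 HL) x Hx i Hi), Cmod_0. now apply nrm_ge0.
Qed.

Lemma L_tail (k : nat) (x : seqC) : L x -> L (tail k x).
Proof. intro Hx. apply (L_le _ x Hx). intro i. apply (Cmod_tail_le k 0); lia. Qed.

Lemma nrm_tail_le (p k : nat) (x : seqC) : (k <= p)%nat -> L x -> nrm (tail p x) <= nrm (tail k x).
Proof. intros H Hx. apply nrm_le; auto using L_tail, Cmod_tail_le. Qed.

Lemma L_head (k : nat) (x : seqC) : L x -> L (head k x).
Proof.
  intro Hx. apply (L_le _ x Hx). intro i. unfold head.
  destruct (Nat.ltb i k); [apply Rle_refl|]. rewrite Cmod_0; apply Cmod_ge_0.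
Qed.

(** The moduli of the tails form a decreasing net; a lower bound z satisfies z i <= 0 because the
    tail from i + 1 vanishes at i. Order continuity of the norm enters only here. *)
Lemma nrm_tail_lim (x : seqC) (eps : R) :
  L x -> 0 < eps -> exists k, forall p, (k <= p)%nat -> nrm (tail p x) < eps.
Proof.
  intros Hx He.
  set (f := fun (p : nat) (i : nat) => RtoC (Cmod (tail p x i)) : C).
  assert (Hmod : forall p i, Cmod (f p i) = Cmod (tail p x i)).
  { intros p i. unfold f. rewrite Cmod_R, Rabs_pos_eq; trivial. apply Cmod_ge_0. }
  assert (HfL : forall p, L (f p)).
  { intro p. apply (L_le _ (tail p x)); [now apply L_tail|]. intro i. rewrite Hmod. apply Rle_refl. }
  destruct (Hoc nat le f) with (eps := eps) as [k Hk]; trivial.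
  - split; [now exists 0%nat|]. split; [auto|]. split; [intros; lia|].
    intros a b. exists (a + b)%nat. lia.
  - intro p. split; trivial. intro i. unfold f; simpl. split; trivial. apply Cmod_ge_0.
  - intros a b Hab i. unfold ssub, f; simpl. split; [ring|].
    assert (H := Cmod_tail_le b a x i Hab). lra.
  - intros z Hz H i. specialize (H (S i) i). unfold ssub, f in *.
    unfold tail in H. replace (Nat.ltb i (S i)) with true in H by (symmetry; apply Nat.ltb_lt; lia).
    rewrite Cmod_0 in H. exact H.
  - exists k. intros p Hp. apply Rle_lt_trans with (nrm (f p)); [|auto].
    apply nrm_le; trivial. intro i. rewrite Hmod. apply Rle_refl.
Qed.

Definition bd (T : seqC -> seqC) (b : R) : Prop :=
  0 <= b /\ forall x, L x -> L (T x) /\ nrm (T x) <= b * nrm x.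

(** The predicate under the infimum in [gamma], so that [gamma_cov_eq] holds by conversion. *)
Definition cov (T : seqC -> seqC) (d : R) : Prop :=
  0 < d /\ exists M : list seqC, List.Forall L M /\
    forall x, L x -> nrm x <= 1 -> exists m, In m M /\
      exists y, L y /\ nrm y <= 1 /\ T x = sadd m (sscal (RtoC d) y).

Lemma gamma_cov_eq (T : seqC -> seqC) : gamma L nrm T = real (Glb_Rbar (cov T)).
Proof. reflexivity. Qed.

Lemma gamma_ge0 (T : seqC -> seqC) : 0 <= gamma L nrm T.
Proof.
  rewrite gamma_cov_eq. destruct (Glb_Rbar_correct (cov T)) as [_ H].
  assert (H0 : Rbar_le 0 (Glb_Rbar (cov T))).
  { apply H. intros d [Hd _]. simpl; lra. }
  destruct (Glb_Rbar (cov T)); simpl in *; lra.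
Qed.

Lemma gamma_le (T : seqC -> seqC) (d : R) : cov T d -> gamma L nrm T <= d.
Proof.
  intro Hd. assert (H0 := gamma_ge0 T). rewrite gamma_cov_eq in *.
  destruct (Glb_Rbar_correct (cov T)) as [H _]. specialize (H d Hd).
  destruct (Glb_Rbar (cov T)); simpl in *; trivial; try lra. destruct Hd; lra.
Qed.

Lemma gamma_le_of_cov (T : seqC -> seqC) (g : R) :
  (forall d, g < d -> cov T d) -> gamma L nrm T <= g.
Proof.
  intro H. apply Rnot_lt_le; intro Hlt.
  assert (Hc := gamma_le T ((g + gamma L nrm T) / 2)).
  assert (gamma L nrm T <= (g + gamma L nrm T) / 2) by (apply Hc, H; lra). lra.
Qed.

Lemma cov_le (T : seqC -> seqC) (d d' : R) : cov T d -> d <= d' -> cov T d'.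
Proof.
  intros (Hd & M & HM & H) Hle. split; [lra|]. exists M; split; trivial.
  intros x Hx Hn. destruct (H x Hx Hn) as (m & Hm & y & Hy & Hyn & E).
  exists m; split; trivial. exists (sscal (RtoC (d / d')) y). split; [|split].
  - now apply L_sscal.
  - rewrite nrm_sscal, Cmod_R by trivial.
    assert (0 <= d / d' <= 1).
    { split; [apply Rdiv_le_0_compat; lra|]. apply Rle_div_l; lra. }
    rewrite Rabs_pos_eq by lra. assert (H1 := nrm_ge0 y Hy). nra.
  - rewrite E. f_equal. apply functional_extensionality; intro i. unfold sscal.
    rewrite Cmult_assoc. f_equal. rewrite <- RtoC_mult. f_equal. field. lra.
Qed.

(** The first hypothesis excludes an empty set of radii, whose infimum [p_infty] is sent to 0 by
    [real]. Bounded operators satisfy it by [cov_of_bd]. *)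
Lemma cov_of_gamma_lt (T : seqC -> seqC) (d : R) :
  (exists d0, cov T d0) -> gamma L nrm T < d -> cov T d.
Proof.
  intros [d0 H0] Hlt. rewrite gamma_cov_eq in Hlt.
  destruct (Glb_Rbar_correct (cov T)) as [Hlb Hglb].
  assert (Hex : exists d', cov T d' /\ d' < d).
  { apply NNPP. intro Hn.
    assert (Hd : Rbar_le d (Glb_Rbar (cov T))).
    { apply Hglb. intros d' Hd'. apply Rnot_lt_le. intro; apply Hn; eauto. }
    specialize (Hlb d0 H0).
    destruct (Glb_Rbar (cov T)); simpl in *; trivial; lra. }
  destruct Hex as (d' & Hd' & Hl). apply (cov_le T d'); trivial; lra.
Qed.

Lemma nrm_normalize (x y : seqC) (d : R) :
  0 < d -> L y -> nrm y <= d -> exists z, L z /\ nrm z <= 1 /\ y = sscal (RtoC d) z.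
Proof.
  intros Hd Hy Hn. exists (sscal (RtoC (/ d)) y). split; [now apply L_sscal|]. split.
  - rewrite nrm_sscal, Cmod_R by trivial.
    assert (0 < / d) by now apply Rinv_0_lt_compat. rewrite Rabs_pos_eq by lra.
    apply (Rmult_le_reg_l d); trivial. rewrite <- Rmult_assoc, Rinv_r by lra. lra.
  - apply functional_extensionality; intro i. unfold sscal.
    rewrite Cmult_assoc, <- RtoC_mult, Rinv_r by lra. ring.
Qed.

Lemma bop_bd (T : seqC -> seqC) : bop L nrm T -> exists b, bd T b.
Proof.
  intros (H1 & _ & _ & M & HM). exists (Rabs M). split; [apply Rabs_pos|].
  intros x Hx. split; auto. eapply Rle_trans; [apply HM; trivial|].
  apply Rmult_le_compat_r; [now apply nrm_ge0 | apply Rle_abs].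
Qed.

Lemma bop_of_bd (T : seqC -> seqC) (b : R) :
  bd T b -> (forall x y, L x -> L y -> T (sadd x y) = sadd (T x) (T y)) ->
  (forall c x, L x -> T (sscal c x) = sscal c (T x)) -> bop L nrm T.
Proof. intros [_ H] Ha Hs. repeat split; trivial; [|exists b]; intros; now apply H. Qed.

Lemma bop_ssub (T : seqC -> seqC) (x y : seqC) :
  bop L nrm T -> L x -> L y -> T (ssub x y) = ssub (T x) (T y).
Proof.
  intros (H0 & Ha & Hs & _) Hx Hy.
  rewrite ssub_sadd, Ha, Hs by auto using L_sscal. now rewrite <- ssub_sadd.
Qed.

Lemma cov_of_bd (T : seqC -> seqC) (b d : R) : bd T b -> b < d -> cov T d.
Proof.
  intros [Hb H] Hlt. split; [lra|]. exists (szero :: nil). split.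
  - constructor; [exact L_szero | constructor].
  - intros x Hx Hn. exists szero; split; [now left|]. destruct (H x Hx) as [HT HTn].
    destruct (nrm_normalize x (T x) d) as (z & Hz & Hzn & E); trivial; [lra| |].
    + assert (H0 := nrm_ge0 x Hx). nra.
    + exists z. split; [|split]; trivial. rewrite E. seq_ring.
Qed.

Lemma bop_cov (T : seqC -> seqC) (d : R) : bop L nrm T -> gamma L nrm T < d -> cov T d.
Proof.
  intros HT Hlt. apply cov_of_gamma_lt; trivial.
  destruct (bop_bd T HT) as [b Hb]. exists (b + 1). apply (cov_of_bd _ b); trivial; lra.
Qed.

Lemma bop_sadd (S T : seqC -> seqC) :
  bop L nrm S -> bop L nrm T -> bop L nrm (fun x => sadd (S x) (T x)).
Proof.
  intros HS HT. destruct (bop_bd S HS) as [b Hb], (bop_bd T HT) as [c Hc].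
  destruct HS as (S1 & S2 & S3 & _), HT as (T1 & T2 & T3 & _).
  apply (bop_of_bd _ (b + c)).
  - destruct Hb as [Hb0 Hb], Hc as [Hc0 Hc]. split; [lra|]. intros x Hx. split; [now apply L_sadd; auto|].
    eapply Rle_trans; [apply nrm_sadd; auto|].
    destruct (Hb x Hx), (Hc x Hx). lra.
  - intros x y Hx Hy. rewrite S2, T2 by trivial. seq_ring.
  - intros c' x Hx. rewrite S3, T3 by trivial. seq_ring.
Qed.

Lemma bop_comp (S T : seqC -> seqC) :
  bop L nrm S -> bop L nrm T -> bop L nrm (fun x => S (T x)).
Proof.
  intros HS HT. destruct (bop_bd S HS) as [b Hb], (bop_bd T HT) as [c Hc].
  destruct HS as (S1 & S2 & S3 & _), HT as (T1 & T2 & T3 & _).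
  apply (bop_of_bd _ (b * c)).
  - destruct Hb as [Hb0 Hb], Hc as [Hc0 Hc]. split; [now apply Rmult_le_pos|].
    intros x Hx. split; auto.
    destruct (Hc x Hx) as [HTx H1], (Hb (T x) HTx) as [_ H2]. nra.
  - intros x y Hx Hy. rewrite T2, S2 by auto. reflexivity.
  - intros c' x Hx. rewrite T3, S3 by auto. reflexivity.
Qed.

Lemma bop_scal (c : C) (T : seqC -> seqC) :
  bop L nrm T -> bop L nrm (fun x => sscal c (T x)).
Proof.
  intro HT. destruct (bop_bd T HT) as [b [Hb0 Hb]].
  destruct HT as (T1 & T2 & T3 & _).
  apply (bop_of_bd _ (Cmod c * b)).
  - split; [apply Rmult_le_pos; trivial; apply Cmod_ge_0|].
    intros x Hx. split; [now apply L_sscal; auto|].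
    rewrite nrm_sscal by auto. rewrite Rmult_assoc. apply Rmult_le_compat_l; [apply Cmod_ge_0|].
    now apply Hb.
  - intros x y Hx Hy. rewrite T2 by trivial. seq_ring.
  - intros c' x Hx. rewrite T3 by trivial. seq_ring.
Qed.

Lemma bop_head (k : nat) (T : seqC -> seqC) : bop L nrm T -> bop L nrm (fun x => head k (T x)).
Proof.
  apply (bop_comp (head k)). apply (bop_of_bd _ 1).
  - split; [lra|]. intros x Hx. split; [now apply L_head|]. rewrite Rmult_1_l.
    apply nrm_le; trivial. intro i. unfold head.
    destruct (Nat.ltb i k); [apply Rle_refl|]. rewrite Cmod_0; apply Cmod_ge_0.
  - intros; apply head_sadd.
  - intros; apply head_sscal.
Qed.

(** If T x = m + d y and S y = m' + c y', then S (T x) = (S m + d m') + c d y'; the new centres are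
    S m + d m'. *)
Lemma cov_comp (S T : seqC -> seqC) (c d : R) :
  bop L nrm S -> cov S c -> cov T d -> cov (fun x => S (T x)) (c * d).
Proof.
  intros (_ & S2 & S3 & _) (Hc & MS & HMS & HS) (Hd & MT & HMT & HT).
  split; [now apply Rmult_lt_0_compat|].
  exists (map (fun p => sadd (S (fst p)) (sscal (RtoC d) (snd p))) (list_prod MT MS)).
  rewrite Forall_forall in HMS, HMT. split.
  - rewrite Forall_forall. intros z Hz. apply in_map_iff in Hz.
    destruct Hz as ([m m'] & <- & Hm). apply in_prod_iff in Hm. destruct Hm.
    apply L_sadd; [|apply L_sscal; auto].
    destruct (HS szero) as (s & Hs & y & Hy & _ & E);
      [exact L_szero | rewrite nrm_szero; lra|].
    (* S m lies in L because m is a multiple of a vector z of the unit ball and S z is a centre plus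
       c times a vector of L. The added 1 allows m = 0. *)
    destruct (nrm_normalize m m (nrm m + 1)) as (z & Hz & Hz1 & Em); auto; try lra.
    { assert (Hm0 := nrm_ge0 m (HMT m H)). lra. }
    destruct (HS z Hz Hz1) as (s' & Hs' & y' & Hy' & _ & E').
    simpl fst. rewrite Em, S3, E' by trivial. auto using L_sscal, L_sadd.
  - intros x Hx Hn. destruct (HT x Hx Hn) as (m & Hm & y & Hy & Hyn & E).
    destruct (HS y Hy Hyn) as (m' & Hm' & y' & Hy' & Hyn' & E').
    exists (sadd (S m) (sscal (RtoC d) m')). split.
    + apply in_map_iff. exists (m, m'). split; trivial. now apply in_prod.
    + exists y'. split; [|split]; trivial.
      rewrite E, S2, S3, E' by auto using L_sscal.
      apply functional_extensionality; intro i. unfold sadd, sscal. rewrite RtoC_mult. ring.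
Qed.

Lemma cov_sadd (S T : seqC -> seqC) (c d : R) :
  cov S c -> cov T d -> cov (fun x => sadd (S x) (T x)) (c + d).
Proof.
  intros (Hc & MS & HMS & HS) (Hd & MT & HMT & HT). split; [lra|].
  exists (map (fun p => sadd (fst p) (snd p)) (list_prod MS MT)).
  rewrite Forall_forall in HMS, HMT. split.
  - rewrite Forall_forall. intros z Hz. apply in_map_iff in Hz.
    destruct Hz as ([m m'] & <- & Hm). apply in_prod_iff in Hm. destruct Hm.
    apply L_sadd; simpl; auto.
  - intros x Hx Hn. destruct (HS x Hx Hn) as (m & Hm & y & Hy & Hyn & E).
    destruct (HT x Hx Hn) as (m' & Hm' & y' & Hy' & Hyn' & E').
    exists (sadd m m'). split.
    + apply in_map_iff. exists (m, m'). split; trivial. now apply in_prod.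
    + destruct (nrm_normalize x (sadd (sscal (RtoC c) y) (sscal (RtoC d) y')) (c + d))
        as (z & Hz & Hzn & Ez); [lra | auto using L_sadd, L_sscal | |].
      * eapply Rle_trans; [apply nrm_sadd; auto using L_sscal|].
        rewrite !nrm_sscal, !Cmod_R, !Rabs_pos_eq by (trivial; lra). nra.
      * exists z. split; [|split]; trivial. rewrite <- Ez, E, E'. seq_ring.
Qed.

Lemma cov_compact (K : seqC -> seqC) (d : R) : compact_op L nrm K -> 0 < d -> cov K d.
Proof.
  intros [HK H] Hd. split; trivial. destruct (H d Hd) as (M & HM & HM').
  exists M; split; trivial. intros x Hx Hn. destruct (HM' x Hx Hn) as (m & Hm & Hle).
  exists m; split; trivial. rewrite Forall_forall in HM.
  destruct (nrm_normalize x (ssub (K x) m) d) as (z & Hz & Hzn & E); trivial.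
  - apply L_ssub; auto. now apply HK.
  - exists z. split; [|split]; trivial. rewrite <- E. seq_ring.
Qed.

Lemma gamma_ext (S T : seqC -> seqC) :
  (forall x, L x -> S x = T x) -> gamma L nrm S = gamma L nrm T.
Proof.
  intro H. rewrite !gamma_cov_eq. f_equal. apply Glb_Rbar_eqset. intro d.
  unfold cov. split; intros (Hd & M & HM & HS); split; trivial; exists M; split; trivial;
    intros x Hx Hn; [rewrite <- H by trivial | rewrite H by trivial]; auto.
Qed.

Lemma gamma_compact (K : seqC -> seqC) : compact_op L nrm K -> gamma L nrm K = 0.
Proof.
  intro HK. apply Rle_antisym; [|apply gamma_ge0].
  apply gamma_le_of_cov. intros d Hd. now apply cov_compact.
Qed.

Lemma gamma_sadd (S T : seqC -> seqC) :
  bop L nrm S -> bop L nrm T ->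
  gamma L nrm (fun x => sadd (S x) (T x)) <= gamma L nrm S + gamma L nrm T.
Proof.
  intros HS HT. apply gamma_le_of_cov. intros d Hd.
  set (e := (d - gamma L nrm S - gamma L nrm T) / 2).
  replace d with ((gamma L nrm S + e) + (gamma L nrm T + e)) by (unfold e; lra).
  apply cov_sadd; apply bop_cov; trivial; unfold e; lra.
Qed.

Lemma gamma_comp (S T : seqC -> seqC) :
  bop L nrm S -> bop L nrm T ->
  gamma L nrm (fun x => S (T x)) <= gamma L nrm S * gamma L nrm T.
Proof.
  intros HS HT. apply gamma_le_of_cov. intros d Hd.
  set (s := gamma L nrm S) in *. set (t := gamma L nrm T) in *.
  assert (Hs : 0 <= s) by apply gamma_ge0. assert (Ht : 0 <= t) by apply gamma_ge0.
  (* For e = min (1, q), (s + e)(t + e) = s t + e (s + t + e) <= s t + q (s + t + 1) = d. *)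
  set (q := (d - s * t) / (s + t + 1)).
  assert (Hq : 0 < q) by (apply Rdiv_lt_0_compat; lra).
  assert (Hqe : q * (s + t + 1) = d - s * t) by (unfold q; field; lra).
  set (e := Rmin 1 q). assert (He : 0 < e) by (apply Rmin_glb_lt; lra).
  assert (He1 : e <= 1) by apply Rmin_l. assert (Heq : e <= q) by apply Rmin_r.
  apply (cov_le _ ((s + e) * (t + e))).
  - apply (cov_comp S T); trivial; apply bop_cov; trivial; fold s t; lra.
  - assert (e * (s + t + e) <= q * (s + t + 1)) by (apply Rmult_le_compat; lra). lra.
Qed.

Lemma gamma_le_bd (T : seqC -> seqC) (b : R) : bd T b -> gamma L nrm T <= b.
Proof. intro H. apply gamma_le_of_cov. intros d. now apply cov_of_bd. Qed.

Lemma gamma_sscal (c : C) (T : seqC -> seqC) :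
  bop L nrm T -> gamma L nrm (fun x => sscal c (T x)) <= Cmod c * gamma L nrm T.
Proof.
  intro HT.
  assert (Hb : bd (sscal c) (Cmod c)).
  { split; [apply Cmod_ge_0|]. intros x Hx. split; [now apply L_sscal|].
    rewrite nrm_sscal by trivial. apply Rle_refl. }
  eapply Rle_trans; [apply (gamma_comp (sscal c)); trivial|].
  - apply (bop_of_bd _ _ Hb); intros; seq_ring.
  - apply Rmult_le_compat_r; [apply gamma_ge0 | now apply gamma_le_bd].
Qed.

(** Total boundedness in finite dimension: one coordinate is added at a time, half of the tolerance
    going to a net of a disk and half to the remaining coordinates. A coordinate outside the index
    set vanishes and adds nothing. *)
Lemma box_net (k : nat) (c eps : R) :
  0 < eps -> exists M : list seqC, List.Forall L M /\
  forall y, L y -> (forall i, Cmod (y i) <= c) -> (forall i, (k <= i)%nat -> y i = 0) ->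
  exists m, In m M /\ nrm (ssub y m) <= eps.
Proof.
  revert eps. induction k as [|k IH]; intros eps He.
  - exists (szero :: nil). split; [repeat constructor; exact L_szero|].
    intros y Hy _ H0. exists szero. split; [now left|].
    replace (ssub y szero) with szero; [rewrite nrm_szero; lra|].
    apply functional_extensionality; intro i. unfold ssub, szero.
    rewrite H0 by lia. ring.
  - destruct (IH (eps / 2)) as (M & HM & HMy); [lra|].
    destruct (classic (idx N k)) as [Hk|Hk].
    + destruct (disk_net c (eps / 2)) as [G HG]; [lra|].
      destruct (proj2 HL k Hk) as [Hu Hu1].
      exists (map (fun p => sadd (fst p) (sscal (snd p) (unitv k))) (list_prod M G)).
      rewrite Forall_forall in HM. split.
      * rewrite Forall_forall. intros z Hz. apply in_map_iff in Hz.
        destruct Hz as ([m g] & <- & Hm). apply in_prod_iff in Hm. destruct Hm.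
        simpl. auto using L_sadd, L_sscal.
      * intros y Hy Hc Hz.
        destruct (HMy (head k y)) as (m & Hm & Hmn).
        -- now apply L_head.
        -- intro i. unfold head. destruct (Nat.ltb i k); trivial.
           rewrite Cmod_0. eapply Rle_trans; [apply Cmod_ge_0 | apply (Hc i)].
        -- intros i Hi. unfold head. destruct (Nat.ltb_spec i k); trivial; lia.
        -- destruct (HG (y k) (Hc k)) as (g & Hg & Hgn).
           exists (sadd m (sscal g (unitv k))). split.
           ++ apply in_map_iff. exists (m, g). split; trivial. now apply in_prod.
           ++ replace (ssub y (sadd m (sscal g (unitv k)))) with
                (sadd (ssub (head k y) m) (sscal (y k - g)%C (unitv k))).
              ** eapply Rle_trans; [apply nrm_sadd; auto using L_ssub, L_head, L_sscal|].
                 rewrite nrm_sscal, Hu1 by trivial. lra.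
              ** apply functional_extensionality; intro i.
                 unfold sadd, ssub, sscal, head, unitv.
                 destruct (Nat.eqb_spec i k) as [->|Hne].
                 --- rewrite Nat.ltb_irrefl. ring.
                 --- destruct (Nat.ltb_spec i k); [ring|]. rewrite (Hz i) by lia. ring.
    + exists M. split; trivial. intros y Hy Hc Hz.
      destruct (HMy y) as (m & Hm & Hmn); trivial.
      * intros i Hi. destruct (Nat.eq_dec i k) as [->|Hne]; [|apply Hz; lia].
        exact (bss_supp _ _ _ (proj1 HL) y Hy k Hk).
      * exists m. split; trivial. lra.
Qed.

Lemma compact_head (k : nat) (T : seqC -> seqC) :
  bop L nrm T -> compact_op L nrm (fun x => head k (T x)).
Proof.
  intro HT. assert (Hh := bop_head k T HT). split; trivial. intros eps He.
  destruct (bop_bd _ Hh) as [b [Hb0 Hb]].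
  destruct (box_net k b eps He) as (M & HM & H). exists M; split; trivial.
  intros x Hx Hn. destruct (Hb x Hx) as [HLx Hbx]. apply H; trivial.
  - intro i. eapply Rle_trans; [now apply Cmod_coord_le|].
    assert (H0 := nrm_ge0 x Hx). nra.
  - intros i Hi. unfold head. destruct (Nat.ltb_spec i k); trivial; lia.
Qed.

Lemma compact_comp (S K : seqC -> seqC) :
  bop L nrm S -> compact_op L nrm K -> compact_op L nrm (fun x => S (K x)).
Proof.
  intros HS [HK H]. split; [now apply bop_comp|]. intros eps He.
  destruct (bop_bd S HS) as [b [Hb0 Hb]].
  destruct (H (eps / (b + 1))) as (M & HM & HMx); [apply Rdiv_lt_0_compat; lra|].
  exists (map S M). rewrite Forall_forall in *. split.
  - intros z Hz. apply in_map_iff in Hz. destruct Hz as (m & <- & Hm). apply HS; auto.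
  - intros x Hx Hn. destruct (HMx x Hx Hn) as (m & Hm & Hle). exists (S m).
    split; [now apply in_map|]. assert (HKx : L (K x)) by now apply HK.
    rewrite <- bop_ssub by auto.
    destruct (Hb (ssub (K x) m)) as [_ Hbx]; [apply L_ssub; auto|].
    eapply Rle_trans; [exact Hbx|]. apply Rle_trans with ((b + 1) * (eps / (b + 1))).
    + apply Rmult_le_compat; try lra. apply nrm_ge0, L_ssub; auto.
    + right; field; lra.
Qed.

Lemma compact_sscal (c : C) (K : seqC -> seqC) :
  compact_op L nrm K -> compact_op L nrm (fun x => sscal c (K x)).
Proof.
  apply (compact_comp (sscal c)). apply (bop_of_bd _ (Cmod c)).
  - split; [apply Cmod_ge_0|]. intros x Hx. split; [now apply L_sscal|].
    rewrite nrm_sscal by trivial. apply Rle_refl.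
  - intros; seq_ring.
  - intros; seq_ring.
Qed.

(** * The measure of noncompactness as the limit of tail norms *)

Lemma tail_list (M : list seqC) (eps : R) :
  0 < eps -> List.Forall L M ->
  exists k, forall p m, (k <= p)%nat -> In m M -> nrm (tail p m) < eps.
Proof.
  intros He HM. induction HM as [|m M Hm HM [k Hk]].
  - exists 0%nat. intros p m _ [].
  - destruct (nrm_tail_lim m eps Hm He) as [k' Hk']. exists (k + k')%nat.
    intros p z Hp [<-|Hz]; [apply Hk'; lia | apply Hk; trivial; lia].
Qed.

(** The finitely many centres have tails of norm below d' - d from a common index on; the remaining
    ball contributes at most d. *)
Lemma bd_tail_of_cov (T : seqC -> seqC) (d d' : R) :
  bop L nrm T -> cov T d -> d < d' ->
  exists k, forall p, (k <= p)%nat -> bd (fun x => tail p (T x)) d'.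
Proof.
  intros (T1 & T2 & T3 & _) (Hd & M & HM & H) Hlt.
  destruct (tail_list M (d' - d)) as [k Hk]; trivial; [lra|].
  exists k. intros p Hp. split; [lra|]. intros x Hx. split; [now apply L_tail; auto|].
  rewrite Forall_forall in HM.
  assert (Hball : forall x, L x -> nrm x <= 1 -> nrm (tail p (T x)) <= d').
  { clear x Hx. intros x Hx Hn. destruct (H x Hx Hn) as (m & Hm & y & Hy & Hyn & E).
    rewrite E, tail_sadd, tail_sscal.
    eapply Rle_trans; [apply nrm_sadd; auto using L_sscal, L_tail|].
    rewrite nrm_sscal, Cmod_R, Rabs_pos_eq by (auto using L_tail; lra).
    specialize (Hk p m Hp Hm). assert (Ht := nrm_tail_le p 0 y (Nat.le_0_l p) Hy).
    rewrite tail_0 in Ht. nra. }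
  (* The bound on the unit ball extends by homogeneity; norm 0 is separate because normalizing
     divides by the norm. *)
  destruct (Req_dec (nrm x) 0) as [E|Hne].
  - assert (Ex : x = sscal 0 x).
    { rewrite (bss_nrm_def _ _ _ (proj1 HL) x Hx E). seq_ring. }
    rewrite Ex at 1. rewrite T3, tail_sscal, nrm_sscal, Cmod_0 by auto using L_tail.
    rewrite E; lra.
  - assert (H0 := nrm_ge0 x Hx).
    destruct (nrm_normalize x x (nrm x)) as (z & Hz & Hzn & E); trivial; try lra.
    rewrite E at 1. rewrite T3, tail_sscal, nrm_sscal, Cmod_R, Rabs_pos_eq by auto using L_tail.
    specialize (Hball z Hz Hzn). nra.
Qed.

(** Converse of [bd_tail_of_cov]: the head of T is compact, so it is covered at any positive cost,
    here (d' - d) / 2. *)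
Lemma cov_of_bd_tail (T : seqC -> seqC) (k : nat) (d d' : R) :
  bop L nrm T -> bd (fun x => tail k (T x)) d -> d < d' -> cov T d'.
Proof.
  intros HT Hb Hlt. assert (Hd := proj1 Hb).
  assert (H : cov (fun x => sadd (head k (T x)) (tail k (T x))) d').
  { replace d' with ((d' - d) / 2 + (d' + d) / 2) by lra. apply cov_sadd.
    - apply cov_compact; [now apply compact_head | lra].
    - apply (cov_of_bd _ d); trivial; lra. }
  destruct H as (Hd' & M & HM & H). split; trivial. exists M; split; trivial.
  intros x Hx Hn. specialize (H x Hx Hn). now rewrite sadd_head_tail in H.
Qed.

(** * Nonnegative matrices *)

Definition toC (x : nat -> R) : seqC := fun i => RtoC (x i).
Definition mv (A : mat) (x : nat -> R) : nat -> R := fun i => Series (fun j => A i j * x j).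
Definition cabs (x : seqC) : nat -> R := fun i => Cmod (x i).
Definition mle (A B : mat) : Prop := forall i j, A i j <= B i j.

(** The norm bound is a parameter, since products, Hadamard products and tails each produce an
    explicit new bound. *)
Definition good (b : R) (A : mat) : Prop :=
  0 <= b /\ nonneg_mat N A /\ defines_op L A /\ forall x, L x -> nrm (matop A x) <= b * nrm x.

Lemma Series_zero (a : nat -> R) : (forall k, a k = 0) -> Series a = 0.
Proof.
  intro H. rewrite (Series_ext a (fun k => 0 * a k)); [rewrite Series_scal_l; ring|].
  intro k. rewrite H; ring.
Qed.

Lemma Series_ge0 (a : nat -> R) : ex_series a -> (forall k, 0 <= a k) -> 0 <= Series a.
Proof.
  intros Ha H. rewrite <- (Series_zero (fun _ => 0)); trivial.
  apply Series_le; trivial. intro k; split; [lra | auto].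
Qed.

Lemma ex_series_Rmult (c : R) (a : nat -> R) : ex_series a -> ex_series (fun k => c * a k).
Proof. exact (ex_series_scal (K := R_AbsRing) (V := R_NormedModule) c a). Qed.

Lemma is_series_single (a : nat -> R) (j : nat) :
  is_series (fun k => if Nat.eqb k j then a k else 0) (a j).
Proof.
  set (f := fun k => if Nat.eqb k j then a k else 0).
  assert (H : forall n, sum_n f n = if Nat.leb j n then a j else 0).
  { induction n as [|n IH].
    - rewrite sum_O. unfold f. destruct j; reflexivity.
    - rewrite sum_Sn, IH. unfold f. change (@plus R_AbelianMonoid) with Rplus.
      destruct (Nat.eqb_spec (S n) j) as [<-|Hne].
      + rewrite (proj2 (Nat.leb_gt _ _)), (proj2 (Nat.leb_le _ _)) by lia. apply Rplus_0_l.
      + destruct (Nat.leb_spec j n); destruct (Nat.leb_spec j (S n)); try lia; apply Rplus_0_r. }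
  change (is_lim_seq (sum_n f) (a j)).
  apply (is_lim_seq_ext_loc (fun _ => a j)); [|apply is_lim_seq_const].
  exists j. intros n Hn. rewrite H, (proj2 (Nat.leb_le _ _)); trivial.
Qed.

Lemma matop_toC (A : mat) (x : nat -> R) : matop A (toC x) = toC (mv A x).
Proof.
  apply functional_extensionality; intro i. unfold matop, toC, mv, RtoC; simpl.
  f_equal. apply Series_zero. intro; simpl; ring.
Qed.

Lemma Cmod_toC (x : nat -> R) (i : nat) : Cmod (toC x i) = Rabs (x i).
Proof. apply Cmod_R. Qed.

Lemma L_toC_le (x : nat -> R) (y : seqC) : L y -> (forall i, Rabs (x i) <= Cmod (y i)) -> L (toC x).
Proof. intros Hy H. apply (L_le _ y Hy). intro i. rewrite Cmod_toC. apply H. Qed.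

Lemma L_Re (x : seqC) : L x -> L (toC (fun i => Re (x i))).
Proof.
  intro Hx. apply (L_toC_le _ x Hx). intro i.
  eapply Rle_trans; [apply Rmax_l | apply Rmax_Cmod].
Qed.

Lemma L_Im (x : seqC) : L x -> L (toC (fun i => Im (x i))).
Proof.
  intro Hx. apply (L_toC_le _ x Hx). intro i.
  eapply Rle_trans; [apply Rmax_r | apply Rmax_Cmod].
Qed.

Lemma L_cabs (x : seqC) : L x -> L (toC (cabs x)).
Proof.
  intro Hx. apply (L_toC_le _ x Hx). intro i. unfold cabs.
  rewrite Rabs_pos_eq; [apply Rle_refl | apply Cmod_ge_0].
Qed.

Lemma nrm_cabs (x : seqC) : L x -> nrm (toC (cabs x)) = nrm x.
Proof.
  intro Hx. apply Rle_antisym; apply nrm_le; auto using L_cabs; intro i;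
    rewrite Cmod_toC; unfold cabs; rewrite Rabs_pos_eq by apply Cmod_ge_0; apply Rle_refl.
Qed.

Lemma good_ge0 (b : R) (A : mat) (i j : nat) : good b A -> 0 <= A i j.
Proof. intros (_ & H & _). apply H. Qed.

Lemma good_ex (b : R) (A : mat) (x : nat -> R) (i : nat) :
  good b A -> L (toC x) -> ex_series (fun j => A i j * x j).
Proof.
  intros (_ & _ & H & _) Hx. destruct (H _ Hx) as [He _]. apply ex_series_Rabs.
  eapply ex_series_ext; [|apply (He i)]. intro j. simpl.
  now rewrite Cmod_toC, Rabs_mult.
Qed.

Lemma good_mv_L (b : R) (A : mat) (x : nat -> R) : good b A -> L (toC x) -> L (toC (mv A x)).
Proof. intros (_ & _ & H & _) Hx. rewrite <- matop_toC. now apply H. Qed.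

Lemma good_mv_nrm (b : R) (A : mat) (x : nat -> R) :
  good b A -> L (toC x) -> nrm (toC (mv A x)) <= b * nrm (toC x).
Proof. intros (_ & _ & _ & H) Hx. rewrite <- matop_toC. now apply H. Qed.

Lemma good_mv_plus (b : R) (A : mat) (x y : nat -> R) (i : nat) :
  good b A -> L (toC x) -> L (toC y) -> mv A (fun j => x j + y j) i = mv A x i + mv A y i.
Proof.
  intros HA Hx Hy. unfold mv. rewrite <- Series_plus by eauto using good_ex.
  apply Series_ext. intro; ring.
Qed.

Lemma good_bd (b : R) (A : mat) : good b A -> bd (matop A) b.
Proof. intros (Hb & _ & H & H'). split; trivial. intros x Hx; split; auto. now apply H. Qed.

Lemma good_bop (b : R) (A : mat) : good b A -> bop L nrm (matop A).
Proof.
  intro HA. apply (bop_of_bd _ b); [now apply good_bd| |].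
  - intros x y Hx Hy. apply functional_extensionality; intro i.
    unfold matop, sadd. apply injective_projections; simpl;
      rewrite <- Series_plus by (eapply good_ex; eauto using L_Re, L_Im);
      apply Series_ext; intro j; unfold Re, Im, Cplus; simpl; ring.
  - intros c x Hx. apply functional_extensionality; intro i.
    unfold matop, sscal. apply injective_projections; simpl;
      rewrite <- !Series_scal_l.
    + rewrite <- Series_minus.
      * apply Series_ext; intro j; unfold Re, Im; simpl; ring.
      * apply ex_series_Rmult, (good_ex b A (fun j => Re (x j)) i HA). now apply L_Re.
      * apply ex_series_Rmult, (good_ex b A (fun j => Im (x j)) i HA). now apply L_Im.
    + rewrite <- Series_plus.
      * apply Series_ext; intro j; unfold Re, Im; simpl; ring.
      * apply ex_series_Rmult, (good_ex b A (fun j => Im (x j)) i HA). now apply L_Im.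
      * apply ex_series_Rmult, (good_ex b A (fun j => Re (x j)) i HA). now apply L_Re.
Qed.

(** If w is the complex sum, |w|^2 is the sum of the real parts of conj(w) z_k, hence at most |w|
    times the sum of the |z_k|. The case w = 0 is separate. *)
Lemma Cmod_pair_Series_le (z : nat -> C) :
  ex_series (fun k => Cmod (z k)) ->
  Cmod (Series (fun k => Re (z k)), Series (fun k => Im (z k))) <= Series (fun k => Cmod (z k)).
Proof.
  intro He. set (s := Series (fun k => Re (z k))). set (t := Series (fun k => Im (z k))).
  assert (HRe : forall k, Rabs (Re (z k)) <= Cmod (z k))
    by (intro k; eapply Rle_trans; [apply Rmax_l | apply Rmax_Cmod]).
  assert (HIm : forall k, Rabs (Im (z k)) <= Cmod (z k))
    by (intro k; eapply Rle_trans; [apply Rmax_r | apply Rmax_Cmod]).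
  assert (E1 : ex_series (fun k => Re (z k)))
    by (apply (ex_series_le (K := R_AbsRing) (V := R_CompleteNormedModule) _ _ HRe He)).
  assert (E2 : ex_series (fun k => Im (z k)))
    by (apply (ex_series_le (K := R_AbsRing) (V := R_CompleteNormedModule) _ _ HIm He)).
  set (c := Cmod (s, t)). assert (Hc : 0 <= c) by apply Cmod_ge_0.
  assert (Hcc : c * c = s * s + t * t).
  { unfold c, Cmod; simpl. rewrite sqrt_sqrt; [ring|]. nra. }
  assert (H : c * c <= c * Series (fun k => Cmod (z k))).
  { rewrite Hcc. unfold s at 1, t at 1.
    rewrite (Rmult_comm _ s), (Rmult_comm _ t), <- !Series_scal_l, <- Series_plus
      by (now apply ex_series_Rmult).
    assert (E3 : ex_series (fun k => c * Cmod (z k)))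
      by (now apply ex_series_Rmult).
    assert (Hk : forall k, Rabs (s * Re (z k) + t * Im (z k)) <= c * Cmod (z k)).
    { intro k. replace (s * Re (z k) + t * Im (z k)) with (Re (Cmult (s, - t) (z k)))
        by (unfold Re, Im; simpl; ring).
      replace c with (Cmod (s, - t)) by (unfold c, Cmod; simpl; f_equal; ring).
      rewrite <- Cmod_mult. eapply Rle_trans; [apply Rmax_l | apply Rmax_Cmod]. }
    assert (E4 : ex_series (fun k => Rabs (s * Re (z k) + t * Im (z k)))).
    { apply (ex_series_le (K := R_AbsRing) (V := R_CompleteNormedModule)) with (2 := E3).
      intro k. unfold norm; simpl. unfold abs; simpl. rewrite Rabs_Rabsolu. apply Hk. }
    eapply Rle_trans; [apply Rle_abs|]. eapply Rle_trans; [apply Series_Rabs, E4|].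
    apply Series_le; trivial. intro k; split; [apply Rabs_pos | apply Hk]. }
  destruct Hc as [Hc|Hc].
  - now apply Rmult_le_reg_l with c.
  - rewrite <- Hc. apply Series_ge0; trivial. intro; apply Cmod_ge_0.
Qed.

(** For a nonnegative matrix |A x| <= A |x| coordinatewise, and |x| has the norm of x, so testing
    nonnegative real vectors is enough. *)
Lemma good_of_nonneg (b : R) (A : mat) :
  0 <= b -> nonneg_mat N A ->
  (forall x, (forall i, 0 <= x i) -> L (toC x) ->
     (forall i, ex_series (fun j => A i j * x j)) /\
     L (toC (mv A x)) /\ nrm (toC (mv A x)) <= b * nrm (toC x)) ->
  good b A.
Proof.
  intros Hb HA H.
  assert (Habs : forall i j, Rabs (A i j) = A i j) by (intros; apply Rabs_pos_eq, HA).
  assert (Hx : forall x, L x -> (forall i, ex_series (fun j => Rabs (A i j) * Cmod (x j))) /\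
                L (matop A x) /\ nrm (matop A x) <= b * nrm x).
  { intros x Hx. destruct (H (cabs x)) as (He & HLm & Hn).
    - intro; apply Cmod_ge_0.
    - now apply L_cabs.
    - assert (Hle : forall i, Cmod (matop A x i) <= Cmod (toC (mv A (cabs x)) i)).
      { intro i. rewrite Cmod_toC. eapply Rle_trans; [|apply Rle_abs].
        assert (Hz : forall j, Cmod (RtoC (A i j) * x j)%C = A i j * cabs x j)
          by (intro j; now rewrite Cmod_mult, Cmod_R, Habs).
        unfold mv. rewrite <- (Series_ext _ _ Hz).
        replace (matop A x i) with (Series (fun j => Re (RtoC (A i j) * x j)%C),
                                    Series (fun j => Im (RtoC (A i j) * x j)%C)).
        - apply Cmod_pair_Series_le. eapply ex_series_ext; [|apply (He i)]. intro j. now rewrite Hz.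
        - unfold matop. apply injective_projections; apply Series_ext; intro j;
            unfold Re, Im; simpl; ring. }
      split; [|split].
      + intro i. apply (ex_series_ext (fun j => A i j * cabs x j)); [|apply (He i)].
        intro j. now rewrite Habs.
      + exact (L_le _ _ HLm Hle).
      + eapply Rle_trans; [exact (nrm_le _ _ HLm Hle)|]. now rewrite nrm_cabs in Hn. }
  split; [|split; [|split]]; trivial.
  - intros x Hx'. destruct (Hx x Hx') as (H1 & H2 & _). now split.
  - intros x Hx'. now apply Hx.
Qed.

Lemma good_dom (b : R) (A B : mat) : nonneg_mat N A -> mle A B -> good b B -> good b A.
Proof.
  intros HA Hle HB. apply good_of_nonneg; trivial; [apply HB|].
  intros x Hx0 Hx.
  assert (Ht : forall i j, 0 <= A i j * x j <= B i j * x j).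
  { intros i j. split; [apply Rmult_le_pos; auto; apply HA|].
    apply Rmult_le_compat_r; auto. }
  assert (He : forall i, ex_series (fun j => A i j * x j)).
  { intro i. apply (ex_series_le (K := R_AbsRing) (V := R_CompleteNormedModule)) with (2 := good_ex b B x i HB Hx).
    intro j. unfold norm; simpl. unfold abs; simpl. rewrite Rabs_pos_eq; apply Ht. }
  assert (HLB := good_mv_L b B x HB Hx).
  assert (Hm : forall i, Cmod (toC (mv A x) i) <= Cmod (toC (mv B x) i)).
  { intro i. rewrite !Cmod_toC.
    assert (0 <= mv A x i) by (apply Series_ge0; trivial; intro; apply Ht).
    assert (mv A x i <= mv B x i) by (apply Series_le; eauto using good_ex).
    rewrite !Rabs_pos_eq; lra. }
  split; [|split]; trivial.
  - exact (L_le _ _ HLB Hm).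
  - eapply Rle_trans; [exact (nrm_le _ _ HLB Hm)|]. now apply good_mv_nrm.
Qed.

Lemma good_le (b c : R) (A : mat) : good b A -> b <= c -> good c A.
Proof.
  intros (Hb & H1 & H2 & H3) Hc. split; [lra|]. split; [|split]; trivial.
  intros x Hx. assert (H0 := nrm_ge0 x Hx). specialize (H3 x Hx). nra.
Qed.

Lemma good_zero : good 0 (fun _ _ => 0).
Proof.
  apply good_of_nonneg; [lra | intros i j; split; trivial; lra |].
  intros x _ Hx. assert (E : mv (fun _ _ => 0) x = fun _ => 0).
  { apply functional_extensionality; intro i. apply Series_zero. intro; ring. }
  split; [|split].
  - intro i. apply (ex_series_ext (fun j => 0 * x j)); [reflexivity|].
    exists 0. change (is_lim_seq (sum_n (fun j => 0 * x j)) 0).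
    apply (is_lim_seq_ext (fun _ => 0)); [|apply is_lim_seq_const].
    intro n. rewrite (sum_n_ext _ (fun _ => 0)) by (intro; apply Rmult_0_l).
    rewrite sum_n_const. symmetry; apply Rmult_0_r.
  - rewrite E. exact L_szero.
  - rewrite E. change (toC (fun _ => 0)) with szero. rewrite nrm_szero. lra.
Qed.

Lemma good_add (a b : R) (A B : mat) :
  good a A -> good b B -> good (a + b) (fun i j => A i j + B i j).
Proof.
  intros HA HB. apply good_of_nonneg.
  - destruct HA, HB; lra.
  - intros i j. destruct HA as (_ & HA & _), HB as (_ & HB & _).
    destruct (HA i j) as [A1 A2], (HB i j) as [B1 B2]. split; [lra|].
    intro Hij. rewrite A2, B2; trivial; ring.
  - intros x _ Hx.
    assert (E : toC (mv (fun i j => A i j + B i j) x) = sadd (toC (mv A x)) (toC (mv B x))).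
    { apply functional_extensionality; intro i. unfold toC, sadd, mv.
      rewrite <- RtoC_plus. f_equal. rewrite <- Series_plus by eauto using good_ex.
      apply Series_ext; intro; ring. }
    assert (HA1 := good_mv_L a A x HA Hx). assert (HB1 := good_mv_L b B x HB Hx).
    split; [|split].
    + intro i. apply (ex_series_ext (fun j => plus (A i j * x j) (B i j * x j))).
      * intro j. symmetry; apply Rmult_plus_distr_r.
      * apply (ex_series_plus (K := R_AbsRing) (V := R_NormedModule)); eauto using good_ex.
    + rewrite E. now apply L_sadd.
    + rewrite E. eapply Rle_trans; [now apply nrm_sadd|].
      assert (H1 := good_mv_nrm a A x HA Hx). assert (H2 := good_mv_nrm b B x HB Hx). lra.
Qed.

Lemma matop_scal (c : R) (A : mat) (x : seqC) :
  matop (fun i j => c * A i j) x = sscal (RtoC c) (matop A x).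
Proof.
  apply functional_extensionality; intro i. unfold matop, sscal.
  apply injective_projections; simpl; rewrite Rmult_0_l, ?Rminus_0_r, ?Rplus_0_r, <- Series_scal_l;
    apply Series_ext; intro; ring.
Qed.

Lemma good_scal (c a : R) (A : mat) : 0 <= c -> good a A -> good (c * a) (fun i j => c * A i j).
Proof.
  intros Hc HA. destruct HA as (Ha & HA1 & HA2 & HA3).
  split; [now apply Rmult_le_pos|]. split; [|split].
  - intros i j. destruct (HA1 i j) as [H1 H2]. split; [now apply Rmult_le_pos|].
    intro H. rewrite H2 by trivial. ring.
  - intros x Hx. destruct (HA2 x Hx) as [He HLx]. split.
    + intro i. apply (ex_series_ext (fun j => scal (Rabs c) (Rabs (A i j) * Cmod (x j)))).
      * intro j. unfold scal; simpl; unfold mult; simpl. rewrite Rabs_mult. ring.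
      * now apply (ex_series_scal (K := R_AbsRing) (V := R_NormedModule)).
    + rewrite matop_scal. now apply L_sscal.
  - intros x Hx. rewrite matop_scal, nrm_sscal, Cmod_R, Rabs_pos_eq, Rmult_assoc by (trivial; now apply HA2).
    apply Rmult_le_compat_l; auto.
Qed.

Lemma good_sum (m : nat) (b : nat -> R) (A : nat -> mat) :
  (forall j, (j < m)%nat -> good (b j) (A j)) ->
  good (sumR m b) (fun i l => sumR m (fun j => A j i l)).
Proof.
  induction m as [|m IH]; intro H; simpl; [exact good_zero|].
  apply (good_add (sumR m b) (b m) (fun i l => sumR m (fun j => A j i l)) (A m)); auto.
Qed.

(** The j-th column is the image of the j-th unit vector, of norm 1; columns outside the index set
    vanish. *)
Lemma L_col (b : R) (A : mat) (j : nat) :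
  good b A -> L (toC (fun i => A i j)) /\ nrm (toC (fun i => A i j)) <= b.
Proof.
  intro HA. destruct (classic (idx N j)) as [Hj|Hj].
  - destruct (proj2 HL j Hj) as [Hu Hu1].
    assert (E : matop A (unitv j) = toC (fun i => A i j)).
    { replace (unitv j) with (toC (fun k => if Nat.eqb k j then 1 else 0)).
      - rewrite matop_toC. unfold toC. apply functional_extensionality; intro i. f_equal.
        unfold mv. rewrite <- (is_series_unique _ _ (is_series_single (fun k => A i k) j)).
        apply Series_ext; intro k. destruct (Nat.eqb k j); ring.
      - apply functional_extensionality; intro k. unfold toC, unitv. now destruct (Nat.eqb k j). }
    destruct (good_bd b A HA) as [_ Hb]. destruct (Hb _ Hu) as [H1 H2].
    rewrite E in *. split; trivial. now rewrite Hu1, Rmult_1_r in H2.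
  - replace (toC (fun i => A i j)) with szero.
    + split; [exact L_szero | rewrite nrm_szero; apply HA].
    + apply functional_extensionality; intro i. unfold toC, szero. f_equal.
      symmetry. apply (proj1 (proj2 HA) i j). now right.
Qed.

Lemma good_entry_le (b : R) (A : mat) (i j : nat) : good b A -> A i j <= b.
Proof.
  intro HA. destruct (L_col b A j HA) as [H1 H2].
  eapply Rle_trans; [apply Rle_abs|]. rewrite <- (Cmod_toC (fun i => A i j)).
  eapply Rle_trans; [apply Cmod_coord_le; eassumption | assumption].
Qed.

(** * Products of infinite matrices *)

Definition rtail (k : nat) (x : nat -> R) : nat -> R := fun i => if Nat.ltb i k then 0 else x i.
Definition spike (k : nat) (x : nat -> R) : nat -> R := fun i => if Nat.eqb i k then x i else 0.

Lemma toC_rtail (k : nat) (x : nat -> R) : toC (rtail k x) = tail k (toC x).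
Proof.
  apply functional_extensionality; intro i. unfold toC, rtail, tail. now destruct (Nat.ltb i k).
Qed.

Lemma mv_spike (A : mat) (k : nat) (x : nat -> R) (i : nat) : mv A (spike k x) i = A i k * x k.
Proof.
  unfold mv. rewrite <- (is_series_unique _ _ (is_series_single (fun j => A i j * x j) k)).
  apply Series_ext; intro j. unfold spike. destruct (Nat.eqb j k); ring.
Qed.

(** One coordinate is split off the tail: B sends it to x n times the n-th column of B, and A sends
    that column to the n-th column of the product. *)
Lemma mv_mv_rtail (a b : R) (A B : mat) (x : nat -> R) (n i : nat) :
  good a A -> good b B -> L (toC x) ->
  mv A (mv B (rtail n x)) i = matmul A B i n * x n + mv A (mv B (rtail (S n) x)) i.
Proof.
  intros HA HB Hx.
  assert (Hs : L (toC (spike n x))).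
  { apply (L_toC_le _ _ Hx). intro k. rewrite Cmod_toC. unfold spike.
    destruct (Nat.eqb k n); [apply Rle_refl | rewrite Rabs_R0; apply Rabs_pos]. }
  assert (Ht : L (toC (rtail (S n) x))) by (rewrite toC_rtail; now apply L_tail).
  replace (rtail n x) with (fun k => spike n x k + rtail (S n) x k).
  - replace (mv B (fun k => spike n x k + rtail (S n) x k))
      with (fun k => mv B (spike n x) k + mv B (rtail (S n) x) k).
    + rewrite (good_mv_plus a) by eauto using good_mv_L. f_equal.
      unfold matmul. rewrite <- Series_scal_r. apply Series_ext; intro k.
      rewrite mv_spike. ring.
    + apply functional_extensionality; intro k. symmetry. now apply (good_mv_plus b).
  - apply functional_extensionality; intro k. unfold spike, rtail.
    destruct (Nat.eqb_spec k n) as [->|Hne].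
    + rewrite Nat.ltb_irrefl, (proj2 (Nat.ltb_lt _ _)) by lia. ring.
    + destruct (Nat.ltb_spec k n); destruct (Nat.ltb_spec k (S n)); try lia; ring.
Qed.

(* Order continuity of the norm replaces Fubini: the partial sums differ from the limit
   by the image of a tail of [x]. *)
Lemma is_series_matmul (a b : R) (A B : mat) (x : nat -> R) (i : nat) :
  good a A -> good b B -> L (toC x) ->
  is_series (fun j => matmul A B i j * x j) (mv A (mv B x) i).
Proof.
  intros HA HB Hx.
  (* [sum_n] includes the index n, so the remainder involves the tail from n + 1. *)
  assert (Hsum : forall n, mv A (mv B x) i =
    sum_n (fun j => matmul A B i j * x j) n + mv A (mv B (rtail (S n) x)) i).
  { induction n as [|n IH].
    - rewrite sum_O. replace x with (rtail 0 x) at 1 by reflexivity. now apply (mv_mv_rtail a b).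
    - rewrite IH, sum_Sn, (mv_mv_rtail a b A B x (S n)) by trivial.
      unfold plus; simpl. ring. }
  change (is_lim_seq (sum_n (fun j => matmul A B i j * x j)) (mv A (mv B x) i)).
  apply is_lim_seq_spec. intros eps. assert (He := cond_pos eps).
  assert (Ha := proj1 HA). assert (Hb := proj1 HB).
  destruct (nrm_tail_lim (toC x) (eps / (a * b + 1)) Hx) as [K HK].
  { apply Rdiv_lt_0_compat; trivial. nra. }
  exists K. intros n Hn. rewrite (Hsum n).
  replace (_ - _) with (- mv A (mv B (rtail (S n) x)) i) by (simpl; ring).
  rewrite Rabs_Ropp, <- Cmod_toC.
  assert (Ht : L (toC (rtail (S n) x))) by (rewrite toC_rtail; now apply L_tail).
  eapply Rle_lt_trans; [apply Cmod_coord_le; eauto using good_mv_L|].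
  specialize (HK (S n) ltac:(lia)). rewrite <- toC_rtail in HK.
  eapply Rle_lt_trans; [apply (good_mv_nrm a); eauto using good_mv_L|].
  assert (H1 := good_mv_nrm b B _ HB Ht). assert (H0 := nrm_ge0 _ Ht).
  apply Rle_lt_trans with (a * b * nrm (toC (rtail (S n) x))).
  - rewrite Rmult_assoc. now apply Rmult_le_compat_l.
  - apply (Rmult_lt_compat_l (a * b + 1)) in HK; [|nra].
    replace ((a * b + 1) * (eps / (a * b + 1))) with (pos eps) in HK by (field; nra). nra.
Qed.

Lemma mv_matmul (a b : R) (A B : mat) (x : nat -> R) :
  good a A -> good b B -> L (toC x) -> mv (matmul A B) x = mv A (mv B x).
Proof.
  intros HA HB Hx. apply functional_extensionality; intro i.
  now apply is_series_unique, (is_series_matmul a b).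
Qed.

Lemma matmul_nonneg (a b : R) (A B : mat) : good a A -> good b B -> nonneg_mat N (matmul A B).
Proof.
  intros HA HB i j. split.
  - apply Series_ge0.
    + apply (good_ex a); trivial. now apply (L_col b).
    + intro k. apply Rmult_le_pos; eauto using good_ge0.
  - intro Hij. apply Series_zero. intro k.
    destruct HA as (_ & HA & _), HB as (_ & HB & _).
    destruct Hij as [H|H].
    + rewrite (proj2 (HA i k)); [ring | now left].
    + rewrite (proj2 (HB k j)); [ring | now right].
Qed.

Lemma good_matmul (a b : R) (A B : mat) : good a A -> good b B -> good (a * b) (matmul A B).
Proof.
  intros HA HB. apply good_of_nonneg.
  - destruct HA, HB. now apply Rmult_le_pos.
  - now apply (matmul_nonneg a b).
  - intros x _ Hx. rewrite (mv_matmul a b) by trivial. split; [|split].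
    + intro i. eexists. now apply (is_series_matmul a b).
    + eauto using good_mv_L.
    + eapply Rle_trans; [apply (good_mv_nrm a); eauto using good_mv_L|].
      rewrite Rmult_assoc. apply Rmult_le_compat_l; [apply HA | now apply good_mv_nrm].
Qed.

Lemma matop_matmul (a b : R) (A B : mat) (x : seqC) :
  good a A -> good b B -> L x -> matop (matmul A B) x = matop A (matop B x).
Proof.
  intros HA HB Hx.
  assert (E : forall A x, matop A x = fun i => (mv A (fun j => Re (x j)) i, mv A (fun j => Im (x j)) i))
    by reflexivity.
  rewrite E, !(mv_matmul a b) by auto using L_Re, L_Im. reflexivity.
Qed.

(** Multiplication by D on the right is the action on the columns of D, which lie in L; so this is
    [mv_matmul] column by column. *)
Lemma matmul_assoc (a b c : R) (A B D : mat) :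
  good a A -> good b B -> good c D -> matmul (matmul A B) D = matmul A (matmul B D).
Proof.
  intros HA HB HD. apply functional_extensionality; intro i. apply functional_extensionality; intro j.
  change (mv (matmul A B) (fun k => D k j) i = mv A (mv B (fun k => D k j)) i).
  rewrite (mv_matmul a b); trivial. now apply (L_col c).
Qed.

Lemma matmul_mle (a b : R) (A A' B B' : mat) :
  nonneg_mat N A -> nonneg_mat N B -> good a A' -> good b B' -> mle A A' -> mle B B' ->
  mle (matmul A B) (matmul A' B').
Proof.
  intros HA HB HA' HB' HlA HlB i j. apply Series_le.
  - intro k. split; [apply Rmult_le_pos; [apply HA | apply HB]|].
    apply Rmult_le_compat; auto; [apply HA | apply HB].
  - apply (good_ex a A' (fun k => B' k j)); trivial. now apply (L_col b).
Qed.

(** * Tail matrices and monotonicity of the measure of noncompactness *)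

Definition tailmat (p : nat) (A : mat) : mat := fun i j => if Nat.ltb i p then 0 else A i j.

Lemma matop_tailmat (p : nat) (A : mat) (x : seqC) : matop (tailmat p A) x = tail p (matop A x).
Proof.
  apply functional_extensionality; intro i. unfold matop, tail, tailmat.
  destruct (Nat.ltb i p); trivial.
  unfold RtoC. f_equal; apply Series_zero; intro; ring.
Qed.

Lemma tailmat_nonneg (p : nat) (A : mat) : nonneg_mat N A -> nonneg_mat N (tailmat p A).
Proof.
  intros HA i j. unfold tailmat. destruct (Nat.ltb i p); [split; trivial; lra | apply HA].
Qed.

Lemma tailmat_mle (p : nat) (A B : mat) : mle A B -> mle (tailmat p A) (tailmat p B).
Proof. intros H i j. unfold tailmat. destruct (Nat.ltb i p); [apply Rle_refl | apply H]. Qed.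

Lemma tailmat_le (p : nat) (A : mat) : nonneg_mat N A -> mle (tailmat p A) A.
Proof. intros H i j. unfold tailmat. destruct (Nat.ltb i p); [apply H | apply Rle_refl]. Qed.

Lemma good_tailmat (p : nat) (b d : R) (A : mat) :
  good b A -> bd (fun x => tail p (matop A x)) d -> good d (tailmat p A).
Proof.
  intros HA [Hd H].
  assert (HA' := good_dom b _ A (tailmat_nonneg p A (proj1 (proj2 HA)))
    (tailmat_le p A (proj1 (proj2 HA))) HA).
  destruct HA' as (_ & H1 & H2 & _). split; [|split; [|split]]; trivial.
  intros x Hx. rewrite matop_tailmat. now apply H.
Qed.

Notation gam A := (gamma L nrm (matop A)).

(** Together with [gamma_le_tail], this trades [gamma] for norm bounds on nonnegative tail matrices,
    which can be compared entrywise. *)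
Lemma gamma_lt_tail (b d : R) (A : mat) :
  good b A -> gam A < d -> exists k, forall p, (k <= p)%nat -> good d (tailmat p A).
Proof.
  intros HA Hd. assert (HB := good_bop b A HA).
  assert (Hc : cov (matop A) ((gam A + d) / 2)) by (apply bop_cov; trivial; lra).
  destruct (bd_tail_of_cov _ _ d HB Hc) as [k Hk]; [lra|].
  exists k. intros p Hp. apply (good_tailmat p b); auto.
Qed.

Lemma gamma_le_tail (b d : R) (p : nat) (A : mat) :
  good b A -> good d (tailmat p A) -> gam A <= d.
Proof.
  intros HA Hd. apply gamma_le_of_cov. intros d' Hlt.
  apply (cov_of_bd_tail _ p d); trivial; [now apply (good_bop b)|].
  destruct (good_bd _ _ Hd) as [H0 H]. split; trivial.
  intros x Hx. rewrite <- matop_tailmat. now apply H.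
Qed.

Lemma gamma_mono (b : R) (A B : mat) : nonneg_mat N A -> mle A B -> good b B -> gam A <= gam B.
Proof.
  intros HA Hle HB. assert (HA' := good_dom b A B HA Hle HB).
  apply Rnot_lt_le; intro Hlt.
  destruct (gamma_lt_tail b ((gam A + gam B) / 2) B HB) as [k Hk]; [lra|].
  assert (gam A <= (gam A + gam B) / 2); [|lra].
  apply (gamma_le_tail b _ k); trivial.
  apply (good_dom _ _ (tailmat k B)); auto using tailmat_nonneg, tailmat_mle.
Qed.

Lemma gamma_good_le (b : R) (A : mat) : good b A -> gam A <= b.
Proof. intro HA. now apply gamma_le_bd, good_bd. Qed.

Lemma gamma_matmul (a b : R) (A B : mat) :
  good a A -> good b B -> gam (matmul A B) <= gam A * gam B.
Proof.
  intros HA HB. rewrite (gamma_ext _ (fun x => matop A (matop B x))).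
  - eauto using gamma_comp, good_bop.
  - intros x Hx. now apply (matop_matmul a b).
Qed.

(** * The essential spectral radius of a nonnegative matrix *)

(** [mp A n] is the power A^(n+1): the shift matches [setpow] at [S n] and avoids the identity
    matrix. *)
Fixpoint mp (A : mat) (n : nat) : mat :=
  match n with O => A | S n' => matmul (mp A n') A end.

(** The partial Neumann sum I + T + ... + T^(k-1), in Horner form. *)
Fixpoint psum (T : seqC -> seqC) (k : nat) (x : seqC) : seqC :=
  match k with O => szero | S k' => sadd x (T (psum T k' x)) end.

Lemma L_iter (T : seqC -> seqC) (n : nat) (x : seqC) :
  bop L nrm T -> L x -> L (Nat.iter n T x).
Proof. intros [HT _] Hx. induction n; simpl; auto. Qed.

Lemma bop_iter (T : seqC -> seqC) (n : nat) : bop L nrm T -> bop L nrm (Nat.iter n T).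
Proof.
  intro HT. induction n as [|n IH].
  - apply (bop_of_bd _ 1); try reflexivity. split; [lra|].
    intros x Hx. split; trivial. simpl; lra.
  - apply (bop_comp T (Nat.iter n T) HT IH).
Qed.

Lemma bop_psum (T : seqC -> seqC) (k : nat) : bop L nrm T -> bop L nrm (psum T k).
Proof.
  intro HT. induction k as [|k IH].
  - apply (bop_of_bd _ 0); [|intros; simpl; seq_ring | intros; simpl; seq_ring].
    split; [lra|]. intros x Hx. split; [exact L_szero|]. simpl. rewrite nrm_szero. lra.
  - apply (bop_sadd (fun x => x) (fun x => T (psum T k x))).
    + exact (bop_iter T 0 HT).
    + now apply bop_comp.
Qed.

Lemma psum_sub (T : seqC -> seqC) (k : nat) (x : seqC) :
  bop L nrm T -> L x -> ssub (psum T k x) (T (psum T k x)) = ssub x (Nat.iter k T x).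
Proof.
  intros HT Hx. assert (HP := fun k => proj1 (bop_psum T k HT) x Hx).
  assert (HT1 := proj1 HT).
  induction k as [|k IH]; simpl.
  - replace (T szero) with szero; [seq_ring|].
    replace szero with (sscal 0 szero) by seq_ring.
    destruct HT as (_ & _ & -> & _); [seq_ring | exact L_szero].
  - replace (T (sadd x (T (psum T k x)))) with (sadd (T x) (T (T (psum T k x)))).
    + replace (ssub (sadd x (T (psum T k x))) (sadd (T x) (T (T (psum T k x)))))
        with (sadd (ssub x (T x)) (ssub (T (psum T k x)) (T (T (psum T k x))))) by seq_ring.
      rewrite <- (bop_ssub T (psum T k x)), IH, bop_ssub by auto using L_iter. seq_ring.
    + destruct HT as (_ & -> & _); auto.
Qed.

Lemma psum_comm (T : seqC -> seqC) (k : nat) (x : seqC) :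
  bop L nrm T -> L x -> psum T k (T x) = T (psum T k x).
Proof.
  intros HT Hx. assert (HP := fun k => proj1 (bop_psum T k HT) x Hx).
  assert (HT1 := proj1 HT). induction k as [|k IH]; simpl.
  - replace szero with (sscal 0 szero) by seq_ring.
    destruct HT as (_ & _ & -> & _); [seq_ring | exact L_szero].
  - rewrite IH. destruct HT as (_ & -> & _); auto.
Qed.

(** Fixed-point iteration of y -> x + U y, started at 0; the one place where completeness of L
    enters. *)
Lemma contraction_solve (U : seqC -> seqC) (q : R) (x : seqC) :
  bop L nrm U -> bd U q -> q < 1 -> L x -> exists y, L y /\ ssub y (U y) = x.
Proof.
  intros HU [Hq Hb] Hq1 Hx.
  set (y := fix y p := match p with O => szero | S p' => sadd x (U (y p')) end).
  assert (HLy : forall p, L (y p)).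
  { induction p; simpl; [exact L_szero|]. apply L_sadd; trivial. now apply HU. }
  set (K := nrm x / (1 - q)).
  assert (HK : 0 <= K) by (apply Rdiv_le_0_compat; [now apply nrm_ge0 | lra]).
  assert (HKe : nrm x + q * K = K) by (unfold K; field; lra).
  assert (HyK : forall p, nrm (y p) <= K).
  { induction p as [|p IH]; simpl; [now rewrite nrm_szero|].
    destruct (Hb (y p) (HLy p)) as [H1 H2].
    eapply Rle_trans; [now apply nrm_sadd|]. nra. }
  (* y (p + k) - y p is the p-th iterate of U at y k, and every y k has norm at most K. *)
  assert (Hdiff : forall p k, nrm (ssub (y (p + k)%nat) (y p)) <= q ^ p * K).
  { induction p as [|p IH]; intro k.
    - simpl. replace (ssub (y k) szero) with (y k) by seq_ring. rewrite Rmult_1_l. auto.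
    - simpl. replace (ssub (sadd x (U (y (p + k)%nat))) (sadd x (U (y p))))
        with (ssub (U (y (p + k)%nat)) (U (y p))) by seq_ring.
      rewrite <- bop_ssub by auto.
      destruct (Hb (ssub (y (p + k)%nat) (y p))) as [_ H]; [apply L_ssub; auto|].
      specialize (IH k). assert (H0 := nrm_ge0 _ (L_ssub _ _ (HLy (p + k)%nat) (HLy p))). nra. }
  assert (Hsmall : forall eps, 0 < eps -> exists P, forall p k, (P <= p)%nat ->
                     nrm (ssub (y (p + k)%nat) (y p)) < eps).
  { intros eps He. destruct (pow_lt_1_zero q) with (y := eps / (K + 1)) as [P HP].
    - rewrite Rabs_pos_eq; lra.
    - apply Rdiv_lt_0_compat; lra.
    - exists P. intros p k Hp. specialize (HP p Hp). rewrite Rabs_pos_eq in HP by now apply pow_le.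
      eapply Rle_lt_trans; [apply Hdiff|].
      assert (H0 : 0 <= q ^ p) by now apply pow_le.
      apply (Rmult_lt_compat_r (K + 1)) in HP; [|lra].
      replace (eps / (K + 1) * (K + 1)) with eps in HP by (field; lra). nra. }
  destruct (bss_complete _ _ _ (proj1 HL) y HLy) as (z & Hz & Hlim).
  { intros eps He. destruct (Hsmall (eps / 2)) as [P HP]; [lra|]. exists P. intros p p' Hp Hp'.
    replace (ssub (y p) (y p')) with (ssub (ssub (y p) (y P)) (ssub (y p') (y P))) by seq_ring.
    eapply Rle_lt_trans; [apply nrm_ssub; auto using L_ssub|].
    assert (H1 := HP P (p - P)%nat (le_n P)). assert (H2 := HP P (p' - P)%nat (le_n P)).
    replace (P + (p - P))%nat with p in H1 by lia. replace (P + (p' - P))%nat with p' in H2 by lia. lra. }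
  exists z. split; trivial.
  assert (HUz : L (U z)) by now apply HU.
  assert (E : ssub (ssub z (U z)) x = szero).
  { apply nrm_eq0; [auto using L_ssub|]. intros eps He.
    destruct (Hlim (eps / 2)) as [P HP]; [lra|].
    replace (ssub (ssub z (U z)) x) with
      (ssub (U (ssub (y P) z)) (ssub (y (S P)) z)).
    - destruct (Hb (ssub (y P) z)) as [H1 H2]; [auto using L_ssub|].
      eapply Rle_trans; [apply nrm_ssub; auto using L_ssub|].
      assert (H3 := HP P (le_n P)). assert (H4 := HP (S P) (Nat.le_succ_diag_r P)).
      assert (H0 := nrm_ge0 _ (L_ssub _ _ (HLy P) Hz)). nra.
    - rewrite (bop_ssub U) by auto. simpl. seq_ring. }
  replace x with (sadd x szero) by seq_ring. rewrite <- E. seq_ring.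
Qed.

Lemma contraction_inj (U : seqC -> seqC) (q : R) (y : seqC) :
  bd U q -> q < 1 -> L y -> y = U y -> y = szero.
Proof.
  intros [Hq Hb] Hq1 Hy E. apply nrm_eq0; trivial. intros eps He.
  destruct (Hb y Hy) as [_ H]. rewrite <- E in H. assert (H0 := nrm_ge0 y Hy). nra.
Qed.

Lemma ssub_eq0 (x y : seqC) : ssub x y = szero -> x = y.
Proof.
  intro E. replace x with (sadd (ssub x y) y) by seq_ring. rewrite E. seq_ring.
Qed.

(** Only an iterate of T is a contraction. With P = I + T + ... + T^(n-1), the identity P (I - T) =
    (I - T) P = I - T^n reduces inverting I - T to inverting I - T^n. A fixed vector of T is one of
    T^n, hence 0; this uniqueness makes the inverse linear. *)
Lemma neumann (T : seqC -> seqC) (n : nat) (q : R) :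
  bop L nrm T -> bd (Nat.iter n T) q -> q < 1 ->
  exists V, bop L nrm V /\
    forall x, L x -> ssub (V x) (T (V x)) = x /\ V (ssub x (T x)) = x.
Proof.
  intros HT Hb Hq. assert (HI := bop_iter T n HT). assert (HP := bop_psum T n HT).
  assert (HT1 := proj1 HT). assert (HI1 := proj1 HI). assert (HP1 := proj1 HP).
  assert (Hpd : forall y, L y -> psum T n (ssub y (T y)) = ssub y (Nat.iter n T y)).
  { intros y Hy. rewrite (bop_ssub (psum T n)), psum_comm by auto. now apply psum_sub. }
  assert (Hinj : forall y, L y -> y = T y -> y = szero).
  { intros y Hy E. apply (contraction_inj (Nat.iter n T) q); trivial.
    clear - E. induction n as [|n IH]; simpl; trivial. now rewrite <- IH. }
  assert (Huniq : forall y z, L y -> L z -> ssub y (T y) = ssub z (T z) -> y = z).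
  { intros y z Hy Hz E. apply ssub_eq0, Hinj; [now apply L_ssub|].
    rewrite (bop_ssub T) by trivial. apply ssub_eq0.
    replace (ssub (ssub y z) (ssub (T y) (T z))) with (ssub (ssub y (T y)) (ssub z (T z))) by seq_ring.
    rewrite E. seq_ring. }
  assert (Hex : forall x, exists y, L x -> L y /\ ssub y (T y) = x).
  { intro x. destruct (classic (L x)) as [Hx|Hx]; [|exists x; tauto].
    destruct (contraction_solve _ q (psum T n x) HI Hb Hq) as (y & Hy & E); auto.
    exists y. intros _. split; trivial. apply ssub_eq0.
    assert (He : L (ssub (ssub y (T y)) x)) by auto using L_ssub.
    apply (contraction_inj (Nat.iter n T) q); trivial.
    apply ssub_eq0. rewrite <- psum_sub by trivial.
    replace (psum T n (ssub (ssub y (T y)) x)) with szero.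
    - replace szero with (sscal 0 szero) at 2 by seq_ring.
      destruct HT as (_ & _ & -> & _); [seq_ring | exact L_szero].
    - rewrite (bop_ssub (psum T n)), Hpd, E by auto using L_ssub. seq_ring. }
  set (V := fun x => proj1_sig (constructive_indefinite_description _ (Hex x))).
  assert (HV : forall x, L x -> L (V x) /\ ssub (V x) (T (V x)) = x).
  { intros x. unfold V. destruct (constructive_indefinite_description _ (Hex x)); trivial. }
  destruct (bop_bd _ HP) as [c [Hc Hcb]].
  exists V. split.
  (* (1 - q) |V x| <= |(I - T^n) V x| = |P x| <= c |x|. *)
  - apply (bop_of_bd _ (c / (1 - q))).
    + split; [apply Rdiv_le_0_compat; lra|]. intros x Hx. destruct (HV x Hx) as [HVx E].
      split; trivial. destruct (Hcb x Hx) as [H1 H2]. rewrite <- E in H2 at 1.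
      rewrite Hpd in H2 by trivial.
      destruct Hb as [Hq0 Hb]. destruct (Hb _ HVx) as [H3 H4].
      assert (H5 : nrm (V x) <= nrm (ssub (V x) (Nat.iter n T (V x))) + nrm (Nat.iter n T (V x))).
      { replace (V x) with (sadd (ssub (V x) (Nat.iter n T (V x))) (Nat.iter n T (V x))) at 1 by seq_ring.
        apply nrm_sadd; auto using L_ssub. }
      apply (Rmult_le_reg_r (1 - q)); [lra|].
      replace (c / (1 - q) * nrm x * (1 - q)) with (c * nrm x) by (field; lra). lra.
    + intros x y Hx Hy. destruct (HV x Hx) as [Hx1 Ex], (HV y Hy) as [Hy1 Ey].
      destruct (HV (sadd x y) (L_sadd _ _ Hx Hy)) as [Hs1 Es].
      apply Huniq; auto using L_sadd. rewrite Es. destruct HT as (_ & -> & _); trivial.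
      rewrite <- Ex at 1. rewrite <- Ey at 1. seq_ring.
    + intros a x Hx. destruct (HV x Hx) as [Hx1 Ex].
      destruct (HV (sscal a x) (L_sscal _ _ Hx)) as [Hs1 Es].
      apply Huniq; auto using L_sscal. rewrite Es. destruct HT as (_ & _ & -> & _); trivial.
      rewrite <- Ex at 1. seq_ring.
  - intros x Hx. split; [now apply HV|].
    assert (Hd : L (ssub x (T x))) by auto using L_ssub.
    apply Huniq; trivial; now apply HV.
Qed.

(** * Powers of a matrix and the upper bound for the essential spectrum *)

Lemma good_mp (b : R) (A : mat) (n : nat) : good b A -> good (b ^ S n) (mp A n).
Proof.
  intro HA. induction n as [|n IH]; [now rewrite pow_1|].
  replace (b ^ S (S n)) with (b ^ S n * b) by (simpl; ring). now apply good_matmul.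
Qed.

Lemma mp_add (b : R) (A : mat) (p q : nat) :
  good b A -> mp A (S (p + q)) = matmul (mp A p) (mp A q).
Proof.
  intro HA. induction q as [|q IH]; simpl.
  - now rewrite Nat.add_0_r.
  - rewrite Nat.add_succ_r, IH. eapply matmul_assoc; eauto using good_mp.
Qed.

Lemma matop_mp (b : R) (A : mat) (n : nat) (x : seqC) :
  good b A -> L x -> matop (mp A n) x = Nat.iter (S n) (matop A) x.
Proof.
  intros HA. revert x. induction n as [|n IH]; intros x Hx; trivial.
  rewrite Nat.iter_succ_r, <- IH by now apply (good_bop b).
  simpl mp. eapply matop_matmul; eauto using good_mp.
Qed.

(** Cutting off rows lowers entries, so in a product of tails all cut-offs except the leftmost may
    be dropped; the leftmost cuts the rows of the whole product. *)
Lemma mp_tailmat_mle (b : R) (p : nat) (A : mat) (n : nat) :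
  good b A -> mle (mp (tailmat p A) n) (tailmat p (mp A n)).
Proof.
  intro HA. assert (HA0 := proj1 (proj2 HA)).
  assert (HT : good b (tailmat p A)) by (apply (good_dom _ _ A); auto using tailmat_nonneg, tailmat_le).
  induction n as [|n IH]; [intros i j; apply Rle_refl|]. simpl.
  assert (Hn : nonneg_mat N (mp A n)) by exact (proj1 (proj2 (good_mp b A n HA))).
  assert (Hle : mle (matmul (mp (tailmat p A) n) (tailmat p A)) (matmul (tailmat p (mp A n)) A)).
  { eapply matmul_mle; eauto using tailmat_le, tailmat_nonneg.
    - exact (proj1 (proj2 (good_mp b _ n HT))).
    - apply (good_dom (b ^ S n) _ (mp A n)); auto using tailmat_le, tailmat_nonneg, good_mp. }
  intros i j. eapply Rle_trans; [apply Hle|]. unfold matmul, tailmat.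
  destruct (Nat.ltb i p); [|apply Rle_refl]. rewrite Series_zero; [apply Rle_refl|]. intro; ring.
Qed.

Lemma iter_sscal (c : C) (T : seqC -> seqC) (n : nat) :
  bop L nrm T -> exists z, Cmod z = Cmod c ^ n /\
  forall x, L x -> Nat.iter n (fun x => sscal c (T x)) x = sscal z (Nat.iter n T x).
Proof.
  intro HT. induction n as [|n (z & Ez & IH)].
  - exists 1. split; [simpl; apply Cmod_1|]. intros x _. simpl. seq_ring.
  - exists (c * z)%C. split; [now rewrite Cmod_mult, Ez|]. intros x Hx. simpl.
    rewrite IH by trivial. assert (Hn := L_iter T n x HT Hx).
    destruct HT as (_ & _ & -> & _); trivial. seq_ring.
Qed.

(* [(tail A)^n] is dominated by [tail (A^n)], so [lam - tail A] has a Neumann inverse,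
   and [A - tail A] is compact. *)
Lemma not_ess_spec (b : R) (A : mat) (n : nat) (lam : C) :
  good b A -> gam (mp A n) < Cmod lam ^ S n -> ~ ess_spec L nrm (matop A) lam.
Proof.
  intros HA Hlt Hspec. apply Hspec. clear Hspec.
  set (d := (gam (mp A n) + Cmod lam ^ S n) / 2).
  destruct (gamma_lt_tail (b ^ S n) d (mp A n)) as [p Hp]; [now apply good_mp | unfold d; lra|].
  specialize (Hp p (le_n p)).
  assert (HA0 := proj1 (proj2 HA)).
  set (A' := tailmat p A).
  assert (HA' : good b A') by (unfold A'; apply (good_dom _ _ A); auto using tailmat_nonneg, tailmat_le).
  assert (Hd : good d (mp A' n)).
  { apply (good_dom _ _ _ (proj1 (proj2 (good_mp b A' n HA')))) with (2 := Hp).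
    now apply (mp_tailmat_mle b). }
  assert (Hl0 : 0 < Cmod lam ^ S n) by (assert (H := gamma_ge0 (matop (mp A n))); lra).
  assert (Hlam : lam <> 0).
  { intros ->. rewrite Cmod_0, pow_i in Hl0 by lia. lra. }
  assert (HT := good_bop b A HA). assert (HT' := good_bop b A' HA').
  set (T := matop A) in *. set (T' := matop A') in *.
  set (mu := (/ lam)%C). assert (Hmu : (mu * lam)%C = 1) by (apply Cinv_l; exact Hlam).
  assert (Hlm : forall z, (lam * (mu * z))%C = z)
    by (intro z; rewrite Cmult_assoc, (Cmult_comm lam), Hmu; ring).
  assert (Hml : forall z, (mu * (lam * z))%C = z) by (intro z; rewrite Cmult_assoc, Hmu; ring).
  (* The iterate of order n + 1 of U = T' / lam has norm at most d / |lam|^(n+1), which is below 1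
     because d is the midpoint of gamma (A^(n+1)) and |lam|^(n+1). *)
  set (U := fun x => sscal mu (T' x)).
  assert (HU : bop L nrm U) by now apply bop_scal.
  destruct (neumann U (S n) (d / Cmod lam ^ S n) HU) as (V & HV & HVU).
  - destruct (iter_sscal mu T' (S n) HT') as (z & Ez & Hz).
    split; [apply Rdiv_le_0_compat; trivial; apply Hd|].
    intros x Hx. change (Nat.iter (S n) U x) with (Nat.iter (S n) (fun x => sscal mu (T' x)) x).
    rewrite Hz by trivial.
    unfold T'. rewrite <- (matop_mp b) by trivial.
    destruct (good_bd _ _ Hd) as [_ Hb]. destruct (Hb x Hx) as [H1 H2].
    split; [now apply L_sscal|]. rewrite nrm_sscal, Ez by trivial.
    unfold mu. rewrite Cmod_inv, pow_inv by trivial. unfold Rdiv.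
    assert (0 < / Cmod lam ^ S n) by now apply Rinv_0_lt_compat.
    replace (d * / Cmod lam ^ S n * nrm x) with (/ Cmod lam ^ S n * (d * nrm x)) by ring.
    apply Rmult_le_compat_l; lra.
  - apply Rlt_div_l; trivial. unfold d; lra.
  - assert (HVL := proj1 HV). assert (HTL := proj1 HT). assert (HT'L := proj1 HT').
    assert (Hdec : forall x, T x = sadd (head p (T x)) (T' x)).
    { intro x. unfold T', A'. rewrite matop_tailmat. symmetry; apply sadd_head_tail. }
    (* S inverts lam - T' exactly. Passing to T, which adds the head of T, leaves the errors - head
       T S and - S head T, both compact. *)
    set (S := fun x => sscal mu (V x)).
    assert (HS : bop L nrm S) by now apply bop_scal.
    exists S, (fun x => sscal (-1) (head p (T (S x)))), (fun x => sscal (-1) (S (head p (T x)))).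
    split; [exact HS|]. split; [|split].
    + apply compact_sscal, (compact_head p (fun x => T (S x))). now apply bop_comp.
    + apply compact_sscal, (compact_comp S); trivial. now apply compact_head.
    + intros x Hx. split.
      * destruct (HVU x Hx) as [E _]. rewrite (Hdec (S x)) at 1.
        replace (T' (S x)) with (U (V x)).
        -- replace (sscal lam (S x)) with (V x).
           ++ transitivity (sadd (ssub (V x) (U (V x))) (sscal (-1) (head p (T (S x))))).
              ** generalize (U (V x)); intro u. seq_ring.
              ** now rewrite E.
           ++ apply functional_extensionality; intro i. unfold S, sscal. now rewrite Hlm.
        -- unfold U, S. destruct HT' as (_ & _ & -> & _); auto.
      * replace (ssub (sscal lam x) (T x)) with
          (sadd (sscal lam (ssub x (U x))) (sscal (-1) (head p (T x)))).
        -- assert (HLU : L (ssub x (U x))) by (apply L_ssub; trivial; apply L_sscal; auto).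
           assert (HLh : L (head p (T x))) by (apply L_head; auto).
           destruct HS as (_ & Hsa & Hss & _).
           rewrite Hsa, !Hss by auto using L_sscal. unfold S at 1.
           destruct (HVU x Hx) as [_ ->].
           apply functional_extensionality; intro i. unfold sadd, sscal. rewrite Hlm. ring.
        -- rewrite (Hdec x) at 2. apply functional_extensionality; intro i.
           unfold ssub, sadd, sscal, U, sscal.
           replace (lam * (x i - mu * T' x i))%C with (lam * x i - lam * (mu * T' x i))%C by ring.
           rewrite Hlm. ring.
Qed.

(** * Truncated resolvents and the lower bound for the essential spectral radius *)

Lemma gamma_scal_le (c b : R) (A : mat) :
  0 <= c -> good b A -> gam (fun i j => c * A i j) <= c * gam A.
Proof.
  intros Hc HA. rewrite (gamma_ext _ (fun x => sscal (RtoC c) (matop A x))).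
  - eapply Rle_trans; [now apply gamma_sscal, (good_bop b)|].
    rewrite Cmod_R, Rabs_pos_eq by trivial. apply Rle_refl.
  - intros. apply matop_scal.
Qed.

Lemma mp_scal (c : R) (A : mat) (n : nat) :
  mp (fun i j => c * A i j) n = fun i j => c ^ S n * mp A n i j.
Proof.
  induction n as [|n IH].
  - apply functional_extensionality; intro i; apply functional_extensionality; intro j. simpl; ring.
  - simpl mp. rewrite IH. apply functional_extensionality; intro i; apply functional_extensionality; intro j.
    unfold matmul. rewrite <- Series_scal_l. apply Series_ext; intro k. simpl; ring.
Qed.

(** B + B^2 + ... + B^(k+1), a truncated resolvent without its identity term. *)
Fixpoint vm (B : mat) (k : nat) : mat :=
  match k with O => B | S k' => fun i j => vm B k' i j + mp B (S k') i j end.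

Lemma good_vm (b : R) (B : mat) (k : nat) : good b B -> exists c, good c (vm B k).
Proof.
  intro HB. induction k as [|k [c IH]]; [now exists b|].
  exists (c + b ^ S (S k)). exact (good_add _ _ _ _ IH (good_mp b B (S k) HB)).
Qed.

Lemma matop_add (a b : R) (A B : mat) (x : seqC) :
  good a A -> good b B -> L x ->
  matop (fun i j => A i j + B i j) x = sadd (matop A x) (matop B x).
Proof.
  intros HA HB Hx. apply functional_extensionality; intro i.
  unfold matop, sadd. apply injective_projections; simpl;
    rewrite <- Series_plus by (eapply good_ex; eauto using L_Re, L_Im);
    apply Series_ext; intro; ring.
Qed.

(** V (I - B) = B - B^(k+2) for V = B + ... + B^(k+1), applied to x; [mp B (S k)] is B^(k+2). *)
Lemma vm_telescope (b : R) (B : mat) (k : nat) (x : seqC) :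
  good b B -> L x ->
  ssub (matop (vm B k) x) (matop (vm B k) (matop B x)) = ssub (matop B x) (matop (mp B (S k)) x).
Proof.
  intros HB Hx. assert (HBx : L (matop B x)) by now apply (good_bop b).
  induction k as [|k IH].
  - change (vm B 0) with B. f_equal. symmetry. eapply matop_matmul; eauto.
  - destruct (good_vm b B k HB) as [c Hc]. assert (Hm := good_mp b B (S k) HB).
    change (vm B (S k)) with (fun i j => vm B k i j + mp B (S k) i j).
    rewrite !(matop_add c (b ^ S (S k))) by trivial.
    replace (matop (mp B (S k)) (matop B x)) with (matop (mp B (S (S k))) x)
      by (eapply matop_matmul; eauto).
    set (u := matop (vm B k) x) in *. set (v := matop (vm B k) (matop B x)) in *.
    set (s := matop (mp B (S k)) x) in *. set (t := matop (mp B (S (S k))) x).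
    replace (ssub (sadd u s) (sadd v t)) with (sadd (ssub u v) (ssub s t)) by seq_ring.
    rewrite IH. seq_ring.
Qed.

Lemma mp_le_vm (b : R) (B : mat) (k i : nat) : good b B -> (i <= k)%nat -> mle (mp B i) (vm B k).
Proof.
  intros HB Hi. induction k as [|k IH].
  - replace i with 0%nat by lia. intros p q; apply Rle_refl.
  - intros p q. simpl vm. destruct (Nat.eq_dec i (S k)) as [->|Hne].
    + destruct (good_vm b B k HB) as [c Hc]. assert (H := good_ge0 c _ p q Hc). simpl mp; lra.
    + specialize (IH ltac:(lia) p q). assert (H := good_ge0 _ _ p q (good_mp b B (S k) HB)).
      simpl mp in *; lra.
Qed.

Lemma vm_mono (b : R) (B : mat) (k l : nat) : good b B -> (k <= l)%nat -> mle (vm B k) (vm B l).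
Proof.
  intros HB H. induction H as [|l H IH]; intros p q; [apply Rle_refl|].
  eapply Rle_trans; [apply IH|]. simpl vm.
  assert (H0 := good_ge0 _ _ p q (good_mp b B (S l) HB)). simpl mp in *; lra.
Qed.

(** B^(n+1) = B^(n-i) B^(i+1) for each i <= k. These are k + 1 of the nonnegative terms obtained by
    expanding the product, since n <= M puts B^(n-i) into the first sum. *)
Lemma vm_square_lower (b : R) (B : mat) (M n k : nat) :
  good b B -> (n <= M)%nat -> (k < n)%nat ->
  mle (fun i j => INR (S k) * mp B n i j) (matmul (vm B M) (vm B k)).
Proof.
  intros HB HM. destruct (good_vm b B M HB) as [c Hc].
  assert (Hstep : forall i, (i < n)%nat -> mle (mp B n) (matmul (vm B M) (mp B i))).
  { intros i Hi. replace n with (S ((n - 1 - i) + i)) by lia. rewrite (mp_add b) by trivial.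
    apply (matmul_mle c (b ^ S i)); auto using good_mp.
    - exact (proj1 (proj2 (good_mp b B _ HB))).
    - exact (proj1 (proj2 (good_mp b B _ HB))).
    - apply (mp_le_vm b); trivial. lia.
    - intros p q; apply Rle_refl. }
  induction k as [|k IH]; intros Hk i j.
  - simpl INR. rewrite Rmult_1_l. exact (Hstep 0%nat Hk i j).
  - specialize (IH ltac:(lia) i j). specialize (Hstep (S k) Hk i j).
    destruct (good_vm b B k HB) as [e He].
    replace (matmul (vm B M) (vm B (S k)) i j) with
      (matmul (vm B M) (vm B k) i j + matmul (vm B M) (mp B (S k)) i j).
    + rewrite S_INR. lra.
    + unfold matmul. rewrite <- Series_plus.
      * apply Series_ext; intro l. simpl vm. simpl mp. ring.
      * apply (good_ex c (vm B M) (fun l => vm B k l j)); trivial. now apply (L_col e).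
      * apply (good_ex c (vm B M) (fun l => mp B (S k) l j)); trivial.
        apply (L_col (b ^ S (S k))). now apply good_mp.
Qed.

Lemma bernoulli (eta : R) (k : nat) : 0 <= eta <= 1 -> 1 - INR k * eta <= (1 - eta) ^ k.
Proof.
  intro He. induction k as [|k IH]; [simpl; lra|].
  rewrite S_INR. simpl. assert (0 <= INR k) by apply pos_INR.
  assert ((1 - eta) * (1 - INR k * eta) <= (1 - eta) * (1 - eta) ^ k)
    by (apply Rmult_le_compat_l; lra). nra.
Qed.

(* Pringsheim-type argument. With [B = A / lam], [lam > J], the sums [V = B + ... + B^(M+1)]
   satisfy [V (1 - B) = B - B^(M+2)]; if [J - A] were invertible modulo compacts, [gamma V]
   would stay bounded as [lam] decreases to [J], while [n B^(n+1) <= V V] entrywise. *)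
Lemma ess_spec_radius (b : R) (A : mat) (J : R) :
  good b A -> 0 < J -> (forall n, J ^ S n <= gam (mp A n)) ->
  (forall t, J < t -> exists C, 0 <= C /\ forall n, gam (mp A n) <= C * t ^ S n) ->
  ess_spec L nrm (matop A) (RtoC J).
Proof.
  intros HA HJ Hlow Hup (S & K1 & K2 & HS & HK1 & _ & HI).
  set (sg := gamma L nrm S). assert (Hsg : 0 <= sg) by apply gamma_ge0.
  set (g := gam A). assert (Hg : 0 <= g) by apply gamma_ge0.
  (* The bound for [gam V] obtained below from gam V <= sg (g + 2 J) + gam V / 2. *)
  set (C0 := 2 * (sg * (g + 2 * J))).
  assert (HC0 : 0 <= C0) by (unfold C0; assert (0 <= sg * (g + 2 * J)) by (apply Rmult_le_pos; lra); lra).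
  destruct (nfloor_ex (2 * (C0 * C0))) as [n0 [_ Hn0]]; [nra|].
  (* The contradiction will be n / 2 <= n gamma (B^(n+1)) <= gamma (V)^2 <= C0^2. The choices are
     made in the order n, lam, M; the bound C0 depends on none of them. *)
  set (n := Datatypes.S n0). assert (Hn : 2 * (C0 * C0) < INR n) by (unfold n; now rewrite S_INR).
  assert (HnS : 0 < INR (Datatypes.S n)) by (apply lt_0_INR; lia).
  (* eta is 1 - J / lam. The first term makes (1 - eta)^(n+1) >= 1/2 by Bernoulli's inequality, the
     second gives (lam - J) sg <= 1/2; the summand 2 in it yields eta <= 1/2, so lam <= 2 J. *)
  set (eta := Rmin (/ (2 * INR (Datatypes.S n))) (/ (4 * J * sg + 2))).
  assert (HJs : 0 <= J * sg) by (apply Rmult_le_pos; lra).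
  assert (Heta : 0 < eta) by (apply Rmin_glb_lt; apply Rinv_0_lt_compat; lra).
  assert (He1 : INR (Datatypes.S n) * eta <= / 2).
  { apply Rle_trans with (INR (Datatypes.S n) * / (2 * INR (Datatypes.S n))).
    - apply Rmult_le_compat_l; [lra | apply Rmin_l].
    - right; field; lra. }
  assert (He2 : (4 * J * sg + 2) * eta <= 1).
  { apply Rle_trans with ((4 * J * sg + 2) * / (4 * J * sg + 2)).
    - apply Rmult_le_compat_l; [lra | apply Rmin_r].
    - right; field; lra. }
  clearbody eta.
  assert (Hehalf : eta <= / 2) by nra.
  set (lam := J / (1 - eta)).
  assert (HJl : J = lam * (1 - eta)) by (unfold lam; field; lra).
  assert (Hlam : J < lam) by (apply Rlt_div_r; nra).
  clearbody lam.
  assert (Hlam2 : lam <= 2 * J) by nra.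
  assert (Hgap : (lam - J) * sg <= / 2).
  { replace (lam - J) with (lam * eta) by (rewrite HJl; ring).
    assert (lam * eta * sg <= 2 * J * eta * sg).
    { apply Rmult_le_compat_r; trivial. apply Rmult_le_compat_r; lra. }
    nra. }
  set (B := fun i j => / lam * A i j).
  assert (Hil : 0 < / lam) by (apply Rinv_0_lt_compat; lra).
  assert (HB : good (/ lam * b) B) by (apply good_scal; trivial; lra).
  set (c := / lam * b) in *.
  assert (HgB : forall m, gam (mp B m) <= (/ lam) ^ Datatypes.S m * gam (mp A m)).
  { intro m. unfold B. rewrite mp_scal.
    apply (gamma_scal_le _ (b ^ Datatypes.S m)); [apply pow_le; lra | now apply good_mp]. }
  assert (HAB : forall m, gam (mp A m) <= lam ^ Datatypes.S m * gam (mp B m)).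
  { intro m. replace (mp A m) with (fun i j => lam ^ Datatypes.S m * mp B m i j).
    - apply (gamma_scal_le _ (c ^ Datatypes.S m)); [apply pow_le; lra | now apply good_mp].
    - unfold B. rewrite mp_scal. apply functional_extensionality; intro i.
      apply functional_extensionality; intro j.
      rewrite <- Rmult_assoc, <- Rpow_mult_distr, Rinv_r, pow1 by lra. ring. }
  (* As lam > J, gamma (B^(M+2)) tends to 0, so the remainder of the telescoping sum is harmless for
     large M. *)
  assert (HM : exists M, (n <= M)%nat /\ gam (mp B (Datatypes.S M)) <= 1).
  { destruct (Hup ((J + lam) / 2)) as (C & HC & HCg); [lra|].
    destruct (pow_ratio_eventually C ((J + lam) / 2) lam) as [K HK]; [lra|].
    exists (n + K)%nat. split; [lia|].
    eapply Rle_trans; [apply HgB|]. rewrite pow_inv.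
    assert (Hp : 0 < lam ^ Datatypes.S (Datatypes.S (n + K))) by (apply pow_lt; lra).
    apply (Rmult_le_reg_l _ _ _ Hp). rewrite <- Rmult_assoc, Rinv_r by lra.
    specialize (HCg (Datatypes.S (n + K))). specialize (HK (Datatypes.S (Datatypes.S (n + K))) ltac:(lia)).
    lra. }
  destruct HM as (M & HnM & HM1).
  destruct (good_vm c B M HB) as [v Hv]. set (V := vm B M) in *.
  set (P := mp B (Datatypes.S M)) in *.
  assert (HP : good (c ^ Datatypes.S (Datatypes.S M)) P) by now apply good_mp.
  assert (BB := good_bop _ _ HB). assert (BV := good_bop _ _ Hv). assert (BP := good_bop _ _ HP).
  assert (HSL := proj1 HS).
  (* Applying V to (J - A) S = I + K1 with A = lam B, and writing J = lam - (lam - J), gives V = lam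
     (V - V B) S - (lam - J) V S - V K1; telescoping turns V - V B into B - P. *)
  set (F := fun x => sadd (sscal (RtoC lam) (sadd (matop B (S x)) (sscal (RtoC (-1)) (matop P (S x)))))
             (sadd (sscal (RtoC (- (lam - J))) (matop V (S x))) (sscal (RtoC (-1)) (matop V (K1 x))))).
  assert (EF : forall x, L x -> matop V x = F x).
  { intros x Hx. destruct (HI x Hx) as [E _]. clear HI.
    assert (HK1x : L (K1 x)) by (apply (proj1 HK1); trivial).
    assert (HSx := HSL x Hx). assert (HBS : L (matop B (S x))) by now apply BB.
    assert (EA : matop A (S x) = sscal (RtoC lam) (matop B (S x))).
    { unfold B. rewrite matop_scal. apply functional_extensionality; intro i. unfold sscal.
      rewrite Cmult_assoc, <- RtoC_mult, Rinv_r by lra. ring. }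
    rewrite EA in E.
    assert (E1 : sadd (matop V x) (matop V (K1 x)) =
                 ssub (sscal (RtoC J) (matop V (S x))) (sscal (RtoC lam) (matop V (matop B (S x))))).
    { pose proof BV as (_ & Va & Vs & _).
      rewrite <- Va, <- E, (bop_ssub (matop V)), !Vs by auto using L_sscal. reflexivity. }
    assert (E2 := vm_telescope c B M (S x) HB HSx). fold V P in E2.
    apply functional_extensionality; intro i.
    assert (E1i := f_equal (fun f => f i) E1). assert (E2i := f_equal (fun f => f i) E2).
    unfold sadd, ssub, sscal in E1i, E2i. unfold F, sadd, sscal. simpl in E1i, E2i.
    replace (matop V x i) with (matop V x i + matop V (K1 x) i - matop V (K1 x) i)%C by ring.
    rewrite E1i.
    replace (matop B (S x) i + RtoC (-1) * matop P (S x) i)%C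
      with (matop B (S x) i - matop P (S x) i)%C by ring.
    rewrite <- E2i. rewrite RtoC_opp, RtoC_minus. ring. }
  assert (HgV : gam V <= C0).
  { assert (H1 : gam V <= lam * (gam B * sg + 1 * (gam P * sg)) + ((lam - J) * (gam V * sg) + 1 * 0)).
    { rewrite (gamma_ext _ F) at 1 by exact EF.
      assert (X1 : bop L nrm (fun x => matop B (S x))) by now apply bop_comp.
      assert (X2 : bop L nrm (fun x => matop P (S x))) by now apply bop_comp.
      assert (X3 : bop L nrm (fun x => matop V (S x))) by now apply bop_comp.
      assert (X4 : compact_op L nrm (fun x => matop V (K1 x))) by now apply compact_comp.
      assert (X2' := bop_scal (RtoC (-1)) _ X2). assert (X3' := bop_scal (RtoC (- (lam - J))) _ X3).
      assert (X4' := bop_scal (RtoC (-1)) _ (proj1 X4)).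
      unfold F. eapply Rle_trans; [apply gamma_sadd|apply Rplus_le_compat].
      - apply (bop_scal (RtoC lam)), bop_sadd; trivial.
      - now apply bop_sadd.
      - eapply Rle_trans; [apply gamma_sscal; now apply bop_sadd|].
        rewrite Cmod_R, Rabs_pos_eq by lra. apply Rmult_le_compat_l; [lra|].
        eapply Rle_trans; [now apply gamma_sadd|]. apply Rplus_le_compat.
        + now apply gamma_comp.
        + eapply Rle_trans; [now apply gamma_sscal|]. rewrite Cmod_R, Rabs_left by lra.
          replace (- -1) with 1 by ring. apply Rmult_le_compat_l; [lra|]. now apply gamma_comp.
      - eapply Rle_trans; [now apply gamma_sadd|]. apply Rplus_le_compat.
        + eapply Rle_trans; [now apply gamma_sscal|].
          rewrite Cmod_R, Rabs_Ropp, Rabs_pos_eq by lra. apply Rmult_le_compat_l; [lra|].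
          now apply gamma_comp.
        + eapply Rle_trans; [apply gamma_sscal, X4|]. rewrite Cmod_R, Rabs_left by lra.
          rewrite gamma_compact by trivial. lra. }
    assert (H2 : lam * gam B <= g).
    { specialize (HgB 0%nat). simpl mp in HgB. rewrite pow_1 in HgB. fold g in HgB.
      apply (Rmult_le_compat_l lam) in HgB; [|lra].
      rewrite <- Rmult_assoc, Rinv_r, Rmult_1_l in HgB by lra. exact HgB. }
    assert (HV0 : 0 <= gam V) by apply gamma_ge0.
    assert (HP0 : 0 <= gam P) by apply gamma_ge0.
    assert (H3 : lam * gam P <= 2 * J) by nra.
    assert (H4 : (lam - J) * (gam V * sg) <= / 2 * gam V).
    { replace ((lam - J) * (gam V * sg)) with ((lam - J) * sg * gam V) by ring.
      now apply Rmult_le_compat_r. }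
    assert (H5 : lam * gam B * sg <= g * sg) by now apply Rmult_le_compat_r.
    assert (H6 : lam * gam P * sg <= 2 * J * sg) by now apply Rmult_le_compat_r.
    unfold C0. lra. }
  assert (HVV : INR n * gam (mp B n) <= C0 * C0).
  { assert (HV2 := good_matmul v v V V Hv Hv).
    assert (Hle : mle (fun i j => INR n * mp B n i j) (matmul V V)).
    { intros i j. eapply Rle_trans; [apply (vm_square_lower c B M n n0 HB HnM (Nat.lt_succ_diag_r n0))|].
      destruct (good_vm c B n0 HB) as [e He].
      apply (matmul_mle v v); trivial; try apply Hv; try apply He; [intros p q; apply Rle_refl|].
      apply (vm_mono c); trivial. lia. }
    assert (Hn0' : 0 < INR n) by (apply lt_0_INR; lia).
    assert (Hgn := good_mp c B n HB).
    assert (Hsc := good_scal (INR n) _ _ (Rlt_le _ _ Hn0') Hgn).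
    assert (H1 := gamma_mono _ _ _ (proj1 (proj2 Hsc)) Hle HV2).
    assert (H2 := gamma_matmul v v V V Hv Hv).
    assert (H3 : gam (mp B n) <= / INR n * gam (fun i j => INR n * mp B n i j)).
    { replace (mp B n) with (fun i j => / INR n * (INR n * mp B n i j)) at 1.
      - apply (gamma_scal_le _ _ _ (Rlt_le _ _ (Rinv_0_lt_compat _ Hn0')) Hsc).
      - apply functional_extensionality; intro i. apply functional_extensionality; intro j. field; lra. }
    apply (Rmult_le_compat_l (INR n)) in H3; [|lra].
    rewrite <- Rmult_assoc, Rinv_r, Rmult_1_l in H3 by lra.
    assert (HV0 : 0 <= gam V) by apply gamma_ge0.
    assert (gam V * gam V <= C0 * C0) by now apply Rmult_le_compat. lra. }
  (* J^(n+1) <= gamma (A^(n+1)) <= lam^(n+1) gamma (B^(n+1)), and J / lam = 1 - eta. *)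
  assert (Hfin : / 2 <= gam (mp B n)).
  { specialize (Hlow n). specialize (HAB n).
    rewrite HJl, Rpow_mult_distr in Hlow.
    assert (Hb := bernoulli eta (Datatypes.S n) ltac:(lra)).
    assert (Hp : 0 < lam ^ Datatypes.S n) by (apply pow_lt; lra).
    assert (H : lam ^ Datatypes.S n * (1 - eta) ^ Datatypes.S n <= lam ^ Datatypes.S n * gam (mp B n)) by lra.
    apply Rmult_le_reg_l in H; trivial. lra. }
  assert (0 < INR n) by (apply lt_0_INR; lia). nra.
Qed.

(** * Sets of matrices and the two radii *)

Definition bset (b : R) (P : mset) : Prop := forall A, P A -> good b A.
Definition bdd (P : mset) : Prop := exists b, bset b P.
Definition dom (P Q : mset) : Prop := forall A, P A -> exists B, Q B /\ mle A B.
Definition had (m : nat) (alpha : nat -> R) (As : nat -> mat) : mat :=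
  fun i l => prodR m (fun j => hpow (As j i l) (alpha j)).

Lemma mset_ext (P Q : mset) : (forall A, P A <-> Q A) -> P = Q.
Proof. intro H. apply functional_extensionality; intro A. apply propositional_extensionality, H. Qed.

Lemma bset_le (b c : R) (P : mset) : bset b P -> b <= c -> bset c P.
Proof. intros H Hc A HA. apply (good_le b); auto. Qed.

Lemma bounded_set_bdd (P : mset) : bounded_set N L nrm P -> bdd P.
Proof.
  intros [H [M HM]]. exists (Rabs M). intros A HA. destruct (H A HA) as [H1 H2].
  split; [apply Rabs_pos|]. split; [|split]; trivial.
  intros x Hx. eapply Rle_trans; [apply HM; trivial|].
  apply Rmult_le_compat_r; [now apply nrm_ge0 | apply Rle_abs].
Qed.

(** The bound is made positive because the Hadamard estimates divide by it. *)
Lemma bdd_common (m : nat) (P : nat -> mset) :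
  (forall j, (j < m)%nat -> bdd (P j)) -> exists b, 0 < b /\ forall j, (j < m)%nat -> bset b (P j).
Proof.
  induction m as [|m IH]; intro H.
  - exists 1. split; [lra|]. intros; lia.
  - destruct IH as (b & Hb & HbP); [auto|]. destruct (H m) as [c Hc]; [lia|].
    exists (Rmax b c). assert (H1 := Rmax_l b c). split; [lra|].
    intros j Hj. destruct (Nat.eq_dec j m) as [->|Hne].
    + apply (bset_le c); trivial. apply Rmax_r.
    + apply (bset_le b); trivial. apply HbP; lia.
Qed.

Lemma bset_setmul (a b : R) (P Q : mset) : bset a P -> bset b Q -> bset (a * b) (setmul P Q).
Proof. intros HP HQ C (A & B & HA & HB & ->). apply good_matmul; auto. Qed.

Lemma bdd_setmul (P Q : mset) : bdd P -> bdd Q -> bdd (setmul P Q).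
Proof. intros [a Ha] [b Hb]. exists (a * b). now apply bset_setmul. Qed.

Lemma setpow_SS (P : mset) (n : nat) : (1 <= n)%nat -> setpow P (S n) = setmul (setpow P n) P.
Proof. destruct n; [lia | reflexivity]. Qed.

Lemma bset_setpow (b : R) (P : mset) (n : nat) : (1 <= n)%nat -> bset b P -> bset (b ^ n) (setpow P n).
Proof.
  intros Hn HP. induction Hn as [|n Hn IH]; [now rewrite pow_1|].
  rewrite setpow_SS by trivial. replace (b ^ S n) with (b ^ n * b) by (simpl; ring).
  now apply bset_setmul.
Qed.

Lemma bdd_setpow (P : mset) (n : nat) : (1 <= n)%nat -> bdd P -> bdd (setpow P n).
Proof. intros Hn [b Hb]. exists (b ^ n). now apply bset_setpow. Qed.

Lemma setmul_assoc (P Q T : mset) :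
  bdd P -> bdd Q -> bdd T -> setmul (setmul P Q) T = setmul P (setmul Q T).
Proof.
  intros [a Ha] [b Hb] [c Hc]. apply mset_ext. intro X. split.
  - intros (Y & D & (A & B & HA & HB & ->) & HD & ->).
    exists A, (matmul B D). split; [|split]; trivial; [exists B, D; auto|].
    apply (matmul_assoc a b c); auto.
  - intros (A & Y & HA & (B & D & HB & HD & ->) & ->).
    exists (matmul A B), D. split; [|split]; trivial; [exists A, B; auto|].
    symmetry. apply (matmul_assoc a b c); auto.
Qed.

Lemma setpow_add (P : mset) (p q : nat) :
  bdd P -> (1 <= p)%nat -> (1 <= q)%nat -> setpow P (p + q) = setmul (setpow P p) (setpow P q).
Proof.
  intros HP Hp Hq. induction Hq as [|q Hq IH].
  - rewrite Nat.add_1_r. now apply setpow_SS.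
  - rewrite Nat.add_succ_r, !setpow_SS, IH by lia. apply setmul_assoc; auto using bdd_setpow.
Qed.

Lemma setpow_mul (P : mset) (n m : nat) :
  bdd P -> (1 <= n)%nat -> (1 <= m)%nat -> setpow (setpow P n) m = setpow P (n * m).
Proof.
  intros HP Hn Hm. induction Hm as [|m Hm IH]; [now rewrite Nat.mul_1_r|].
  rewrite setpow_SS, IH by trivial. rewrite <- setpow_add by (trivial; nia).
  f_equal. nia.
Qed.

Lemma mp_in_setpow (P : mset) (m n : nat) (A : mat) :
  bdd P -> (1 <= m)%nat -> setpow P m A -> setpow P (m * S n) (mp A n).
Proof.
  intros HP Hm HA. induction n as [|n IH]; [now rewrite Nat.mul_1_r|].
  replace (m * S (S n))%nat with (m * S n + m)%nat by nia.
  rewrite setpow_add by (trivial; nia). exists (mp A n), A. auto.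
Qed.

(** [eq A] is the singleton of A; results on sets thereby apply to the powers of one matrix. *)
Lemma setpow_singleton (A : mat) (n : nat) : setpow (eq A) (S n) = eq (mp A n).
Proof.
  induction n as [|n IH]; trivial. rewrite setpow_SS, IH by lia. apply mset_ext. intro B. split.
  - intros (X & Y & <- & <- & ->). reflexivity.
  - intros <-. exists (mp A n), A. auto.
Qed.

Lemma bdd_singleton (b : R) (A : mat) : good b A -> bdd (eq A).
Proof. intro HA. exists b. now intros B <-. Qed.

Lemma dom_setmul (P P' Q Q' : mset) :
  bdd P -> bdd Q -> bdd P' -> bdd Q' -> dom P P' -> dom Q Q' -> dom (setmul P Q) (setmul P' Q').
Proof.
  intros [a Ha] [b Hb] [a' Ha'] [b' Hb'] HP HQ C (A & B & HA & HB & ->).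
  destruct (HP A HA) as (A' & HA' & HlA), (HQ B HB) as (B' & HB' & HlB).
  exists (matmul A' B'). split; [exists A', B'; auto|].
  apply (matmul_mle a' b'); auto; [apply (Ha A HA) | apply (Hb B HB)].
Qed.

Lemma dom_setpow (P Q : mset) (n : nat) :
  (1 <= n)%nat -> bdd P -> bdd Q -> dom P Q -> dom (setpow P n) (setpow Q n).
Proof.
  intros Hn HP HQ H. induction Hn as [|n Hn IH]; trivial.
  rewrite !setpow_SS by trivial. apply dom_setmul; auto using bdd_setpow.
Qed.

Lemma bdd_setprodS (Phi : nat -> mset) (k : nat) :
  (forall i, (i <= k)%nat -> bdd (Phi i)) -> bdd (setprodS Phi k).
Proof.
  induction k as [|k IH]; intro H; simpl; auto. apply bdd_setmul; auto.
Qed.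

Lemma setpow_setprodS (P : mset) (n : nat) : setpow P (S n) = setprodS (fun _ => P) n.
Proof.
  induction n as [|n IH]; trivial. rewrite setpow_SS, IH by lia. reflexivity.
Qed.

Lemma Series_term_le (a : nat -> R) (k : nat) :
  ex_series a -> (forall j, 0 <= a j) -> a k <= Series a.
Proof.
  intros Ha H. rewrite <- (is_series_unique _ _ (is_series_single a k)).
  apply Series_le; trivial. intro j. destruct (Nat.eqb j k); split; auto; lra.
Qed.

Lemma is_series_sumR (m : nat) (w : nat -> R) (c : nat -> nat -> R) :
  (forall j, (j < m)%nat -> ex_series (c j)) ->
  is_series (fun k => sumR m (fun j => w j * c j k)) (sumR m (fun j => w j * Series (c j))).
Proof.
  induction m as [|m IH]; intro H; simpl.
  - change (is_lim_seq (sum_n (fun _ => 0)) 0). apply (is_lim_seq_ext (fun _ => 0)).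
    + intro n. rewrite sum_n_const. symmetry; apply Rmult_0_r.
    + apply is_lim_seq_const.
  - apply (is_series_plus (K := R_AbsRing) (V := R_NormedModule)); [apply IH; auto|].
    apply (is_series_scal (K := R_AbsRing) (V := R_NormedModule)), Series_correct; auto.
Qed.

(** * Weighted Hadamard products *)

Section Hadamard.
Variables (m : nat) (alpha : nat -> R).
Hypothesis Halpha : forall j, (j < m)%nat -> 0 < alpha j.
Hypothesis Hsum : 1 <= sumR m alpha.

Lemma had_nonneg (As : nat -> mat) :
  (forall j, (j < m)%nat -> nonneg_mat N (As j)) -> nonneg_mat N (had m alpha As).
Proof.
  intros HA i l. split.
  - apply prodR_ge0. intros; apply hpow_ge0.
  - intro Hil. assert (Hm := sumR_pos_size _ _ Hsum). apply prodR_zero. exists 0%nat. split; [lia|].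
    apply hpow_le0. right. apply (HA 0%nat); trivial.
Qed.

(** The entries of A_j / b_j are at most 1 by [good_entry_le]. With s the sum of the weights,
    [prod_hpow_le_mean] bounds the product of their powers by the sum of (alpha_j / s) A_j / b_j,
    whose norm is at most 1; multiplying by beta, the product of the b_j^(alpha_j), gives the
    claim. *)
Lemma good_had (b : nat -> R) (As : nat -> mat) :
  (forall j, (j < m)%nat -> 0 < b j /\ good (b j) (As j)) ->
  good (prodR m (fun j => hpow (b j) (alpha j))) (had m alpha As).
Proof.
  intros HA. set (beta := prodR m (fun j => hpow (b j) (alpha j))).
  assert (Hbeta : 0 < beta) by (apply prodR_gt0; intros; apply hpow_gt0; now apply HA).
  set (s := sumR m alpha) in *.
  set (w := fun j => beta * (alpha j / s) / b j).
  assert (Hw : forall j, (j < m)%nat -> 0 <= w j).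
  { intros j Hj. destruct (HA j Hj) as [Hb _]. specialize (Halpha j Hj).
    apply Rdiv_le_0_compat; trivial. apply Rmult_le_pos; [lra|]. apply Rdiv_le_0_compat; lra. }
  assert (Hgs : good (sumR m (fun j => w j * b j)) (fun i l => sumR m (fun j => w j * As j i l))).
  { apply (good_sum m (fun j => w j * b j) (fun j i l => w j * As j i l)).
    intros j Hj. apply good_scal; auto. now apply HA. }
  assert (E : sumR m (fun j => w j * b j) = beta).
  { rewrite (sumR_ext m _ (fun j => beta / s * alpha j)).
    - rewrite sumR_scal. fold s. field; lra.
    - intros j Hj. destruct (HA j Hj). unfold w. field; split; lra. }
  rewrite E in Hgs. apply (good_dom _ _ _) with (3 := Hgs).
  - apply had_nonneg. intros j Hj. now apply HA.
  - intros i l. unfold had.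
    rewrite (prodR_ext m _ (fun j => hpow (b j) (alpha j) * hpow (As j i l / b j) (alpha j))).
    + rewrite prodR_mult. fold beta.
      apply Rle_trans with (beta * sumR m (fun j => alpha j / s * (As j i l / b j))).
      * apply Rmult_le_compat_l; [lra|]. apply prod_hpow_le_mean; trivial.
        intros j Hj. destruct (HA j Hj) as [Hb Hg].
        assert (H0 := good_ge0 _ _ i l Hg). assert (H1 := good_entry_le _ _ i l Hg).
        split; [apply Rdiv_le_0_compat; trivial | apply Rle_div_l; lra].
      * rewrite <- sumR_scal. right. apply sumR_ext. intros j Hj. destruct (HA j Hj).
        unfold w. field; split; lra.
    + intros j Hj. destruct (HA j Hj) as [Hb Hg].
      assert (H0 := good_ge0 _ _ i l Hg). rewrite <- hpow_mult by (try apply Rdiv_le_0_compat; lra).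
      f_equal. field; lra.
Qed.

(** Hoelder's inequality for the series defining each entry, with weights of sum at least 1: the
    terms c j k divided by their sum over k are at most 1, so [prod_hpow_le_mean] applies to each k
    and is then summed. If one sum is 0, all its terms vanish and so does the left side. *)
Lemma had_matmul_mle (b : R) (As Bs : nat -> mat) :
  (forall j, (j < m)%nat -> good b (As j)) -> (forall j, (j < m)%nat -> good b (Bs j)) ->
  mle (matmul (had m alpha As) (had m alpha Bs)) (had m alpha (fun j => matmul (As j) (Bs j))).
Proof.
  intros HA HB i l. set (s := sumR m alpha) in *.
  set (c := fun j k => As j i k * Bs j k l).
  assert (Hc0 : forall j k, (j < m)%nat -> 0 <= c j k)
    by (intros j k Hj; apply Rmult_le_pos; eauto using good_ge0).
  assert (Hce : forall j, (j < m)%nat -> ex_series (c j)).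
  { intros j Hj. apply (good_ex b (As j) (fun k => Bs j k l)); auto. now apply (L_col b); auto. }
  set (t := fun k => prodR m (fun j => hpow (c j k) (alpha j))).
  assert (Ht : matmul (had m alpha As) (had m alpha Bs) i l = Series t).
  { apply Series_ext. intro k. unfold had, t. rewrite <- prodR_mult. apply prodR_ext.
    intros j Hj. symmetry. apply hpow_mult; eauto using good_ge0. }
  rewrite Ht. clear Ht. change (Series t <= prodR m (fun j => hpow (Series (c j)) (alpha j))).
  assert (HS0 : forall j, (j < m)%nat -> 0 <= Series (c j)) by (intros; apply Series_ge0; auto).
  destruct (classic (exists j, (j < m)%nat /\ Series (c j) = 0)) as [(j & Hj & E)|Hnz].
  - rewrite Series_zero.
    + apply prodR_ge0. intros; apply hpow_ge0.
    + intro k. apply prodR_zero. exists j; split; trivial. apply hpow_le0.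
      rewrite <- E. apply Series_term_le; auto.
  - assert (HS : forall j, (j < m)%nat -> 0 < Series (c j)).
    { intros j Hj. destruct (HS0 j Hj) as [H|H]; trivial. exfalso; apply Hnz. exists j; auto. }
    set (Q := prodR m (fun j => hpow (Series (c j)) (alpha j))).
    assert (HQ : 0 < Q) by (apply prodR_gt0; intros; apply hpow_gt0; auto).
    set (w := fun j => Q * (alpha j / s) / Series (c j)).
    assert (Hsr := is_series_sumR m w c Hce).
    replace Q with (sumR m (fun j => w j * Series (c j))).
    + rewrite <- (is_series_unique _ _ Hsr). apply Series_le; [|eexists; exact Hsr].
      intro k. split; [apply prodR_ge0; intros; apply hpow_ge0|].
      unfold t. rewrite (prodR_ext m _ (fun j =>
        hpow (Series (c j)) (alpha j) * hpow (c j k / Series (c j)) (alpha j))).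
      * rewrite prodR_mult. fold Q.
        apply Rle_trans with (Q * sumR m (fun j => alpha j / s * (c j k / Series (c j)))).
        -- apply Rmult_le_compat_l; [lra|]. apply prod_hpow_le_mean; trivial.
           intros j Hj. specialize (HS j Hj). split; [apply Rdiv_le_0_compat; auto|].
           apply Rle_div_l; trivial. rewrite Rmult_1_l. apply Series_term_le; auto.
        -- rewrite <- sumR_scal. right. apply sumR_ext. intros j Hj. specialize (HS j Hj).
           unfold w. field; split; lra.
      * intros j Hj. specialize (HS j Hj).
        rewrite <- hpow_mult by (try apply Rdiv_le_0_compat; auto; lra). f_equal. field; lra.
    + rewrite (sumR_ext m _ (fun j => Q / s * alpha j)).
      * rewrite sumR_scal. fold s. field; lra.
      * intros j Hj. specialize (HS j Hj). unfold w. field; split; lra.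
Qed.

Lemma bdd_hadset (Psi : nat -> mset) :
  (forall j, (j < m)%nat -> bdd (Psi j)) -> bdd (hadset m Psi alpha).
Proof.
  intro H. destruct (bdd_common m Psi H) as (b & Hb & HbP).
  exists (prodR m (fun j => hpow b (alpha j))). intros C (As & HAs & ->).
  apply (good_had (fun _ => b) As). intros j Hj. split; trivial. apply (HbP j Hj); auto.
Qed.

(** Induction on the number of factors: the dominating Hadamard product obtained so far is
    multiplied by the next one, and [had_matmul_mle] merges the two. *)
Lemma hadset_setprodS_dom (Psi2 : nat -> nat -> mset) (k : nat) :
  (forall i j, (i <= k)%nat -> (j < m)%nat -> bdd (Psi2 i j)) ->
  dom (setprodS (fun i => hadset m (fun j => Psi2 i j) alpha) k)
      (hadset m (fun j => setprodS (fun i => Psi2 i j) k) alpha).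
Proof.
  induction k as [|k IH]; intro H.
  - intros A HA. exists A. split; trivial. intros i j; apply Rle_refl.
  - intros X (A & B & HA & HB & ->).
    destruct (IH ltac:(auto) A HA) as (A' & HA' & HlA).
    destruct HA' as (As & HAs & ->). destruct HB as (Bs & HBs & ->).
    assert (HbA : forall j, (j < m)%nat -> bdd (setprodS (fun i => Psi2 i j) k))
      by (intros; apply bdd_setprodS; auto).
    destruct (bdd_common m _ HbA) as (a & Ha & HaP).
    destruct (bdd_common m (fun j => Psi2 (S k) j)) as (b & Hb & HbP); [auto|].
    assert (HAg : forall j, (j < m)%nat -> good (Rmax a b) (As j)).
    { intros j Hj. apply (good_le a); [apply (HaP j Hj); auto | apply Rmax_l]. }
    assert (HBg : forall j, (j < m)%nat -> good (Rmax a b) (Bs j)).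
    { intros j Hj. apply (good_le b); [apply (HbP j Hj); auto | apply Rmax_r]. }
    assert (Hab : 0 < Rmax a b) by (assert (H1 := Rmax_l a b); lra).
    assert (HgA : good (prodR m (fun j => hpow (Rmax a b) (alpha j))) (had m alpha As))
      by (apply (good_had (fun _ => Rmax a b)); auto).
    assert (HgB : good (prodR m (fun j => hpow (Rmax a b) (alpha j))) (had m alpha Bs))
      by (apply (good_had (fun _ => Rmax a b)); auto).
    exists (had m alpha (fun j => matmul (As j) (Bs j))). split.
    + exists (fun j => matmul (As j) (Bs j)). split; trivial.
      intros j Hj. exists (As j), (Bs j). auto.
    + assert (HbH : bdd (setprodS (fun i => hadset m (fun j => Psi2 i j) alpha) k))
        by (apply bdd_setprodS; intros; apply bdd_hadset; auto).
      destruct HbH as [e He].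
      assert (H1 : mle (matmul A (had m alpha Bs)) (matmul (had m alpha As) (had m alpha Bs))).
      { eapply matmul_mle; eauto.
        - exact (proj1 (proj2 (He A HA))).
        - exact (proj1 (proj2 HgB)).
        - intros p q; apply Rle_refl. }
      intros p q. eapply Rle_trans; [apply H1|]. now apply (had_matmul_mle (Rmax a b)).
Qed.

Lemma hadset_setpow_dom (Psi : nat -> mset) (n : nat) :
  (1 <= n)%nat -> (forall j, (j < m)%nat -> bdd (Psi j)) ->
  dom (setpow (hadset m Psi alpha) n) (hadset m (fun j => setpow (Psi j) n) alpha).
Proof.
  intros Hn H. destruct n as [|n]; [lia|]. rewrite setpow_setprodS.
  replace (fun j => setpow (Psi j) (S n)) with (fun j => setprodS (fun _ => Psi j) n).
  - apply (hadset_setprodS_dom (fun _ => Psi)). auto.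
  - apply functional_extensionality; intro j. now rewrite setpow_setprodS.
Qed.

(** For t j > gamma (A_j), the tails of all A_j have norm at most t j from a common index k on, and
    [good_had] applies to these tails with the bounds t j. *)
Lemma gamma_had (b : R) (As : nat -> mat) :
  0 < b -> (forall j, (j < m)%nat -> good b (As j)) ->
  gam (had m alpha As) <= prodR m (fun j => hpow (gam (As j)) (alpha j)).
Proof.
  intros Hb HA.
  assert (HgA : good (prodR m (fun j => hpow b (alpha j))) (had m alpha As))
    by (apply (good_had (fun _ => b)); auto).
  apply prod_hpow_le_of_lt; trivial; [intros; apply gamma_ge0|].
  intros t Ht.
  assert (Hk : forall m', (m' <= m)%nat -> exists k, forall j p,
    (j < m')%nat -> (k <= p)%nat -> good (t j) (tailmat p (As j))).
  { induction m' as [|m' IH]; intro Hm'; [exists 0%nat; intros; lia|].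
    destruct IH as [k Hk]; [lia|].
    destruct (gamma_lt_tail b (t m') (As m')) as [k' Hk']; [auto | auto |].
    exists (k + k')%nat. intros j p Hj Hp. destruct (Nat.eq_dec j m') as [->|Hne].
    - apply Hk'; lia.
    - apply Hk; lia. }
  destruct (Hk m (le_n m)) as [k Hk']. clear Hk.
  apply (gamma_le_tail _ _ k _ HgA).
  (* Cut-off rows agree because [hpow] is 0 at 0 and there is at least one factor. *)
  replace (tailmat k (had m alpha As)) with (had m alpha (fun j => tailmat k (As j))).
  - apply (good_had t). intros j Hj. split; [|now apply Hk'].
    assert (H0 := gamma_ge0 (matop (As j))). specialize (Ht j Hj). lra.
  - apply functional_extensionality; intro i. apply functional_extensionality; intro l.
    unfold had, tailmat. destruct (Nat.ltb i k); trivial.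
    apply prodR_zero. exists 0%nat. split; [exact (sumR_pos_size _ _ Hsum) | apply hpow_le0; lra].
Qed.

End Hadamard.

(** The bound [B] keeps the supremum finite; an infinite one would be sent to 0 by [real]. *)
Lemma supR_ge (E : R -> Prop) (B x : R) : (forall r, E r -> r <= B) -> E x -> x <= supR E.
Proof.
  intros HB Hx. unfold supR. destruct (Lub_Rbar_correct (fun r => r = 0 \/ E r)) as [H1 H2].
  assert (Hu : Rbar_le (Lub_Rbar (fun r => r = 0 \/ E r)) (Rmax 0 B)).
  { apply H2. intros r [->|Hr]; [apply Rmax_l|]. eapply Rle_trans; [apply HB, Hr | apply Rmax_r]. }
  assert (Hl := H1 x (or_intror Hx)).
  destruct (Lub_Rbar (fun r => r = 0 \/ E r)); simpl in *; trivial; contradiction.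
Qed.

Lemma supR_le (E : R -> Prop) (B : R) : 0 <= B -> (forall r, E r -> r <= B) -> supR E <= B.
Proof.
  intros H0 HB. unfold supR. destruct (Lub_Rbar_correct (fun r => r = 0 \/ E r)) as [H1 H2].
  assert (Hu : Rbar_le (Lub_Rbar (fun r => r = 0 \/ E r)) B).
  { apply H2. intros r [->|Hr]; [exact H0 | now apply HB]. }
  destruct (Lub_Rbar (fun r => r = 0 \/ E r)); simpl in *; trivial; contradiction.
Qed.

Lemma supR_ge0 (E : R -> Prop) : 0 <= supR E.
Proof.
  unfold supR. destruct (Lub_Rbar_correct (fun r => r = 0 \/ E r)) as [H1 _].
  assert (Hl := H1 0 (or_introl eq_refl)).
  destruct (Lub_Rbar (fun r => r = 0 \/ E r)); simpl in *; trivial; lra.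
Qed.

(** * The joint essential spectral radius and its value on singletons *)

Notation jr := (joint_ess_rad L nrm).
Notation er A := (ess_rad L nrm (matop A)).

(** [fekete] for the suprema of [gamma] over the powers of P, submultiplicative because a long
    product splits into two. The last two clauses, a lower bound on each power and a growth bound
    above the radius, replace the limit in what follows. *)
Lemma joint_spec (P : mset) : bdd P ->
  0 <= jr P /\
  (forall n c, (1 <= n)%nat -> 0 <= c -> (forall A, setpow P n A -> gam A <= c) -> jr P ^ n <= c) /\
  (forall t, jr P < t -> exists C, 0 <= C /\
     forall n A, (1 <= n)%nat -> setpow P n A -> gam A <= C * t ^ n).
Proof.
  intros HP. pose proof HP as [b Hb].
  set (E := fun n r => exists A, setpow P n A /\ r = gam A).
  set (g := fun n => supR (E (S n))).
  assert (HEb : forall n r, E (S n) r -> r <= b ^ S n).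
  { intros n r (A & HA & ->). apply gamma_good_le. apply (bset_setpow b P (S n)); trivial; lia. }
  assert (HgE : forall n A, setpow P (S n) A -> gam A <= g n).
  { intros n A HA. apply (supR_ge _ (b ^ S n)); [apply HEb | now exists A]. }
  destruct (fekete g) as (J & HJ0 & Hlim & Hlow & Hgrow).
  - intro n. apply supR_ge0.
  - intros m p. apply supR_le; [apply Rmult_le_pos; apply supR_ge0|].
    intros r (A & HA & ->).
    replace (S (S (m + p))) with (S m + S p)%nat in HA by lia.
    rewrite setpow_add in HA by (trivial; lia). destruct HA as (B & D & HB & HD & ->).
    eapply Rle_trans.
    + apply (gamma_matmul (b ^ S m) (b ^ S p));
        [apply (bset_setpow b P (S m)) | apply (bset_setpow b P (S p))]; trivial; lia.
    + apply Rmult_le_compat; auto using gamma_ge0.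
  - assert (HJ : jr P = J).
    { change (real (Lim_seq (fun n => hpow (g n) (/ INR (S n)))) = J).
      now rewrite (is_lim_seq_unique _ _ Hlim). }
    rewrite HJ. split; [exact HJ0|]. split.
    + intros n c Hn Hc H. destruct n as [|n]; [lia|].
      eapply Rle_trans; [apply Hlow|]. apply supR_le; trivial. intros r (A & HA & ->). auto.
    + intros t Ht. destruct (Hgrow t Ht) as (C & HC & HCg). exists C; split; trivial.
      intros n A Hn HA. destruct n as [|n]; [lia|]. eapply Rle_trans; [apply HgE, HA | apply HCg].
Qed.

Lemma joint_le (P : mset) (C x : R) : bdd P -> 0 <= x -> 0 <= C ->
  (forall n A, (1 <= n)%nat -> setpow P n A -> gam A <= C * x ^ n) -> jr P <= x.
Proof.
  intros HP Hx HC H. destruct (joint_spec P HP) as (H0 & Hlow & _).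
  apply (pow_growth_le C); trivial. intro n. apply Hlow; [lia| |intros; apply H; trivial; lia].
  apply Rmult_le_pos; trivial. now apply pow_le.
Qed.

Lemma Rle_of_lt_upper (x a : R) : (forall t, a < t -> x <= t) -> x <= a.
Proof. intro H. apply Rnot_lt_le; intro Hlt. specialize (H ((x + a) / 2)). lra. Qed.

Lemma joint_dom (P Q : mset) : bdd P -> bdd Q -> dom P Q -> jr P <= jr Q.
Proof.
  intros HP HQ Hd. apply Rle_of_lt_upper. intros t Ht.
  destruct (joint_spec Q HQ) as (H0 & _ & Hup). destruct (Hup t Ht) as (C & HC & HCg).
  apply (joint_le P C); trivial; [lra|]. intros n A Hn HA.
  destruct (dom_setpow P Q n Hn HP HQ Hd A HA) as (B & HB & Hle).
  destruct (bdd_setpow P n Hn HP) as [p Hp]. destruct (bdd_setpow Q n Hn HQ) as [q Hq].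
  eapply Rle_trans; [apply (gamma_mono q A B)|]; auto. apply (Hp A HA).
Qed.

(** (P^n)^m = P^(n m), so the growth bounds of either set are growth bounds of the other. *)
Lemma joint_pow (P : mset) (n : nat) : bdd P -> (1 <= n)%nat -> jr (setpow P n) = jr P ^ n.
Proof.
  intros HP Hn. assert (HPn := bdd_setpow P n Hn HP).
  destruct (joint_spec P HP) as (H0 & Hlow & Hup).
  destruct (joint_spec _ HPn) as (H0' & _ & Hup').
  apply Rle_antisym.
  - apply pow_le_of_lt; trivial. intros t Ht. destruct (Hup t Ht) as (C & HC & HCg).
    apply (joint_le _ C); trivial; [apply pow_le; lra|]. intros m A Hm HA.
    rewrite setpow_mul in HA by trivial. rewrite <- pow_mult. apply HCg; trivial; nia.
  - apply Rle_of_lt_upper. intros t Ht. destruct (Hup' t Ht) as (C & HC & HCg).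
    apply (pow_growth_le C); [now apply pow_le | lra |]. intro m. rewrite <- pow_mult.
    apply Hlow; [nia| |].
    + apply Rmult_le_pos; trivial. apply pow_le; lra.
    + intros A HA. apply HCg; [lia|]. rewrite setpow_mul; trivial; lia.
Qed.

(** For t j above the radius of Psi j and one constant C for all j, products of n factors are
    dominated by Hadamard products of elements of the Psi_j^n. [gamma_had] then bounds them by the
    product of the (C t_j^n)^(alpha_j), a constant times the n-th power of the product of the
    t_j^(alpha_j). *)
Lemma joint_had (m : nat) (alpha : nat -> R) (Psi : nat -> mset) :
  (forall j, (j < m)%nat -> 0 < alpha j) -> 1 <= sumR m alpha ->
  (forall j, (j < m)%nat -> bdd (Psi j)) ->
  jr (hadset m Psi alpha) <= prodR m (fun j => hpow (jr (Psi j)) (alpha j)).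
Proof.
  intros Ha Hs HP. apply prod_hpow_le_of_lt; trivial; [intros j Hj; now apply joint_spec, HP|].
  intros t Ht.
  assert (HC : forall m', (m' <= m)%nat -> exists C, 0 <= C /\ forall j n A, (j < m')%nat -> (1 <= n)%nat ->
     setpow (Psi j) n A -> gam A <= C * t j ^ n).
  { induction m' as [|m' IH]; intro Hm'; [exists 0; split; [lra | intros; lia]|].
    destruct IH as (C & HC & HCg); [lia|].
    assert (Hb : bdd (Psi m')) by auto.
    destruct (joint_spec _ Hb) as (H0 & _ & Hup).
    destruct (Hup (t m')) as (C' & HC' & HCg'); [apply Ht; lia|].
    exists (C + C'). split; [lra|]. intros j n A Hj Hn HA.
    assert (Htj : 0 <= t j ^ n).
    { apply pow_le. assert (H1 := Ht j ltac:(lia)). assert (H2 := proj1 (joint_spec _ (HP j ltac:(lia)))). lra. }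
    destruct (Nat.eq_dec j m') as [->|Hne].
    - specialize (HCg' n A Hn HA). assert (0 <= C * t m' ^ n) by now apply Rmult_le_pos. lra.
    - specialize (HCg j n A ltac:(lia) Hn HA). assert (0 <= C' * t j ^ n) by now apply Rmult_le_pos. lra. }
  destruct (HC m (le_n m)) as (C & HC0 & HCg). clear HC.
  assert (HbH := bdd_hadset m alpha Ha Hs Psi HP).
  assert (Ht0 : forall j, (j < m)%nat -> 0 <= t j).
  { intros j Hj. assert (H1 := Ht j Hj). assert (H2 := proj1 (joint_spec _ (HP j Hj))). lra. }
  apply (joint_le _ (prodR m (fun j => hpow C (alpha j)))); trivial.
  - apply prodR_ge0. intros; apply hpow_ge0.
  - apply prodR_ge0. intros; apply hpow_ge0.
  - intros n A Hn HA.
    destruct (hadset_setpow_dom m alpha Ha Hs Psi n Hn HP A HA) as (B & (As & HAs & ->) & Hle).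
    assert (HPn : forall j, (j < m)%nat -> bdd (setpow (Psi j) n)) by (intros; apply bdd_setpow; auto).
    destruct (bdd_common m _ HPn) as (b & Hb & Hbn).
    assert (HAg : forall j, (j < m)%nat -> good b (As j)) by (intros j Hj; apply (Hbn j Hj); auto).
    destruct (bdd_setpow _ n Hn HbH) as [e He].
    eapply Rle_trans; [apply (gamma_mono (prodR m (fun j => hpow b (alpha j))) A (had m alpha As))|].
    + apply (He A HA).
    + exact Hle.
    + apply (good_had m alpha Ha Hs (fun _ => b)); auto.
    + eapply Rle_trans; [apply (gamma_had m alpha Ha Hs b); auto|].
      rewrite <- prodR_pow, <- prodR_mult. apply prodR_le. intros j Hj. split; [apply hpow_ge0|].
      rewrite <- hpow_pow, <- hpow_mult by (auto; apply pow_le; auto).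
      apply hpow_le; [apply Rlt_le; auto|]. apply HCg; auto.
Qed.

(** [not_ess_spec] at a large power excludes every lam of modulus above J, while [ess_spec_radius]
    puts J itself into the essential spectrum when J > 0. *)
Lemma ess_rad_joint (b : R) (A : mat) : good b A -> er A = jr (eq A).
Proof.
  intro HA. destruct (joint_spec _ (bdd_singleton b A HA)) as (H0 & Hlow & Hup).
  set (J := jr (eq A)) in *.
  assert (Hup' : forall t, J < t -> exists C, 0 <= C /\ forall n, gam (mp A n) <= C * t ^ S n).
  { intros t Ht. destruct (Hup t Ht) as (C & HC & H). exists C; split; trivial.
    intro n. apply H; [lia|]. now rewrite setpow_singleton. }
  assert (Hlow' : forall n, J ^ S n <= gam (mp A n)).
  { intro n. apply Hlow; [lia | apply gamma_ge0 |]. rewrite setpow_singleton. intros B <-. apply Rle_refl. }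
  assert (Hub : forall x, (exists lam, ess_spec L nrm (matop A) lam /\ x = Cmod lam) -> x <= J).
  { intros x (lam & Hspec & ->). apply Rnot_lt_le; intro Hlt.
    destruct (Hup' ((J + Cmod lam) / 2)) as (C & HC & HCg); [lra|].
    destruct (pow_ratio_eventually C ((J + Cmod lam) / 2) (Cmod lam)) as [K HK]; [lra|].
    apply (not_ess_spec b A K lam HA); trivial.
    eapply Rle_lt_trans; [apply HCg|]. apply HK; lia. }
  apply Rle_antisym.
  - now apply supR_le.
  - destruct H0 as [HJ|HJ]; [|rewrite <- HJ; apply supR_ge0].
    apply (supR_ge _ J); trivial. exists (RtoC J). split.
    + now apply (ess_spec_radius b).
    + rewrite Cmod_R, Rabs_pos_eq; lra.
Qed.

Lemma ess_rad_ge0 (A : mat) : 0 <= er A.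
Proof. apply supR_ge0. Qed.

Lemma ess_rad_le (b : R) (A : mat) : good b A -> er A <= b.
Proof.
  intro HA. rewrite (ess_rad_joint b) by trivial.
  destruct (joint_spec _ (bdd_singleton b A HA)) as (_ & Hlow & _).
  rewrite <- pow_1 at 1. apply Hlow; [lia | apply HA |]. intros B <-. now apply gamma_good_le.
Qed.

Lemma ess_rad_mono (b : R) (A B : mat) : nonneg_mat N A -> mle A B -> good b B -> er A <= er B.
Proof.
  intros HA Hle HB. assert (HA' := good_dom b A B HA Hle HB).
  rewrite (ess_rad_joint b A), (ess_rad_joint b B) by trivial.
  apply joint_dom; eauto using bdd_singleton. intros X <-. now exists B.
Qed.

Lemma ess_rad_mp (b : R) (A : mat) (n : nat) : good b A -> er (mp A n) = er A ^ S n.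
Proof.
  intro HA. rewrite (ess_rad_joint b A), (ess_rad_joint (b ^ S n)) by auto using good_mp.
  rewrite <- setpow_singleton. apply joint_pow; [now apply (bdd_singleton b) | lia].
Qed.

(** The matrix is an element of the Hadamard product of the singletons, so [joint_had] applies. *)
Lemma ess_rad_had (m : nat) (alpha : nat -> R) (b : R) (As : nat -> mat) :
  (forall j, (j < m)%nat -> 0 < alpha j) -> 1 <= sumR m alpha -> 0 < b ->
  (forall j, (j < m)%nat -> good b (As j)) ->
  er (had m alpha As) <= prodR m (fun j => hpow (er (As j)) (alpha j)).
Proof.
  intros Ha Hs Hb HA.
  assert (HgA : good (prodR m (fun j => hpow b (alpha j))) (had m alpha As))
    by (apply (good_had m alpha Ha Hs (fun _ => b)); auto).
  assert (HbA : forall j, (j < m)%nat -> bdd (eq (As j))) by (intros; apply (bdd_singleton b); auto).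
  rewrite (ess_rad_joint _ _ HgA).
  eapply Rle_trans; [apply (joint_dom _ (hadset m (fun j => eq (As j)) alpha))|].
  - now apply (bdd_singleton _ _ HgA).
  - now apply bdd_hadset.
  - intros X <-. exists (had m alpha As). split; [exists As; auto | intros i j; apply Rle_refl].
  - eapply Rle_trans; [now apply joint_had|]. right. apply prodR_ext. intros j Hj.
    now rewrite (ess_rad_joint b) by auto.
Qed.

(** * The generalized essential spectral radius *)

Notation gr := (gen_ess_rad L nrm).

(** The upper limit is in fact the supremum: raising an element of P^m to powers keeps its
    normalized radius, so each value is reached or exceeded at arbitrarily large indices. The last
    two clauses say that the radius is the least x with er A <= x^n on every P^n. *)
Lemma gen_spec (P : mset) : bdd P ->
  0 <= gr P /\
  (forall n A, (1 <= n)%nat -> setpow P n A -> er A <= gr P ^ n) /\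
  (forall x, 0 <= x -> (forall n A, (1 <= n)%nat -> setpow P n A -> er A <= x ^ n) -> gr P <= x).
Proof.
  intro HP. pose proof HP as [b Hb].
  set (h := fun n => supR (fun r => exists A, setpow P (S n) A /\ r = er A)).
  set (u := fun n => hpow (h n) (/ INR (S n))).
  assert (Hgood : forall n A, setpow P (S n) A -> good (b ^ S n) A)
    by (intros n A HA; apply (bset_setpow b P (S n)); trivial; lia).
  assert (Hu0 : forall n, 0 <= u n) by (intro; apply hpow_ge0).
  assert (Hupow : forall n, u n ^ S n = h n) by (intro n; apply hpow_root_pow; [apply supR_ge0 | lia]).
  assert (Hh : forall n A, setpow P (S n) A -> er A <= h n).
  { intros n A HA. apply (supR_ge _ (b ^ S n)); [|now exists A].
    intros r (B & HB & ->). apply ess_rad_le; auto. }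
  assert (Hle : forall n x, 0 <= x -> (forall A, setpow P (S n) A -> er A <= x ^ S n) -> u n <= x).
  { intros n x Hx H. apply (pow_le_cancel _ _ (S n)); auto; [lia|]. rewrite Hupow.
    apply supR_le; [now apply pow_le|]. intros r (A & HA & ->); auto. }
  destruct (completeness (fun x => exists n, x = u n)) as [G [HG1 HG2]].
  - exists (Rabs b). intros x [n ->]. apply Hle; [apply Rabs_pos|]. intros A HA.
    eapply Rle_trans; [apply ess_rad_le, (Hgood n A HA)|].
    rewrite RPow_abs. apply Rle_abs.
  - exists (u 0%nat). now exists 0%nat.
  - assert (HuG : forall n, u n <= G) by (intro n; apply HG1; now exists n).
    assert (HG0 : 0 <= G) by (eapply Rle_trans; [apply (Hu0 0%nat) | apply HuG]).
    assert (HGr : gr P = G).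
    { change (real (LimSup_seq u) = G). rewrite (is_LimSup_seq_unique u G); trivial.
      intro eps. assert (He := cond_pos eps). split.
      - intro K. assert (Hex : exists m, G - eps < u m).
        { apply NNPP. intro Hn. assert (G <= G - eps); [|lra]. apply HG2. intros x [m ->].
          apply Rnot_lt_le. intro; apply Hn; eauto. }
        (* The index K + m (K + 1) stands for the exponent (m + 1)(K + 1), so A^(K+1) with A in
           P^(m+1) can be tested there. *)
        destruct Hex as [m Hm]. exists (K + m * S K)%nat. split; [lia|].
        eapply Rlt_le_trans; [exact Hm|]. apply Hle; auto. intros A HA.
        apply (pow_le_cancel _ _ (S K)); [lia | apply ess_rad_ge0 | now apply pow_le |].
        rewrite <- (ess_rad_mp _ A K (Hgood m A HA)), <- pow_mult.
        replace (S m * S K)%nat with (S (K + m * S K)) by lia. rewrite Hupow. apply Hh.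
        replace (S (K + m * S K)) with (S m * S K)%nat by lia.
        apply mp_in_setpow; trivial; lia.
      - exists 0%nat. intros n _. specialize (HuG n). lra. }
    rewrite HGr. split; [exact HG0|]. split.
    + intros n A Hn HA. destruct n as [|n]; [lia|]. eapply Rle_trans; [apply Hh, HA|].
      rewrite <- Hupow. apply pow_incr; auto.
    + intros x Hx H. apply HG2. intros y [n ->]. apply Hle; trivial. intros A HA. apply H; trivial; lia.
Qed.

Lemma gen_dom (P Q : mset) : bdd P -> bdd Q -> dom P Q -> gr P <= gr Q.
Proof.
  intros HP HQ Hd. destruct (gen_spec P HP) as (_ & _ & Hmin).
  destruct (gen_spec Q HQ) as (H0 & Hub & _). apply Hmin; trivial. intros n A Hn HA.
  destruct (dom_setpow P Q n Hn HP HQ Hd A HA) as (B & HB & Hle).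
  destruct (bdd_setpow P n Hn HP) as [p Hp]. destruct (bdd_setpow Q n Hn HQ) as [q Hq].
  eapply Rle_trans; [apply (ess_rad_mono q A B)|]; auto. apply (Hp A HA).
Qed.

(** For the lower bound, A in P^m has A^n in (P^n)^m, hence er(A)^n <= gr(P^n)^m; the n-th root y of
    gr(P^n) therefore bounds P. *)
Lemma gen_pow (P : mset) (n : nat) : bdd P -> (1 <= n)%nat -> gr (setpow P n) = gr P ^ n.
Proof.
  intros HP Hn. assert (HPn := bdd_setpow P n Hn HP).
  destruct (gen_spec P HP) as (H0 & Hub & Hmin).
  destruct (gen_spec _ HPn) as (H0' & Hub' & Hmin').
  apply Rle_antisym.
  - apply Hmin'; [now apply pow_le|]. intros m A Hm HA. rewrite setpow_mul in HA by trivial.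
    rewrite <- pow_mult. apply Hub; trivial; nia.
  - set (y := hpow (gr (setpow P n)) (/ INR n)).
    assert (Hy : y ^ n = gr (setpow P n)) by now apply hpow_root_pow.
    assert (Hy0 : 0 <= y) by apply hpow_ge0.
    rewrite <- Hy. apply pow_incr. split; trivial. apply Hmin; trivial. intros m A Hm HA.
    apply (pow_le_cancel _ _ n); trivial; [apply ess_rad_ge0 | now apply pow_le|].
    rewrite <- pow_mult, Nat.mul_comm, pow_mult, Hy.
    destruct n as [|n]; [lia|]. destruct (bdd_setpow P m Hm HP) as [b Hb].
    rewrite <- (ess_rad_mp b A n (Hb A HA)). apply Hub'; trivial.
    rewrite setpow_mul, Nat.mul_comm by trivial. now apply mp_in_setpow.
Qed.

Lemma gen_had (m : nat) (alpha : nat -> R) (Psi : nat -> mset) :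
  (forall j, (j < m)%nat -> 0 < alpha j) -> 1 <= sumR m alpha ->
  (forall j, (j < m)%nat -> bdd (Psi j)) ->
  gr (hadset m Psi alpha) <= prodR m (fun j => hpow (gr (Psi j)) (alpha j)).
Proof.
  intros Ha Hs HP. assert (HbH := bdd_hadset m alpha Ha Hs Psi HP).
  destruct (gen_spec _ HbH) as (_ & _ & Hmin). apply Hmin.
  - apply prodR_ge0. intros; apply hpow_ge0.
  - intros n A Hn HA.
    destruct (hadset_setpow_dom m alpha Ha Hs Psi n Hn HP A HA) as (B & (As & HAs & ->) & Hle).
    assert (HPn : forall j, (j < m)%nat -> bdd (setpow (Psi j) n)) by (intros; apply bdd_setpow; auto).
    destruct (bdd_common m _ HPn) as (b & Hb & Hbn).
    assert (HAg : forall j, (j < m)%nat -> good b (As j)) by (intros j Hj; apply (Hbn j Hj); auto).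
    destruct (bdd_setpow _ n Hn HbH) as [e He].
    eapply Rle_trans; [apply (ess_rad_mono (prodR m (fun j => hpow b (alpha j))) A (had m alpha As))|].
    + apply (He A HA).
    + exact Hle.
    + apply (good_had m alpha Ha Hs (fun _ => b)); auto.
    + eapply Rle_trans; [apply (ess_rad_had m alpha b); auto|].
      rewrite <- prodR_pow. apply prodR_le. intros j Hj. split; [apply hpow_ge0|].
      destruct (gen_spec _ (HP j Hj)) as (H0 & Hub & _).
      rewrite <- hpow_pow by auto.
      apply hpow_le; [apply Rlt_le; auto|]. apply Hub; auto.
Qed.

(** * The chains of inequalities, for an abstract radius *)

Section Chain.
Variable r : mset -> R.
Hypothesis r_ge0 : forall P, bdd P -> 0 <= r P.
Hypothesis r_dom : forall P Q, bdd P -> bdd Q -> dom P Q -> r P <= r Q.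
Hypothesis r_pow : forall P n, bdd P -> (1 <= n)%nat -> r (setpow P n) = r P ^ n.
Hypothesis r_had : forall m alpha Psi,
  (forall j, (j < m)%nat -> 0 < alpha j) -> 1 <= sumR m alpha ->
  (forall j, (j < m)%nat -> bdd (Psi j)) ->
  r (hadset m Psi alpha) <= prodR m (fun j => hpow (r (Psi j)) (alpha j)).

(** Both inequalities are compared after raising to the n-th power: on the left r(H)^n = r(H^n) with
    H^n dominated by the Hadamard product of the powers, on the right r(Psi_j^n) = r(Psi_j)^n. *)
Lemma radius_hadset_chain (m : nat) (alpha : nat -> R) (Psi : nat -> mset) (n : nat) :
  (1 <= n)%nat -> (forall j, (j < m)%nat -> 0 < alpha j) -> 1 <= sumR m alpha ->
  (forall j, (j < m)%nat -> bdd (Psi j)) ->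
  r (hadset m Psi alpha) <= hpow (r (hadset m (fun j => setpow (Psi j) n) alpha)) (/ INR n) /\
  hpow (r (hadset m (fun j => setpow (Psi j) n) alpha)) (/ INR n)
    <= prodR m (fun j => hpow (r (Psi j)) (alpha j)).
Proof.
  intros Hn Ha Hs HP.
  assert (Hn0 : 0 <= / INR n) by (apply Rlt_le, Rinv_0_lt_compat, lt_0_INR; lia).
  assert (HbH := bdd_hadset m alpha Ha Hs Psi HP).
  assert (HPn : forall j, (j < m)%nat -> bdd (setpow (Psi j) n)) by (intros; apply bdd_setpow; auto).
  split.
  - rewrite <- (hpow_pow_root (r (hadset m Psi alpha)) n), <- r_pow by auto.
    apply hpow_le; trivial. apply r_dom; auto using bdd_setpow, bdd_hadset.
    now apply hadset_setpow_dom.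
  - rewrite <- (hpow_pow_root (prodR m _) n) by (trivial; apply prodR_ge0; intros; apply hpow_ge0).
    apply hpow_le; trivial. rewrite <- prodR_pow.
    eapply Rle_trans; [now apply r_had|]. right. apply prodR_ext. intros j Hj.
    rewrite r_pow, hpow_pow; auto.
Qed.

Lemma radius_setprod_chain (m : nat) (alpha : nat -> R) (Psi2 : nat -> nat -> mset) (k n : nat) :
  (1 <= n)%nat -> (forall j, (j < m)%nat -> 0 < alpha j) -> 1 <= sumR m alpha -> (1 <= k)%nat ->
  (forall i j, (i < k)%nat -> (j < m)%nat -> bdd (Psi2 i j)) ->
  r (setprod k (fun i => hadset m (fun j => Psi2 i j) alpha))
    <= r (hadset m (fun j => setprod k (fun i => Psi2 i j)) alpha) /\
  r (hadset m (fun j => setprod k (fun i => Psi2 i j)) alpha)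
    <= hpow (r (hadset m (fun j => setpow (setprod k (fun i => Psi2 i j)) n) alpha)) (/ INR n) /\
  hpow (r (hadset m (fun j => setpow (setprod k (fun i => Psi2 i j)) n) alpha)) (/ INR n)
    <= prodR m (fun j => hpow (r (setprod k (fun i => Psi2 i j))) (alpha j)).
Proof.
  intros Hn Ha Hs Hk HP.
  assert (HPk : forall j, (j < m)%nat -> bdd (setprod k (fun i => Psi2 i j))).
  { intros j Hj. apply bdd_setprodS. intros i Hi. apply HP; trivial; lia. }
  split.
  - apply r_dom.
    + apply bdd_setprodS. intros i Hi. apply bdd_hadset; trivial. intros j Hj. apply HP; trivial; lia.
    + now apply bdd_hadset.
    + apply hadset_setprodS_dom; trivial. intros i j Hi Hj. apply HP; trivial; lia.
  - now apply radius_hadset_chain.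
Qed.

(** A Hadamard power is a weighted Hadamard product with one factor, of weight t >= 1 in the
    application; the last chain is thus a special case. *)
Lemma hadset_1 (P : mset) (t : R) : hadset 1 (fun _ => P) (fun _ => t) = setHpow P t.
Proof.
  apply mset_ext. intro A. split.
  - intros (As & HAs & ->). exists (As 0%nat). split; [apply HAs; lia|].
    apply functional_extensionality; intro i. apply functional_extensionality; intro l.
    simpl. apply Rmult_1_l.
  - intros (B & HB & ->). exists (fun _ => B). split; trivial.
    apply functional_extensionality; intro i. apply functional_extensionality; intro l.
    simpl. symmetry; apply Rmult_1_l.
Qed.

Lemma radius_hpow_chain (Phi : nat -> mset) (t : R) (k n : nat) :
  (1 <= n)%nat -> 1 <= t -> (1 <= k)%nat -> (forall i, (i < k)%nat -> bdd (Phi i)) ->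
  r (setprod k (fun i => setHpow (Phi i) t)) <= r (setHpow (setprod k Phi) t) /\
  r (setHpow (setprod k Phi) t) <= hpow (r (setHpow (setpow (setprod k Phi) n) t)) (/ INR n) /\
  hpow (r (setHpow (setpow (setprod k Phi) n) t)) (/ INR n) <= hpow (r (setprod k Phi)) t.
Proof.
  intros Hn Ht Hk HP.
  destruct (radius_setprod_chain 1 (fun _ => t) (fun i _ => Phi i) k n) as (H1 & H2 & H3);
    simpl; auto; intros; try lra.
  simpl in H3. rewrite Rmult_1_l in H3.
  change (fun i => Phi i) with Phi in *.
  rewrite !hadset_1 in *.
  replace (fun i => hadset 1 (fun _ => Phi i) (fun _ => t)) with (fun i => setHpow (Phi i) t) in H1
    by (apply functional_extensionality; intro i; now rewrite hadset_1).
  auto.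
Qed.

End Chain.
End Space.

Theorem theorem3p6 :
  forall (N : option nat) (L : seqC -> Prop) (nrm : seqC -> R),
    (forall p, N = Some p -> (0 < p)%nat) ->
    in_classL N L nrm ->
    order_continuous L nrm ->
    dual_order_continuous L nrm ->
  forall (n : nat), (1 <= n)%nat ->
  forall (r : mset -> R),
    r = gen_ess_rad L nrm \/ r = joint_ess_rad L nrm ->
  (forall (m : nat) (alpha : nat -> R) (Psi : nat -> mset) (k : nat) (Psi2 : nat -> nat -> mset),
     (1 <= m)%nat ->
     (forall j, (j < m)%nat -> 0 < alpha j) ->
     1 <= sumR m alpha ->
     (forall j, (j < m)%nat -> bounded_set N L nrm (Psi j)) ->
     (1 <= k)%nat ->
     (forall i j, (i < k)%nat -> (j < m)%nat -> bounded_set N L nrm (Psi2 i j)) ->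
     (r (hadset m Psi alpha)
        <= hpow (r (hadset m (fun j => setpow (Psi j) n) alpha)) (/ INR n)
      /\ hpow (r (hadset m (fun j => setpow (Psi j) n) alpha)) (/ INR n)
        <= prodR m (fun j => hpow (r (Psi j)) (alpha j)))
     /\
     (r (setprod k (fun i => hadset m (fun j => Psi2 i j) alpha))
        <= r (hadset m (fun j => setprod k (fun i => Psi2 i j)) alpha)
      /\ r (hadset m (fun j => setprod k (fun i => Psi2 i j)) alpha)
        <= hpow (r (hadset m (fun j => setpow (setprod k (fun i => Psi2 i j)) n) alpha)) (/ INR n)
      /\ hpow (r (hadset m (fun j => setpow (setprod k (fun i => Psi2 i j)) n) alpha)) (/ INR n)
        <= prodR m (fun j => hpow (r (setprod k (fun i => Psi2 i j))) (alpha j))))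
  /\
  (forall (k : nat) (Phi : nat -> mset) (t : R),
     (1 <= k)%nat ->
     (forall i, (i < k)%nat -> bounded_set N L nrm (Phi i)) ->
     1 <= t ->
     r (setprod k (fun i => setHpow (Phi i) t)) <= r (setHpow (setprod k Phi) t)
     /\ r (setHpow (setprod k Phi) t)
          <= hpow (r (setHpow (setpow (setprod k Phi) n) t)) (/ INR n)
     /\ hpow (r (setHpow (setpow (setprod k Phi) n) t)) (/ INR n)
          <= hpow (r (setprod k Phi)) t).
Proof.
  intros N L nrm _ HL Hoc _ n Hn r Hr.
  assert (Hb := bounded_set_bdd N L nrm HL).
  assert (H : (forall P, bdd N L nrm P -> 0 <= r P) /\
    (forall P Q, bdd N L nrm P -> bdd N L nrm Q -> dom P Q -> r P <= r Q) /\
    (forall P n, bdd N L nrm P -> (1 <= n)%nat -> r (setpow P n) = r P ^ n) /\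
    (forall m alpha Psi,
      (forall j, (j < m)%nat -> 0 < alpha j) -> 1 <= sumR m alpha ->
      (forall j, (j < m)%nat -> bdd N L nrm (Psi j)) ->
      r (hadset m Psi alpha) <= prodR m (fun j => hpow (r (Psi j)) (alpha j)))).
  { destruct Hr as [-> | ->]; (split; [|split; [|split]]).
    - intros P HP. now apply (gen_spec N L nrm HL Hoc).
    - exact (gen_dom N L nrm HL Hoc).
    - exact (gen_pow N L nrm HL Hoc).
    - exact (gen_had N L nrm HL Hoc).
    - intros P HP. now apply (joint_spec N L nrm HL Hoc).
    - exact (joint_dom N L nrm HL Hoc).
    - exact (joint_pow N L nrm HL Hoc).
    - exact (joint_had N L nrm HL Hoc). }
  destruct H as (H0 & Hdom & Hpow & Hhad). split.
  - intros m alpha Psi k Psi2 _ Ha Hs HPsi Hk HPsi2. split.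
    + apply (radius_hadset_chain N L nrm HL Hoc); auto.
    + apply (radius_setprod_chain N L nrm HL Hoc); auto.
  - intros k Phi t Hk HPhi Ht. apply (radius_hpow_chain N L nrm HL Hoc); auto.
Qed.
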